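(* Let $\mathbb K$ be a field of characteristic $0$, and let $(\mathfrak g,t_{\mathfrak g})$ be a metrized Lie algebra over $\mathbb K$, i.e. a Lie algebra $\mathfrak g$ with $t_{\mathfrak g}\in S^2(\mathfrak g)^{\mathfrak g}$; set $\varphi=[t_{\mathfrak g}^{1,2},t_{\mathfrak g}^{2,3}]\in\wedge^3(\mathfrak g)^{\mathfrak g}$. If $\Phi$ is a Lie associator, then one may take $$\widetilde\varphi=\log(\Phi)(\bar t_{\mathfrak g}^{1,2},\bar t_{\mathfrak g}^{2,3}),$$ where $\bar t_{\mathfrak g}^{i,j}$ is the image of $t_{\mathfrak g}^{i,j}$ in $\widehat S^\cdot(\mathfrak g)^{\widehat\otimes3}$ and the Poisson bracket of $\widehat S^\cdot(\mathfrak g)^{\widehat\otimes3}$ is used in the Lie series $\log(\Phi)$; that is, with this $\widetilde\varphi$, $(\widehat S^\cdot(\mathfrak g),m_0,P_{\mathfrak g^*},\Delta_0,\widetilde\varphi)$ is a lift of the Lie quasi-bialgebra $(\mathfrak g,\mu,\delta=0,\varphi)$, where $\mu$ is the bracket of $\mathfrak g$.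
   Context: $\widehat S^\cdot(\mathfrak g)=\prod_kS^k(\mathfrak g)$ with product $m_0$, $P_{\mathfrak g^*}$ the Kostant–Kirillov Poisson bracket (extending the Lie bracket of $\mathfrak g$), $\Delta_0$ the coproduct for which elements of $\mathfrak g$ are primitive; $\widehat\otimes$ denotes completed tensor products. $t_{\mathfrak g}^{i,j}$ is $t_{\mathfrak g}\in\mathfrak g\otimes\mathfrak g$ placed in the $i$-th and $j$-th tensor factors. A Lie associator is a noncommutative formal series $\Phi(A,B)$ over $\mathbb K$ such that $\log\Phi(A,B)$ is a Lie series of the form $[A,B]+{}$higher degree terms, satisfying the pentagon and hexagon identities of Drinfeld. Explicitly, let $\widehat{\mathcal T}_n$ be the degree completion of the algebra with generators $t^{i,j}=t^{j,i}$ ($1\le i\ne j\le n$) and relations $[t^{i,j}+t^{i,k},t^{j,k}]=0$, $[t^{i,j},t^{k,l}]=0$ for distinct indices; for disjoint $I_1,\dots,I_n\subset\{1,\dots,m\}$ let $x\mapsto x^{I_1,\dots,I_n}$ be the algebra morphism $\widehat{\mathcal T}_n\to\widehat{\mathcal T}_m$, $t^{i,j}\mapsto\sum_{\alpha\in I_i,\beta\in I_j}t^{\alpha,\beta}$. Writing $\Phi$ also for $\Phi(t^{1,2},t^{2,3})\in\widehat{\mathcal T}_3$, the pentagon identity is $\Phi^{1,2,34}\Phi^{12,3,4}=\Phi^{2,3,4}\Phi^{1,23,4}\Phi^{1,2,3}$ and the hexagon identities are, for some constant $\kappa\in\mathbb K$, $e^{\kappa(t^{1,3}+t^{2,3})/2}=\Phi^{3,1,2}e^{\kappa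 t^{1,3}/2}(\Phi^{1,3,2})^{-1}e^{\kappa t^{2,3}/2}\Phi^{1,2,3}$ and $e^{\kappa(t^{1,2}+t^{1,3})/2}=(\Phi^{2,3,1})^{-1}e^{\kappa t^{1,3}/2}\Phi^{2,1,3}e^{\kappa t^{1,2}/2}(\Phi^{1,2,3})^{-1}$. A Drinfeld algebra is a quintuple $(A,m_0,P,\Delta,\widetilde\varphi)$ where: $(A,m_0)$ is a formal series algebra with maximal ideal $\mathfrak m_A$; $P$ is a Poisson structure on $A$ with $\mathrm{Im}(P)\subset\mathfrak m_A$; $\Delta:A\to A\widehat\otimes A$ is a continuous Poisson algebra morphism with $(\epsilon\otimes\mathrm{id})\Delta=(\mathrm{id}\otimes\epsilon)\Delta=\mathrm{id}$, $\epsilon:A\to A/\mathfrak m_A=\mathbb K$; and $\widetilde\varphi\in(\mathfrak m_A)^{\widehat\otimes3}$ satisfies $(\mathrm{id}\otimes\Delta)(\Delta(a))=\widetilde\varphi\star(\Delta\otimes\mathrm{id})(\Delta(a))\star(-\widetilde\varphi)$ for $a\in A$, and $\widetilde\varphi^{1,2,34}\star\widetilde\varphi^{12,3,4}=\widetilde\varphi^{2,3,4}\star\widetilde\varphi^{1,23,4}\star\widetilde\varphi^{1,2,3}$, where $f\star g=f+g+\frac12P(f,g)+\cdots$ is the Campbell–Baker–Hausdorff series for the Poisson bracket (so $f\star b\star(-f)=\exp(P(f,-))(b)$), $\widetilde\varphi^{12,3,4}=(\Delta\otimes\mathrm{id}\otimes\mathrm{id})(\widetilde\varphi)$, etc.,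 $\widetilde\varphi^{1,2,3}=\widetilde\varphi\otimes1$, $\widetilde\varphi^{2,3,4}=1\otimes\widetilde\varphi$. Reduction: set $\mathfrak g=\mathfrak m_A/\mathfrak m_A^2$; $P$ induces a Lie bracket $\mu$ on $\mathfrak g$, $\Delta-\Delta^{2,1}$ induces $\delta:\mathfrak g\to\Lambda^2(\mathfrak g)$, and the class of $\mathrm{Alt}(\widetilde\varphi)$ in $\mathfrak g^{\otimes3}$ is $\varphi\in\Lambda^3(\mathfrak g)$, with $\mathrm{Alt}=\frac16\sum_{\sigma\in\mathfrak S_3}\mathrm{sgn}(\sigma)\sigma$. A lift of $(\mathfrak g,\mu,\delta,\varphi)$ is a Drinfeld algebra whose reduction is $(\mathfrak g,\mu,\delta,\varphi)$. *)

(* Defs.v *)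
From HB Require Import structures.
From mathcomp Require Import all_boot all_order all_algebra perm.
From mathcomp Require Import boolp classical_sets.

Set Implicit Arguments.
Unset Strict Implicit.
Unset Printing Implicit Defensive.

Import GRing.Theory.
Local Open Scope ring_scope.
Local Open Scope quotient_scope.

(******************************************************************************)
(* Associative unital algebras presented by generators and relations, and     *)
(* their degree completions.  One construction serves for the free algebra    *)
(* K<<A, B>>, for the algebra of infinitesimal braids and for the symmetric   *)
(* algebra of an arbitrary (possibly infinite-dimensional) vector space.      *)
(******************************************************************************)

Section Presentations.
Variables (K : fieldType) (X : Type).

Inductive nexp : Type :=
| NCst of K
| NGen of X
| NAdd of nexp & nexp
| NMul of nexp & nexp.

HB.instance Definition _ := gen_eqMixin nexp.
HB.instance Definition _ := gen_choiceMixin nexp.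

Fixpoint neval (B : algType K) (th : X -> B) (e : nexp) : B :=
  match e with
  | NCst c => c%:A
  | NGen x => th x
  | NAdd e1 e2 => neval th e1 + neval th e2
  | NMul e1 e2 => neval th e1 * neval th e2
  end.

(* The derivation along the morphism [neval th] that sends x to D x. *)
Fixpoint nder (B : algType K) (th D : X -> B) (e : nexp) : B :=
  match e with
  | NCst _ => 0
  | NGen x => D x
  | NAdd e1 e2 => nder th D e1 + nder th D e2
  | NMul e1 e2 =>
      nder th D e1 * neval th e2 + neval th e1 * nder th D e2
  end.

Definition naug (e : nexp) : K := neval (fun _ : X => 0 : K^o) e.

(* Relations are required to hold at the augmentation point, so that the      *)
(* presented algebra is not the zero ring.                                    *)
Record presentation := Presentation {
  prel :> nexp -> nexp -> Prop;
  prel_aug : forall e f, prel e f -> naug e = naug f }.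

Inductive pcong (R : presentation) : nexp -> nexp -> Prop :=
| pc_rel e f : prel R e f -> pcong R e f
| pc_refl e : pcong R e e
| pc_sym e f : pcong R e f -> pcong R f e
| pc_trans e f g : pcong R e f -> pcong R f g -> pcong R e g
| pc_add e e' f f' :
    pcong R e e' -> pcong R f f' -> pcong R (NAdd e f) (NAdd e' f')
| pc_mul e e' f f' :
    pcong R e e' -> pcong R f f' -> pcong R (NMul e f) (NMul e' f')
| pc_addA e f g : pcong R (NAdd e (NAdd f g)) (NAdd (NAdd e f) g)
| pc_addC e f : pcong R (NAdd e f) (NAdd f e)
| pc_add0 e : pcong R (NAdd (NCst 0) e) e
| pc_addN e : pcong R (NAdd (NMul (NCst (-1)) e) e) (NCst 0)
| pc_mulA e f g : pcong R (NMul e (NMul f g)) (NMul (NMul e f) g)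
| pc_mul1 e : pcong R (NMul (NCst 1) e) e
| pc_mulDl e f g : pcong R (NMul (NAdd e f) g) (NAdd (NMul e g) (NMul f g))
| pc_mulDr e f g : pcong R (NMul e (NAdd f g)) (NAdd (NMul e f) (NMul e g))
| pc_cstD a b : pcong R (NAdd (NCst a) (NCst b)) (NCst (a + b))
| pc_cstM a b : pcong R (NMul (NCst a) (NCst b)) (NCst (a * b))
| pc_cstC a e : pcong R (NMul (NCst a) e) (NMul e (NCst a)).

Lemma neval_pcong (R : presentation) (B : algType K) (th : X -> B) :
  (forall e f, prel R e f -> neval th e = neval th f) ->
  forall e f, pcong R e f -> neval th e = neval th f.
Proof.
move=> thR e f; elim => {e f} /=.
- exact: thR.
- by [].
- by move=> e f _ ->.
- by move=> e f g _ -> _ ->.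
- by move=> e e' f f' _ -> _ ->.
- by move=> e e' f f' _ -> _ ->.
- by move=> e f g; rewrite addrA.
- by move=> e f; rewrite addrC.
- by move=> e; rewrite scale0r add0r.
- by move=> e; rewrite scaleN1r mulN1r scale0r addNr.
- by move=> e f g; rewrite mulrA.
- by move=> e; rewrite scale1r mul1r.
- by move=> e f g; rewrite mulrDl.
- by move=> e f g; rewrite mulrDr.
- by move=> a b; rewrite scalerDl.
- by move=> a b; rewrite -scalerAl mul1r scalerA.
- by move=> a e; rewrite -scalerAl mul1r -scalerAr mulr1.
Qed.

Section Quotient.
Variable R : presentation.

Definition pcongb (e f : nexp) : bool := `[< pcong R e f >].

Fact pcongb_refl : reflexive pcongb.
Proof. by move=> e; apply/asboolP; apply: pc_refl. Qed.
Fact pcongb_sym : symmetric pcongb.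
Proof. by move=> e f; apply/asboolP/asboolP => /pc_sym. Qed.
Fact pcongb_trans : transitive pcongb.
Proof.
by move=> f e g /asboolP ef /asboolP fg; apply/asboolP; apply: pc_trans fg.
Qed.
Canonical pcong_equiv := EquivRel pcongb pcongb_refl pcongb_sym pcongb_trans.

Definition palg := {eq_quot pcong_equiv}.
HB.instance Definition _ := Choice.on palg.
HB.instance Definition _ := EqQuotient.on palg.

Lemma palgP (e f : nexp) : pcong R e f <-> \pi_palg e = \pi_palg f.
Proof.
split; first by move=> ef; apply/eqmodP/asboolP.
by move=> /eqmodP/asboolP.
Qed.

Lemma repr_pcong (e : nexp) : pcong R (repr (\pi_palg e)) e.
Proof. by apply/palgP; rewrite reprK. Qed.

Definition padd := lift_op2 palg NAdd.
Definition pmul := lift_op2 palg NMul.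
Definition popp := lift_op1 palg (NMul (NCst (-1))).
Definition pcst := lift_embed palg NCst.
Definition pgen (x : X) : palg := \pi_palg (NGen x).

Lemma pi_padd : {morph \pi_palg : e f / NAdd e f >-> padd e f}.
Proof.
move=> e f; unlock padd; apply/palgP; apply: pc_add; apply: pc_sym;
  exact: repr_pcong.
Qed.
Canonical pi_padd_morph := PiMorph2 pi_padd.
Lemma pi_pmul : {morph \pi_palg : e f / NMul e f >-> pmul e f}.
Proof.
move=> e f; unlock pmul; apply/palgP; apply: pc_mul; apply: pc_sym;
  exact: repr_pcong.
Qed.
Canonical pi_pmul_morph := PiMorph2 pi_pmul.
Lemma pi_popp : {morph \pi_palg : e / NMul (NCst (-1)) e >-> popp e}.
Proof.
move=> e; unlock popp; apply/palgP; apply: pc_mul; first exact: pc_refl.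
exact/pc_sym/repr_pcong.
Qed.
Canonical pi_popp_morph := PiMorph1 pi_popp.
Canonical pi_pcst_morph := PiEmbed pcst.

Local Ltac plift := repeat (let x := fresh "x" in
  move=> x; elim/quotW: x => x); rewrite !piE; apply/palgP.

Fact paddA : associative padd. Proof. plift; exact: pc_addA. Qed.
Fact paddC : commutative padd. Proof. plift; exact: pc_addC. Qed.
Fact padd0 : left_id (pcst 0) padd. Proof. plift; exact: pc_add0. Qed.
Fact paddN : left_inverse (pcst 0) popp padd.
Proof. plift; exact: pc_addN. Qed.
Fact pmulA : associative pmul. Proof. plift; exact: pc_mulA. Qed.
Fact pmul1 : left_id (pcst 1) pmul. Proof. plift; exact: pc_mul1. Qed.
Fact pmulr1 : right_id (pcst 1) pmul.
Proof. plift; apply: pc_trans (pc_mul1 _ _); apply: pc_sym; exact: pc_cstC. Qed.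
Fact pmulDl : left_distributive pmul padd.
Proof. plift; exact: pc_mulDl. Qed.
Fact pmulDr : right_distributive pmul padd.
Proof. plift; exact: pc_mulDr. Qed.

HB.instance Definition _ := GRing.isPzRing.Build palg
  paddA paddC padd0 paddN pmulA pmul1 pmulr1 pmulDl pmulDr.

Fact palg_nonzero : (1 : palg) != 0.
Proof.
apply/eqP; rewrite -[1]/(pcst 1) -[0]/(pcst 0) !piE => /palgP.
move=> /(@neval_pcong R K^o (fun _ => 0) (@prel_aug R)) /=.
by rewrite scale1r scale0r; apply/eqP/oner_neq0.
Qed.
HB.instance Definition _ := GRing.PzSemiRing_isNonZero.Build palg palg_nonzero.

Definition pscale (c : K) (x : palg) : palg := pcst c * x.

Fact pcstM a b : pcst (a * b) = pcst a * pcst b.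
Proof. by rewrite -[RHS]/(pmul _ _) !piE; apply/palgP/pc_sym/pc_cstM. Qed.
Fact pcstD a b : pcst (a + b) = pcst a + pcst b.
Proof. by rewrite -[RHS]/(padd _ _) !piE; apply/palgP/pc_sym/pc_cstD. Qed.
Fact pcstC a x : pcst a * x = x * pcst a.
Proof.
elim/quotW: x => x; rewrite -[LHS]/(pmul _ _) -[RHS]/(pmul _ _) !piE.
exact/palgP/pc_cstC.
Qed.

Fact pscaleA a b x : pscale a (pscale b x) = pscale (a * b) x.
Proof. by rewrite /pscale mulrA pcstM. Qed.
Fact pscale1 : left_id 1 pscale.
Proof. by move=> x; apply: pmul1. Qed.
Fact pscaleDr : right_distributive pscale +%R.
Proof. by move=> a x y; apply: mulrDr. Qed.
Fact pscaleDl x : {morph pscale^~ x : a b / a + b}.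
Proof. by move=> a b; rewrite /pscale pcstD mulrDl. Qed.
HB.instance Definition _ := GRing.Zmodule_isLmodule.Build K palg
  pscaleA pscale1 pscaleDr pscaleDl.

Fact pscaleAl (a : K) (x y : palg) : a *: (x * y) = (a *: x) * y.
Proof. exact: mulrA. Qed.
HB.instance Definition _ := GRing.Lmodule_isLalgebra.Build K palg pscaleAl.
Fact pscaleAr (a : K) (x y : palg) : a *: (x * y) = x * (a *: y).
Proof. by rewrite -[LHS]/(_ * (_ * _)) -[a *: y]/(_ * _) !mulrA pcstC. Qed.
HB.instance Definition _ := GRing.Lalgebra_isAlgebra.Build K palg pscaleAr.

(* Universal property: [peval th] is the algebra morphism extending th as     *)
(* soon as th satisfies the relations.                                        *)
Definition peval (B : algType K) (th : X -> B) (x : palg) : B :=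
  neval th (repr x).

Lemma pevalE (B : algType K) (th : X -> B) :
  (forall e f, prel R e f -> neval th e = neval th f) ->
  forall e, peval th (\pi_palg e) = neval th e.
Proof. by move=> thR e; apply: neval_pcong thR _ _ (repr_pcong e). Qed.

(* The span of the words of length k in the generators. *)
Definition homog (k : nat) (x : palg) : Prop :=
  exists s : seq (K * k.-tuple X),
    x = \sum_(p <- s) p.1 *: \prod_(a <- p.2) pgen a.

Lemma homog0 k : homog k 0.
Proof. by exists [::]; rewrite big_nil. Qed.

Lemma homogD k x y : homog k x -> homog k y -> homog k (x + y).
Proof. by move=> [s ->] [s' ->]; exists (s ++ s'); rewrite big_cat. Qed.

Lemma homogZ k c x : homog k x -> homog k (c *: x).
Proof.
move=> [s ->]; exists [seq (c * p.1, p.2) | p <- s].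
by rewrite big_map scaler_sumr; apply: eq_bigr => p _; rewrite scalerA.
Qed.

Lemma homog_sum k (I : Type) (r : seq I) (P : pred I) (F : I -> palg) :
  (forall i, P i -> homog k (F i)) -> homog k (\sum_(i <- r | P i) F i).
Proof.
by move=> FP; apply: big_ind => //; [apply: homog0 | apply: homogD].
Qed.

Lemma homogM k l x y : homog k x -> homog l y -> homog (k + l) (x * y).
Proof.
move=> [s ->] [s' ->]; rewrite mulr_suml; apply: homog_sum => p _.
rewrite mulr_sumr; apply: homog_sum => q _.
exists [:: (p.1 * q.1, [tuple of p.2 ++ q.2])].
by rewrite big_seq1 /= big_cat /= -scalerAl -scalerAr scalerA.
Qed.

Lemma homog1 : homog 0 1.
Proof. by exists [:: (1, [tuple])]; rewrite big_seq1 big_nil scale1r. Qed.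

Lemma homog_gen a : homog 1 (pgen a).
Proof. by exists [:: (1, [tuple a])]; rewrite !big_seq1 scale1r. Qed.

(* The degree completion, i.e. the product over k of the degree k parts. *)
Record cpalg := CPAlg {
  ccomp :> nat -> palg;
  ccompP : `[< forall k, homog k (ccomp k) >] }.

HB.instance Definition _ := gen_eqMixin cpalg.
HB.instance Definition _ := gen_choiceMixin cpalg.

Lemma cpalgP (f g : cpalg) : (forall k, f k = g k) -> f = g.
Proof.
case: f g => [f fP] [g gP] /= /funext fg; case: _ / fg gP => gP.
by congr CPAlg; apply: bool_irrelevance.
Qed.

Lemma chomog (f : cpalg) k : homog k (f k).
Proof. by have /asboolP := ccompP f. Qed.

Definition mkc (u : nat -> palg) (uP : forall k, homog k (u k)) : cpalg :=
  CPAlg (asboolT uP).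

Definition czero : cpalg := mkc homog0.
Fact cone_subproof k : homog k (if k == 0%N then 1 else 0).
Proof. by case: k => [|k]; [apply: homog1 | apply: homog0]. Qed.
Definition cone : cpalg := mkc cone_subproof.
Definition cadd (f g : cpalg) : cpalg :=
  mkc (fun k => homogD (chomog f k) (chomog g k)).
Definition cscale (c : K) (f : cpalg) : cpalg :=
  mkc (fun k => homogZ c (chomog f k)).
Definition copp (f : cpalg) : cpalg := cscale (-1) f.
Fact cmul_subproof (f g : cpalg) k :
  homog k (\sum_(i < k.+1) f i * g (k - i)%N).
Proof.
apply: homog_sum => i _.
by rewrite -{1}(subnKC (ltn_ord i : (i <= k)%N)); apply: homogM; apply: chomog.
Qed.
Definition cmul (f g : cpalg) : cpalg := mkc (cmul_subproof f g).

Let tr (n : nat) (f : nat -> palg) : {poly palg} := \poly_(i < n) f i.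

Let cmul_tr n k (f g : cpalg) : (k < n)%N -> cmul f g k = (tr n f * tr n g)`_k.
Proof.
move=> kn; rewrite coefM /=; apply: eq_bigr => i _.
rewrite !coef_poly (leq_trans (ltn_ord i) kn).
by rewrite (leq_ltn_trans (leq_subr i k) kn).
Qed.

Fact caddA : associative cadd.
Proof. by move=> f g h; apply: cpalgP => k /=; rewrite addrA. Qed.
Fact caddC : commutative cadd.
Proof. by move=> f g; apply: cpalgP => k /=; rewrite addrC. Qed.
Fact cadd0 : left_id czero cadd.
Proof. by move=> f; apply: cpalgP => k /=; rewrite add0r. Qed.
Fact caddN : left_inverse czero copp cadd.
Proof. by move=> f; apply: cpalgP => k /=; rewrite scaleN1r addNr. Qed.
Fact cmulA : associative cmul.
Proof.
move=> f g h; apply: cpalgP => k.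
transitivity ((tr k.+1 f * (tr k.+1 g * tr k.+1 h))`_k).
  rewrite coefM /=; apply: eq_bigr => i _; rewrite coef_poly ltn_ord.
  by rewrite -cmul_tr // ltnS leq_subr.
rewrite mulrA coefM /=; apply: eq_bigr => i _.
by rewrite coef_poly ltnS leq_subr -cmul_tr.
Qed.
Fact cmul1 : left_id cone cmul.
Proof.
move=> f; apply: cpalgP => k /=.
rewrite big_ord_recl /= mul1r subn0 big1 ?addr0 // => i _.
by rewrite /bump /= mul0r.
Qed.
Fact cmulr1 : right_id cone cmul.
Proof.
move=> f; apply: cpalgP => k /=.
rewrite big_ord_recr /= subnn mulr1 big1 ?add0r // => i _.
by rewrite subn_eq0 leqNgt ltn_ord mulr0.
Qed.
Fact cmulDl : left_distributive cmul cadd.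
Proof.
move=> f g h; apply: cpalgP => k /=.
by rewrite -big_split; apply: eq_bigr => i _; rewrite /= mulrDl.
Qed.
Fact cmulDr : right_distributive cmul cadd.
Proof.
move=> f g h; apply: cpalgP => k /=.
by rewrite -big_split; apply: eq_bigr => i _; rewrite /= mulrDr.
Qed.

HB.instance Definition _ := GRing.isPzRing.Build cpalg
  caddA caddC cadd0 caddN cmulA cmul1 cmulr1 cmulDl cmulDr.

Fact cpalg_nonzero : (1 : cpalg) != 0.
Proof.
by apply/eqP => /(congr1 (ccomp^~ 0%N)) /= /eqP; rewrite oner_eq0.
Qed.
HB.instance Definition _ :=
  GRing.PzSemiRing_isNonZero.Build cpalg cpalg_nonzero.

Fact cscaleA a b f : cscale a (cscale b f) = cscale (a * b) f.
Proof. by apply: cpalgP => k /=; rewrite scalerA. Qed.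
Fact cscale1 : left_id 1 cscale.
Proof. by move=> f; apply: cpalgP => k /=; rewrite scale1r. Qed.
Fact cscaleDr : right_distributive cscale +%R.
Proof. by move=> a f g; apply: cpalgP => k /=; rewrite scalerDr. Qed.
Fact cscaleDl f : {morph cscale^~ f : a b / a + b}.
Proof. by move=> a b; apply: cpalgP => k /=; rewrite scalerDl. Qed.
HB.instance Definition _ := GRing.Zmodule_isLmodule.Build K cpalg
  cscaleA cscale1 cscaleDr cscaleDl.
Fact cscaleAl (a : K) (f g : cpalg) : a *: (f * g) = (a *: f) * g.
Proof.
apply: cpalgP => k /=; rewrite scaler_sumr.
by apply: eq_bigr => i _; rewrite scalerAl.
Qed.
HB.instance Definition _ := GRing.Lmodule_isLalgebra.Build K cpalg cscaleAl.
Fact cscaleAr (a : K) (f g : cpalg) : a *: (f * g) = f * (a *: g).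
Proof.
apply: cpalgP => k /=; rewrite scaler_sumr.
by apply: eq_bigr => i _; rewrite scalerAr.
Qed.
HB.instance Definition _ := GRing.Lalgebra_isAlgebra.Build K cpalg cscaleAr.

Fact cgen_subproof a k : homog k (if k == 1%N then pgen a else 0).
Proof.
by case: eqP => [->|_]; [apply: homog_gen | apply: homog0].
Qed.
Definition cgen (a : X) : cpalg := mkc (cgen_subproof a).

(* Elements all of whose components of degree < k vanish. *)
Definition filt (k : nat) (f : cpalg) : Prop := forall j, (j < k)%N -> f j = 0.

(* The sum of a series converging for the product of the discrete topologies: *)
(* in each degree k only finitely many terms contribute, and they are summed  *)
(* up to some N beyond which all terms vanish in degree k.                    *)
Definition csum_bound (u : nat -> cpalg) (k : nat) : nat :=
  xget 0%N (fun N => forall p, (N <= p)%N -> u p k = 0).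
Fact csum_subproof (u : nat -> cpalg) k :
  homog k (\sum_(p < csum_bound u k) u p k).
Proof. by apply: homog_sum => p _; apply: chomog. Qed.
Definition csum (u : nat -> cpalg) : cpalg := mkc (csum_subproof u).

Lemma csumE (u : nat -> cpalg) k N :
  (forall p, (N <= p)%N -> u p k = 0) -> csum u k = \sum_(p < N) u p k.
Proof.
move=> uN /=; rewrite /csum_bound.
case: xgetP => [M _ uM|/(_ N)//].
have sumE (n m : nat) : (forall p, (n <= p)%N -> u p k = 0) ->
    \sum_(p < maxn n m) u p k = \sum_(p < n) u p k.
  move=> un; rewrite -!(big_mkord xpredT (fun p => u p k)).
  rewrite (@big_cat_nat _ _ _ n) ?leq_maxl //= [X in _ + X]big_nat_cond.
  by rewrite [X in _ + X]big1 ?addr0 // => p /andP[/andP[/un]].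
by rewrite -(sumE M N uM) maxnC sumE.
Qed.

Definition cexp (x : cpalg) : cpalg := csum (fun p => (p`!%:R)^-1 *: x ^+ p).

(* log x and x^-1 for x with constant term 1. *)
Definition clog (x : cpalg) : cpalg :=
  csum (fun p => ((-1) ^+ p / p.+1%:R) *: (x - 1) ^+ p.+1).
Definition cinv (x : cpalg) : cpalg := csum (fun p => (1 - x) ^+ p).

End Quotient.
End Presentations.

Arguments pgen {K X R} x.
Arguments cgen {K X R} a.

(* The continuous algebra morphism extending th, where th sends generators to *)
(* elements without constant term and respects the relations of R.            *)
Definition cmor (K : fieldType) (X Y : Type) (R : presentation K X)
    (R' : presentation K Y) (th : X -> cpalg R') (f : cpalg R) : cpalg R' :=
  csum (fun p => peval th (f p)).

(******************************************************************************)
(* Lie series in K<<A, B>>, and their evaluation in a Lie algebra.            *)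
(******************************************************************************)

Section LieSeries.
Variables (K : fieldType) (X : Type).

Definition no_rel (e f : nexp K X) : Prop := False.
Fact no_rel_aug e f : no_rel e f -> naug e = naug f.
Proof. by []. Qed.
Definition free_pres := Presentation no_rel_aug.

Inductive lmon : Type := LGen of X | LBr of lmon & lmon.
HB.instance Definition _ := gen_eqMixin lmon.
HB.instance Definition _ := gen_choiceMixin lmon.

Fixpoint ldeg (m : lmon) : nat :=
  if m is LBr m1 m2 then (ldeg m1 + ldeg m2)%N else 1%N.

Fixpoint leval (L : Type) (br : L -> L -> L) (th : X -> L) (m : lmon) : L :=
  match m with
  | LGen x => th x
  | LBr m1 m2 => br (leval br th m1) (leval br th m2)
  end.

Definition lpeval (L : lmodType K) (br : L -> L -> L) (th : X -> L)
    (s : seq (K * lmon)) : L :=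
  \sum_(p <- s) p.1 *: leval br th p.2.

Definition commutator (B : algType K) (x y : B) : B := x * y - y * x.

(* s is a Lie polynomial expression, homogeneous of degree k, for x. *)
Definition lie_expr (k : nat) (x : palg free_pres) (s : seq (K * lmon)) : Prop :=
  all (fun p => ldeg p.2 == k) s /\
  x = lpeval (@commutator (palg free_pres)) pgen s.

Definition lie_series (f : cpalg free_pres) : Prop :=
  forall k, exists s, lie_expr k (f k) s.

(* The image of a Lie series f under the continuous Lie algebra morphism      *)
(* x |-> th x.  The choice of the expressions is immaterial, since the free   *)
(* Lie algebra embeds in the free associative algebra.                        *)
Definition lie_eval (Y : Type) (R : presentation K Y)
    (br : cpalg R -> cpalg R -> cpalg R) (th : X -> cpalg R)
    (f : cpalg free_pres) : cpalg R :=
  csum (fun k => lpeval br th (xget [::] (lie_expr k (f k)))).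

End LieSeries.

(* K<<A, B>>, with A = false and B = true. *)
Definition ncseries (K : fieldType) := cpalg (free_pres K bool).

Definition subst2 (T : Type) (a b : T) (i : bool) : T := if i then b else a.

Definition cbh (K : fieldType) : ncseries K :=
  clog (cexp (cgen false) * cexp (cgen true)).

(* The Campbell-Baker-Hausdorff product f + g + br f g / 2 + ... *)
Definition star (K : fieldType) (Y : Type) (R : presentation K Y)
    (br : cpalg R -> cpalg R -> cpalg R) (f g : cpalg R) : cpalg R :=
  lie_eval br (subst2 f g) (cbh K).

(******************************************************************************)
(* Lie associators.                                                           *)
(******************************************************************************)

Section Associators.
Variable K : fieldType.

(* The generator (i, j) is t^{i+1,j+1}; the symbols t^{i,i} are set to 0. *)
Inductive braid_rel (n : nat) :
  nexp K ('I_n * 'I_n) -> nexp K ('I_n * 'I_n) -> Prop :=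
| br_diag i : braid_rel (NGen K (i, i)) (NCst _ 0)
| br_sym i j : braid_rel (NGen K (i, j)) (NGen K (j, i))
| br_4T i j k : uniq [:: i; j; k] ->
    braid_rel
      (NMul (NAdd (NGen K (i, j)) (NGen K (i, k))) (NGen K (j, k)))
      (NMul (NGen K (j, k)) (NAdd (NGen K (i, j)) (NGen K (i, k))))
| br_comm i j k l : uniq [:: i; j; k; l] ->
    braid_rel (NMul (NGen K (i, j)) (NGen K (k, l)))
              (NMul (NGen K (k, l)) (NGen K (i, j))).

Fact braid_rel_aug n (e f : nexp K ('I_n * 'I_n)) :
  braid_rel e f -> naug e = naug f.
Proof. by case=> * /=; rewrite /naug /= ?scale0r ?addr0 ?mulr0 ?mul0r. Qed.

Definition braid_pres n := Presentation (@braid_rel_aug n).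

Definition That (n : nat) := cpalg (braid_pres n).

(* The slot with 1-based number k. *)
Definition sl (m k : nat) : 'I_m.+1 := inord k.-1.

Definition tgen (m i j : nat) : That m.+1 := cgen (sl m i, sl m j).

(* x |-> x^{I_1,...,I_n}; the I_k are lists of 1-based slot numbers. *)
Definition insertion (n m : nat) (I : n.-tuple (seq nat)) :
    That n -> That m.+1 :=
  cmor (fun p : 'I_n * 'I_n =>
    if p.1 == p.2 then 0 else
    \sum_(a <- tnth I p.1) \sum_(b <- tnth I p.2) tgen m a b).

Definition assoc3 (Phi : ncseries K) : That 3 :=
  cmor (subst2 (tgen 2 1 2) (tgen 2 2 3)) Phi.

Definition pentagon (Phi : ncseries K) : Prop :=
  let ph I : That 4 := @insertion 3 3 I (assoc3 Phi) in
  ph [tuple [:: 1]; [:: 2]; [:: 3; 4]]%N * ph [tuple [:: 1; 2]; [:: 3]; [:: 4]]%N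
  = ph [tuple [:: 2]; [:: 3]; [:: 4]]%N * ph [tuple [:: 1]; [:: 2; 3]; [:: 4]]%N
    * ph [tuple [:: 1]; [:: 2]; [:: 3]]%N.

(* Phi^{i,j,k} *)
Definition assoc_perm (Phi : ncseries K) (i j k : nat) : That 3 :=
  @insertion 3 2 [tuple [:: i]; [:: j]; [:: k]] (assoc3 Phi).

Definition hexagons (kappa : K) (Phi : ncseries K) : Prop :=
  let ph := assoc_perm Phi in
  let ex (x : That 3) : That 3 := cexp ((kappa / 2) *: x) in
  let t13 := tgen 2 1 3 in let t23 := tgen 2 2 3 in let t12 := tgen 2 1 2 in
  ex (t13 + t23)
    = ph 3%N 1%N 2%N * ex t13 * cinv (ph 1%N 3%N 2%N) * ex t23
      * ph 1%N 2%N 3%N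
  /\ ex (t12 + t13)
    = cinv (ph 2%N 3%N 1%N) * ex t13 * ph 2%N 1%N 3%N * ex t12
      * cinv (ph 1%N 2%N 3%N).

Record lie_associator (Phi : ncseries K) : Prop := LieAssociator {
  assoc_const : Phi 0%N = 1;
  assoc_lie : lie_series (clog Phi);
  assoc_lead :
    filt 3 (clog Phi - commutator (cgen false : ncseries K) (cgen true));
  assoc_pentagon : pentagon Phi;
  assoc_hexagon : exists kappa : K, hexagons kappa Phi }.

End Associators.

(******************************************************************************)
(* The formal series algebra A = S^(V), and its completed tensor powers.      *)
(* A formal series algebra is an algebra isomorphic to some S^(V), where V is *)
(* necessarily m_A / m_A^2; Drinfeld algebras are taken in that form.         *)
(******************************************************************************)

Section SymHat.
Variable K : fieldType.

Inductive sym_rel (W : lmodType K) : nexp K W -> nexp K W -> Prop :=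
| sym_comm u v :
    sym_rel (NMul (NGen K u) (NGen K v)) (NMul (NGen K v) (NGen K u))
| sym_lin c u v :
    sym_rel (NGen K (c *: u + v)) (NAdd (NMul (NCst _ c) (NGen K u)) (NGen K v)).

Fact sym_rel_aug (W : lmodType K) (e f : nexp K W) :
  sym_rel e f -> naug e = naug f.
Proof. by case=> * /=; rewrite /naug /= ?mulr0 ?addr0. Qed.

Definition sym_pres (W : lmodType K) := Presentation (@sym_rel_aug W).

Definition symhat (W : lmodType K) := cpalg (sym_pres W).

(* The bracket that is a continuous derivation in each argument and sends a   *)
(* pair of generators (x, y) to beta x y.                                     *)
Definition bider (W : lmodType K) (beta : W -> W -> symhat W)
    (f g : symhat W) : symhat W :=
  csum (fun p => csum (fun q =>
    nder cgen (fun x => nder cgen (beta x) (repr (g q))) (repr (f p)))).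

(* S^(V)^{(x)n}, realised as S^(V^n): the i-th factor is generated by the i-th *)
(* summand of V^n.                                                            *)
Definition tpow (V : lmodType K) (n : nat) := symhat {ffun 'I_n -> V}.

Variable V : lmodType K.

Definition emb n (i : 'I_n) (x : V) : {ffun 'I_n -> V} :=
  [ffun j => if j == i then x else 0].

(* a |-> 1 (x) ... (x) a (x) ... (x) 1, with a in slot i. *)
Definition slot n (i : 'I_n) : symhat V -> tpow V n :=
  cmor (fun x => cgen (emb i x)).

(* Puts the i-th factor in slot s i. *)
Definition place_in n m (s : 'I_n -> 'I_m) : tpow V n -> tpow V m :=
  cmor (fun u : {ffun 'I_n -> V} => \sum_i cgen (emb (s i) (u i))).

(* a_1 (x) ... (x) a_n |-> F_1(a_1) ... F_n(a_n), for continuous algebra      *)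
(* morphisms F_i.                                                             *)
Definition tmap n m (F : n.-tuple (symhat V -> tpow V m)) :
    tpow V n -> tpow V m :=
  cmor (fun u : {ffun 'I_n -> V} => \sum_i tnth F i (cgen (u i))).

(* The extension to A^{(x)n} of a bracket on A: distinct factors commute. *)
Definition tpoisson (P : symhat V -> symhat V -> symhat V) n :
    tpow V n -> tpow V n -> tpow V n :=
  bider (fun u v : {ffun 'I_n -> V} =>
    \sum_i slot i (P (cgen (u i)) (cgen (v i)))).

(* x_1 (x) ... (x) x_n; V^{(x)n} is the span of these in A^{(x)n}. *)
Definition ptens n (x : n.-tuple V) : tpow V n :=
  \prod_(i < n) cgen (emb i (tnth x i)).

(* The completed tensor power of m_A: as m_A is generated by V, each component *)
(* lies in the ideal generated by the tensors x_1 (x) ... (x) x_n.            *)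
Definition maxtens n (f : tpow V n) : Prop :=
  forall k, exists s : seq (n.-tuple V * palg (sym_pres {ffun 'I_n -> V})),
    f k = \sum_(p <- s) (\prod_(i < n) pgen (emb i (tnth p.1 i))) * p.2.

(* m_A is the set of series without constant term, i.e. [filt 1], and (the    *)
(* closure of) m_A^k is [filt k].                                             *)
Definition continuous_at0 (W W' : lmodType K) (F : symhat W -> symhat W') :=
  forall k, exists l, forall f, filt l f -> filt k (F f).

Record poisson_structure (W : lmodType K)
    (P : symhat W -> symhat W -> symhat W) : Prop := PoissonStructure {
  poisson_lin : forall c f g h, P (c *: f + g) h = c *: P f h + P g h;
  poisson_anti : forall f g, P f g = - P g f;
  poisson_jacobi : forall f g h, P f (P g h) + P g (P h f) + P h (P f g) = 0;
  poisson_leibniz : forall f g h, P f (g * h) = P f g * h + g * P f h;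
  poisson_cont : forall k, exists l, forall f g, filt l f -> filt k (P f g) }.

Record algebra_morphism (W W' : lmodType K) (F : symhat W -> symhat W') : Prop :=
  AlgebraMorphism {
  amor_lin : forall c f g, F (c *: f + g) = c *: F f + F g;
  amor_mul : forall f g, F (f * g) = F f * F g;
  amor_one : F 1 = 1 }.

(* (eps (x) id) and (id (x) eps); eps kills the generators. *)
Definition counitl : tpow V 2 -> symhat V :=
  cmor (fun u : {ffun 'I_2 -> V} => cgen (u (sl 1 2))).
Definition counitr : tpow V 2 -> symhat V :=
  cmor (fun u : {ffun 'I_2 -> V} => cgen (u (sl 1 1))).

(* exp(P(f, -))(b), that is f * b * (-f) for the CBH product. *)
Definition expad (W : lmodType K) (P : symhat W -> symhat W -> symhat W)
    (f b : symhat W) : symhat W :=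
  csum (fun p => (p`!%:R)^-1 *: iter p (P f) b).

(* a |-> a^{i,j} for the 1-based slots i, j. *)
Definition place2 m i j : tpow V 2 -> tpow V m.+1 :=
  place_in (fun k : 'I_2 => if k == sl 1 1 then sl m i else sl m j).

Record drinfeld_algebra (P : symhat V -> symhat V -> symhat V)
    (Delta : symhat V -> tpow V 2) (phi : tpow V 3) : Prop := DrinfeldAlgebra {
  da_poisson : poisson_structure P;
  da_max : forall f g, filt 1 (P f g);
  da_morph : algebra_morphism Delta;
  da_cont : continuous_at0 Delta;
  da_poisson_morph :
    forall f g, Delta (P f g) = tpoisson P (Delta f) (Delta g);
  da_counitl : forall a, counitl (Delta a) = a;
  da_counitr : forall a, counitr (Delta a) = a;
  da_phi_max : maxtens phi;
  da_coassoc : forall a,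
    tmap [tuple slot (sl 2 1); place2 2 2 3 \o Delta] (Delta a)
    = expad (@tpoisson P 3) phi
        (tmap [tuple place2 2 1 2 \o Delta; slot (sl 2 3)] (Delta a));
  da_pentagon :
    let st := star (@tpoisson P 4) in
    let s k : symhat V -> tpow V 4 := slot (sl 3 k) in
    let d i j : symhat V -> tpow V 4 := place2 3 i j \o Delta in
    st (tmap [tuple s 1%N; s 2%N; d 3%N 4%N] phi)
       (tmap [tuple d 1%N 2%N; s 3%N; s 4%N] phi)
    = st (st (tmap [tuple s 2%N; s 3%N; s 4%N] phi)
             (tmap [tuple s 1%N; d 2%N 3%N; s 4%N] phi))
         (tmap [tuple s 1%N; s 2%N; s 3%N] phi) }.

(* x is the class of a in m_A / m_A^2 = V. *)
Definition class_of (a : symhat V) (x : V) : Prop :=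
  filt 1 a /\ filt 2 (a - cgen x).

(* tau is the class of f in (m_A / m_A^2)^{(x)n} = V^{(x)n}. *)
Definition tclass_of n (f tau : tpow V n) : Prop :=
  maxtens f /\ filt n.+1 (f - tau).

Definition alt3 (f : tpow V 3) : tpow V 3 :=
  6%:R^-1 *: \sum_(s : 'S_3) (-1) ^+ s *: place_in s f.

Record reduction (P : symhat V -> symhat V -> symhat V)
    (Delta : symhat V -> tpow V 2) (phit : tpow V 3)
    (mu : V -> V -> V) (delta : V -> tpow V 2) (phi : tpow V 3) : Prop :=
  Reduction {
  red_mu : forall a b x y, class_of a x -> class_of b y ->
    class_of (P a b) (mu x y);
  red_delta : forall a x, class_of a x ->
    tclass_of (Delta a - place2 1 2 1 (Delta a)) (delta x);
  red_phi : tclass_of (alt3 phit) phi }.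

Record is_lift (P : symhat V -> symhat V -> symhat V)
    (Delta : symhat V -> tpow V 2) (phit : tpow V 3)
    (mu : V -> V -> V) (delta : V -> tpow V 2) (phi : tpow V 3) : Prop :=
  IsLift {
  lift_drinfeld : drinfeld_algebra P Delta phit;
  lift_reduction : reduction P Delta phit mu delta phi }.

(* The coproduct of S^(V) for which the elements of V are primitive. *)
Definition Delta0 : symhat V -> tpow V 2 :=
  cmor (fun x => cgen (emb (sl 1 1) x) + cgen (emb (sl 1 2) x)).

End SymHat.

(******************************************************************************)
(* Metrized Lie algebras.                                                     *)
(******************************************************************************)

Section Metrized.
Variables (K : fieldType) (g : lmodType K) (mu : g -> g -> g).

Record lie_bracket : Prop := LieBracket {
  lie_linl : forall c x y z, mu (c *: x + y) z = c *: mu x z + mu y z;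
  lie_linr : forall c x y z, mu z (c *: x + y) = c *: mu z x + mu z y;
  lie_alt : forall x, mu x x = 0;
  lie_jacobi : forall x y z,
    mu x (mu y z) + mu y (mu z x) + mu z (mu x y) = 0 }.

(* The Kostant-Kirillov Poisson bracket. *)
Definition kk_poisson : symhat g -> symhat g -> symhat g :=
  bider (fun x y => cgen (mu x y)).

(* The adjoint action of x on S^(g)^{(x)n}, by derivations. *)
Definition ad_act n (x : g) (f : tpow g n) : tpow g n :=
  csum (fun p => nder cgen
    (fun u : {ffun 'I_n -> g} => cgen [ffun i => mu x (u i)]) (repr (f p))).

Definition ad_invariant n (f : tpow g n) : Prop := forall x, ad_act x f = 0.

(* A list t of pairs (a, b) stands for the tensor \sum a (x) b. *)
Definition tensor2 (t : seq (g * g)) : tpow g 2 :=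
  \sum_(p <- t) ptens [tuple p.1; p.2].

Record metrized (t : seq (g * g)) : Prop := Metrized {
  metr_lie : lie_bracket;
  metr_sym : place2 1 2 1 (tensor2 t) = tensor2 t;
  metr_inv : ad_invariant (tensor2 t) }.

(* The image of t^{i,j} in S^(g)^{(x)3}. *)
Definition tbar (t : seq (g * g)) (i j : nat) : tpow g 3 :=
  \sum_(p <- t) cgen (emb (sl 2 i) p.1) * cgen (emb (sl 2 j) p.2).

(* [t^{1,2}, t^{2,3}] = \sum a (x) [b, c] (x) d. *)
Definition phi_metr (t : seq (g * g)) : tpow g 3 :=
  \sum_(p <- t) \sum_(q <- t) ptens [tuple p.1; mu p.2 q.1; q.2].

Definition alternating3 (f : tpow g 3) : Prop :=
  forall s : 'S_3, place_in s f = (-1) ^+ s *: f.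

Definition phi_tilde (Phi : ncseries K) (t : seq (g * g)) : tpow g 3 :=
  lie_eval (@tpoisson K g kk_poisson 3)
    (subst2 (tbar t 1 2) (tbar t 2 3)) (clog Phi).

End Metrized.

(* Main.v *)
Require Import Defs.
From HB Require Import structures.
From mathcomp Require Import all_boot all_order all_algebra perm.
From mathcomp Require Import boolp classical_sets zify.

Set Implicit Arguments.
Unset Strict Implicit.
Unset Printing Implicit Defensive.

Import GRing.Theory.
Local Open Scope ring_scope.
Local Open Scope quotient_scope.

(* The series psi_I = log Phi^I is a Lie series in the braid algebra, and the  *)
(* invariance of t makes the canonical tensors satisfy the infinitesimal braid *)
(* relations for the Poisson bracket.  A Lie map from Lie series over the      *)
(* braid algebra to the Poisson algebra then sends psi_I to the insertions of  *)
(* phi~; it is obtained by the Dynkin-Specht-Wever argument, which avoids the  *)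
(* Poincare-Birkhoff-Witt theorem.  As the Campbell-Hausdorff series is a Lie  *)
(* series, the logarithm of the pentagon for Phi becomes the pentagon for      *)
(* phi~.  Coassociativity holds because phi~ is built from invariant tensors,  *)
(* and so Poisson-commutes with the image of the iterated coproduct.           *)

(** * Degree completions and their continuous morphisms *)

(** The source of everything is that invariance of [t] makes the quadratic elements t^{i,j} of the
    n-th completed tensor power of S^(g) satisfy the infinitesimal braid relations for the Poisson
    bracket: x^a + x^b Poisson-commutes with t^{a,b} ([poisson_embs_casimir]), whence [casimir_4T]
    and [casimir_comm]. Identities between Lie series in the generators of [That n] should therefore
    have images in the Poisson algebra.

    The pentagon for Phi, however, is an identity in an associative algebra. By [cexp_clog] each
    Phi^I is the exponential of a Lie series psi_I ([insertion_assoc]), and since the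
    Campbell-Hausdorff series is a Lie series ([cbh_lie]), the logarithm of either side of the
    pentagon is a Lie series as well. To carry it to the Poisson side one needs a map defined on the
    associative algebra itself. Letting a generator x act on L + K by (l, c) -> ([x, l] + c x, 0)
    and dividing by the degree gives such a map, [lie_map]. It turns commutators of Lie series into
    Poisson brackets ([lie_map_commutator]), log(e^x e^y) into [star] ([lie_map_star]) and psi_I
    into the insertion of phi~ ([lie_map_log_insertion]). This yields [phi_tilde_pentagon].

    The remaining axioms rest on functoriality: coproducts and insertions are induced by linear maps
    ([sym_map]), which are Poisson when they respect the Lie brackets ([sym_map_poisson]), the n-th
    tensor power belonging to the Lie algebra g^n ([tpoissonE]). As [Delta0] is coassociative,
    twisted coassociativity only asks that phi~ Poisson-commute with the image of the iterated
    coproduct, which is [phi_tilde_invariant]. Finally, nested brackets starting from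
    [t^{1,2}, t^{2,3}] = phi stay in the ideal of pure tensors ([poisson_tensor_ideal]), and a Lie
    word of length k in quadratic elements has degree k + 1. So phi~ agrees with phi up to degree 4,
    and phi is alternating by the four-term relation ([phi_metr_alternating]). *)

Section Filtration.
Variables (K : fieldType) (X : Type) (R : presentation K X).
Implicit Types (f g : cpalg R) (u v : nat -> cpalg R).

Lemma ccomp1 k : (1 : cpalg R) k = if k == 0%N then 1 else 0. Proof. by []. Qed.
Lemma ccompD f g k : (f + g) k = f k + g k. Proof. by []. Qed.
Lemma ccompZ c f k : (c *: f) k = c *: f k. Proof. by []. Qed.
Lemma ccompN f k : (- f) k = - f k. Proof. by rewrite -scaleN1r ccompZ scaleN1r. Qed.
Lemma ccompB f g k : (f - g) k = f k - g k. Proof. by rewrite ccompD ccompN. Qed.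
Lemma ccompM f g k : (f * g) k = \sum_(i < k.+1) f i * g (k - i)%N.
Proof. by []. Qed.
Lemma ccomp_sum (I : Type) (r : seq I) (P : pred I) (F : I -> cpalg R) k :
  (\sum_(i <- r | P i) F i) k = \sum_(i <- r | P i) F i k.
Proof. exact: (big_morph (fun f : cpalg R => f k) (fun f g => ccompD f g k)). Qed.
Lemma cgenE a k : (cgen a : cpalg R) k = if k == 1%N then pgen a else 0.
Proof. by []. Qed.

Lemma cgenM a f k :
  (cgen a * f) k = if k is j.+1 then pgen a * f j else 0.
Proof.
rewrite ccompM; case: k => [|k]; first by rewrite big_ord1 mul0r.
rewrite big_ord_recl mul0r add0r big_ord_recl /= subn1 /=.
by rewrite big1 ?addr0 // => i _; rewrite /bump /= mul0r.
Qed.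

Lemma filt_ge0 f : filt 0 f. Proof. by []. Qed.
Lemma filt0 k : filt k (0 : cpalg R). Proof. by []. Qed.
Lemma filtW k l f : (k <= l)%N -> filt l f -> filt k f.
Proof. by move=> kl fl j jk; apply: fl; apply: leq_trans jk kl. Qed.
Lemma filtD k f g : filt k f -> filt k g -> filt k (f + g).
Proof. by move=> fk gk j jk; rewrite ccompD fk // gk // addr0. Qed.
Lemma filtZ k c f : filt k f -> filt k (c *: f).
Proof. by move=> fk j jk; rewrite ccompZ fk // scaler0. Qed.
Lemma filtN k f : filt k f -> filt k (- f).
Proof. by rewrite -scaleN1r; apply: filtZ. Qed.
Lemma filtB k f g : filt k f -> filt k g -> filt k (f - g).
Proof. by move=> fk gk; apply: filtD fk (filtN gk). Qed.
Lemma filt_sum k (I : Type) (r : seq I) (P : pred I) (F : I -> cpalg R) :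
  (forall i, P i -> filt k (F i)) -> filt k (\sum_(i <- r | P i) F i).
Proof. by move=> FP; apply: big_ind => //; apply: filtD. Qed.
Lemma filtM k l f g : filt k f -> filt l g -> filt (k + l) (f * g).
Proof.
move=> fk gl j jkl; rewrite ccompM big1 // => i _.
have [ik|ki] := ltnP i k; first by rewrite fk // mul0r.
by rewrite gl ?mulr0 //; have := ltn_ord i; lia.
Qed.
Lemma filtMl k f g : filt k f -> filt k (f * g).
Proof. by move=> fk; rewrite -[k]addn0; apply: filtM. Qed.
Lemma filtMr k f g : filt k g -> filt k (f * g).
Proof. by move=> gk; rewrite -[k]add0n; apply: filtM. Qed.
Lemma filt_gen a : filt 1 (cgen a : cpalg R).
Proof. by case. Qed.
Lemma filt_exp n f : filt 1 f -> filt n (f ^+ n).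
Proof.
move=> f1; elim: n => // n IHn.
by rewrite exprS -add1n; apply: filtM.
Qed.
Lemma filt_eq f g : (forall k, filt k (f - g)) -> f = g.
Proof.
move=> fg; apply: cpalgP => k; apply/eqP; rewrite -subr_eq0 -ccompB.
by rewrite (fg k.+1).
Qed.

(** [csum] has a value for every sequence; this condition makes that value the limit of the partial
    sums. It is phrased with the filtration so that continuous maps preserve it. *)
Definition summable u := forall k, exists N, forall p, (N <= p)%N -> filt k (u p).

Lemma filt_summable u : (forall p, filt p (u p)) -> summable u.
Proof. by move=> up k; exists k => p kp; apply: filtW kp (up p). Qed.

Lemma csum_approx u k : summable u ->
  exists N, forall M, (N <= M)%N -> filt k (csum u - \sum_(p < M) u p).
Proof.
move=> /(_ k)[N uN]; exists N => M NM j jk.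
rewrite ccompB ccomp_sum (@csumE _ _ _ u j M) ?subrr // => p Mp.
exact: uN (leq_trans NM Mp) _ jk.
Qed.

Lemma csum_filt k u : (forall p, filt k (u p)) -> filt k (csum u).
Proof. by move=> uk j jk /=; rewrite big1 // => p _; apply: uk. Qed.

Lemma summableD u v : summable u -> summable v -> summable (fun p => u p + v p).
Proof.
move=> uS vS k; have [M uM] := uS k; have [N vN] := vS k.
exists (maxn M N) => p; rewrite geq_max => /andP[Mp Np].
by apply: filtD; [apply: uM | apply: vN].
Qed.

Lemma summableZ c u : summable u -> summable (fun p => c *: u p).
Proof.
by move=> uS k; have [M uM] := uS k; exists M => p /uM; apply: filtZ.
Qed.

Lemma csum_unique u f :
  (forall k, exists N, forall M, (N <= M)%N -> filt k (f - \sum_(p < M) u p)) ->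
  summable u -> csum u = f.
Proof.
move=> fu uS; apply: filt_eq => k.
have [M uM] := csum_approx k uS; have [N fN] := fu k.
have := filtB (uM _ (leq_maxl M N)) (fN _ (leq_maxr M N)).
by rewrite opprB addrA subrK.
Qed.

Lemma csumD u v : summable u -> summable v ->
  csum (fun p => u p + v p) = csum u + csum v.
Proof.
move=> uS vS; apply: csum_unique (summableD uS vS) => k.
have [M uM] := csum_approx k uS; have [N vN] := csum_approx k vS.
exists (maxn M N) => p; rewrite geq_max => /andP[Mp Np].
by rewrite big_split opprD addrACA; apply: filtD; [apply: uM | apply: vN].
Qed.

Lemma csumZ c u : summable u -> csum (fun p => c *: u p) = c *: csum u.
Proof.
move=> uS; apply: csum_unique (summableZ c uS) => k.
have [M uM] := csum_approx k uS; exists M => p Mp.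
by rewrite -scaler_sumr -scalerBr; apply/filtZ/uM.
Qed.

Lemma csum_recl u : summable u -> csum u = u 0%N + csum (fun p => u p.+1).
Proof.
move=> uS; apply: (csum_unique _ uS) => k.
have u'S : summable (fun p => u p.+1).
  by move=> l; have [M uM] := uS l; exists M => p Mp; apply/uM/leqW.
have [M uM] := csum_approx k u'S; exists M.+1 => -[//|p] Mp.
by rewrite big_ord_recl opprD addrACA subrr add0r; apply: uM.
Qed.

Lemma csum_finite u N : (forall p, (N <= p)%N -> u p = 0) ->
  csum u = \sum_(p < N) u p.
Proof.
move=> uN; apply: cpalgP => k; rewrite ccomp_sum.
by apply: csumE => p /uN ->.
Qed.

Lemma csum_eq u v : u =1 v -> csum u = csum v.
Proof. by move=> /funext ->. Qed.

Lemma prod_cgenE (s : seq X) j :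
  (\prod_(a <- s) cgen a : cpalg R) j
  = if j == size s then \prod_(a <- s) pgen a else 0.
Proof.
elim: s j => [|a s IHs] j; first by rewrite !big_nil.
by rewrite !big_cons cgenM; case: j => // j; rewrite IHs eqSS; case: ifP; rewrite ?mulr0.
Qed.

Lemma homog_lift k x : homog k x -> exists s : seq (K * k.-tuple X),
  forall j, (\sum_(p <- s) p.1 *: \prod_(a <- p.2) cgen a : cpalg R) j
    = if j == k then x else 0.
Proof.
move=> [s ->]; exists s => j; rewrite ccomp_sum.
under eq_bigr do rewrite ccompZ prod_cgenE size_tuple.
by case: eqP => // _; rewrite big1 // => p _; rewrite scaler0.
Qed.

(* The subalgebra generated by the generators is dense. *)
Lemma cpalg_dense_ind (Q : cpalg R -> Prop) :
  (forall c, Q c%:A) -> (forall a, Q (cgen a)) ->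
  (forall f g, Q f -> Q g -> Q (f + g)) ->
  (forall f g, Q f -> Q g -> Q (f * g)) ->
  (forall f, (forall k, exists2 g, Q g & filt k (f - g)) -> Q f) ->
  forall f, Q f.
Proof.
move=> Qc Qg QD QM Qlim f; apply: (Qlim) => k.
have Q0 : Q 0 by have := Qc 0; rewrite scale0r.
elim: k => [|k [g Qg' fg]]; first by exists 0.
(* The lift of the degree k component of [f - g] has no other component, so adding it to [g]
   improves the approximation by exactly one degree. *)
have [s sE] := homog_lift (chomog (f - g) k).
set h := \sum_(p <- s) _ in sE; exists (g + h).
  apply: (QD) => //; apply: (big_ind Q Q0 QD) => p _.
  rewrite -[X in _ *: X]mul1r scalerAl; apply: (QM); first exact: Qc.
  by apply: (big_ind Q _ QM) => //; rewrite -[1]scale1r.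
move=> j; rewrite ltnS leq_eqVlt opprD addrA ccompB sE => /orP[/eqP ->|jk].
  by rewrite eqxx subrr.
by rewrite (ltn_eqF jk) subr0 fg.
Qed.

Lemma csum0 : csum (fun=> 0) = 0 :> cpalg R.
Proof. by rewrite (@csum_finite _ 0) ?big_ord0. Qed.

End Filtration.

Section Continuity.
Variables (K : fieldType) (X Y : Type) (R : presentation K X)
  (R' : presentation K Y).

(** Additivity gives the partial sums and continuity at 0 gives the limit. Multiplicativity is not
    asked for, so the lemma serves morphisms, derivations and multiplication by a fixed element
    alike. *)
Lemma csum_cont (F : cpalg R -> cpalg R') (u : nat -> cpalg R) :
  (forall f g, F (f - g) = F f - F g) ->
  (forall k, exists l, forall f, filt l f -> filt k (F f)) ->
  summable u -> summable (F \o u) /\ F (csum u) = csum (F \o u).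
Proof.
move=> FB Fcont uS.
have F0 : F 0 = 0 by rewrite -(subrr 0) FB subrr.
have FD f g : F (f + g) = F f + F g.
  by rewrite -{1}[g]opprK -[- g]sub0r FB FB F0 sub0r opprK.
have Fsum n : F (\sum_(p < n) u p) = \sum_(p < n) F (u p).
  by apply: (big_morph F FD F0).
have FuS : summable (F \o u).
  move=> k; have [l Fl] := Fcont k; have [N uN] := uS l.
  by exists N => p /uN; apply: Fl.
split=> //; apply/esym/csum_unique => // k.
have [l Fl] := Fcont k; have [N uN] := csum_approx l uS.
by exists N => M NM; rewrite -Fsum -FB; apply/Fl/uN.
Qed.

End Continuity.

Section Peval.
Variables (K : fieldType) (X : Type) (R : presentation K X) (B : algType K).
Variable th : X -> B.
Hypothesis thR : forall e f, prel R e f -> neval th e = neval th f.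
Implicit Types x y : palg R.

Lemma peval_add x y : peval th (x + y) = peval th x + peval th y.
Proof.
rewrite -[x + y]/(padd x y); elim/quotW: x => x; elim/quotW: y => y.
by rewrite !piE !pevalE.
Qed.
Lemma peval_mul x y : peval th (x * y) = peval th x * peval th y.
Proof.
rewrite -[x * y]/(pmul x y); elim/quotW: x => x; elim/quotW: y => y.
by rewrite !piE !pevalE.
Qed.
Lemma peval_cst c : peval th (pcst R c) = c%:A.
Proof. by rewrite !piE pevalE. Qed.
Lemma peval_scale c x : peval th (c *: x) = c *: peval th x.
Proof.
by rewrite -[c *: x]/(pcst R c * x) peval_mul peval_cst -scalerAl mul1r.
Qed.
Lemma peval_one : peval th (1 : palg R) = 1.
Proof. by rewrite -[1]/(pcst R 1) peval_cst scale1r. Qed.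
Lemma peval_zero : peval th (0 : palg R) = 0.
Proof. by rewrite -[0]/(pcst R 0) peval_cst scale0r. Qed.
Lemma peval_gen a : peval th (pgen a : palg R) = th a.
Proof. by rewrite /pgen pevalE. Qed.
Lemma peval_sum (I : Type) (r : seq I) (P : pred I) (F : I -> palg R) :
  peval th (\sum_(i <- r | P i) F i) = \sum_(i <- r | P i) peval th (F i).
Proof. exact: (big_morph _ peval_add peval_zero). Qed.
Lemma peval_prod (r : seq X) :
  peval th (\prod_(a <- r) pgen a : palg R) = \prod_(a <- r) th a.
Proof.
rewrite (big_morph _ peval_mul peval_one).
by apply: eq_bigr => a _; rewrite peval_gen.
Qed.

End Peval.

Section Morphisms.
Variable K : fieldType.

(** Continuity is recorded in the strong form that the degree filtration is preserved, as happens
    when generators go to series without constant term. *)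
Record cmorphism (X Y : Type) (R : presentation K X) (R' : presentation K Y)
    (F : cpalg R -> cpalg R') : Prop := CMorphism {
  cmorphism_lin : forall c f g, F (c *: f + g) = c *: F f + F g;
  cmorphism_mul : forall f g, F (f * g) = F f * F g;
  cmorphism_one : F 1 = 1;
  cmorphism_filt : forall k f, filt k f -> filt k (F f) }.

Section Theory.
Variables (X Y : Type) (R : presentation K X) (R' : presentation K Y).
Variable F : cpalg R -> cpalg R'.
Hypothesis FP : cmorphism F.

Lemma cmorphismD f g : F (f + g) = F f + F g.
Proof. by rewrite -[f]scale1r (cmorphism_lin FP) !scale1r. Qed.
Lemma cmorphism0 : F 0 = 0.
Proof. by apply: (@addrI _ (F 0)); rewrite -cmorphismD !addr0. Qed.
Lemma cmorphismZ c f : F (c *: f) = c *: F f.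
Proof. by rewrite -[c *: f]addr0 (cmorphism_lin FP) cmorphism0 addr0. Qed.
Lemma cmorphismB f g : F (f - g) = F f - F g.
Proof. by rewrite -scaleN1r cmorphismD cmorphismZ scaleN1r. Qed.
Lemma cmorphism_sum (I : Type) (r : seq I) (P : pred I) (f : I -> cpalg R) :
  F (\sum_(i <- r | P i) f i) = \sum_(i <- r | P i) F (f i).
Proof. exact: (big_morph _ cmorphismD cmorphism0). Qed.
Lemma cmorphism_prod (I : Type) (r : seq I) (P : pred I) (f : I -> cpalg R) :
  F (\prod_(i <- r | P i) f i) = \prod_(i <- r | P i) F (f i).
Proof. exact: (big_morph _ (cmorphism_mul FP) (cmorphism_one FP)). Qed.
Lemma cmorphismX f n : F (f ^+ n) = F f ^+ n.
Proof.
by elim: n => [|n IHn]; rewrite ?(cmorphism_one FP) // !exprS (cmorphism_mul FP) IHn.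
Qed.
Lemma cmorphism_csum u : summable u -> F (csum u) = csum (F \o u).
Proof.
move=> uS; have [] // := @csum_cont _ _ _ _ _ F u _ _ uS.
  by move=> f g; rewrite cmorphismB.
by move=> k; exists k => f; apply: cmorphism_filt FP _ _.
Qed.
Lemma cmorphism_cexp f : filt 1 f -> F (cexp f) = cexp (F f).
Proof.
move=> f1; rewrite cmorphism_csum.
  by apply: csum_eq => p /=; rewrite cmorphismZ cmorphismX.
by apply: filt_summable => p; apply/filtZ/filt_exp.
Qed.
Lemma cmorphism_clog f : filt 1 (f - 1) -> F (clog f) = clog (F f).
Proof.
move=> f1; rewrite cmorphism_csum.
  apply: csum_eq => p /=.
  by rewrite cmorphismZ cmorphismX cmorphismB (cmorphism_one FP).
by apply: filt_summable => p; apply/filtZ/(filtW (leqnSn p))/filt_exp.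
Qed.

End Theory.

Lemma cmorphism_id (X : Type) (R : presentation K X) :
  cmorphism (id : cpalg R -> cpalg R).
Proof. by []. Qed.

Lemma cmorphism_comp (X Y Z : Type) (R : presentation K X)
    (R' : presentation K Y) (R'' : presentation K Z)
    (F : cpalg R -> cpalg R') (G : cpalg R' -> cpalg R'') :
  cmorphism F -> cmorphism G -> cmorphism (G \o F).
Proof.
move=> FP GP; split => [c f g|f g||k f fk] /=.
- by rewrite (cmorphism_lin FP) (cmorphism_lin GP).
- by rewrite (cmorphism_mul FP) (cmorphism_mul GP).
- by rewrite (cmorphism_one FP) (cmorphism_one GP).
- exact/(cmorphism_filt GP)/(cmorphism_filt FP).
Qed.

Section Cmor.
Variables (X Y : Type) (R : presentation K X) (R' : presentation K Y).

Lemma cmorphism_ext (F G : cpalg R -> cpalg R') :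
  cmorphism F -> cmorphism G -> (forall a, F (cgen a) = G (cgen a)) -> F =1 G.
Proof.
move=> FP GP FG; apply: cpalg_dense_ind => //.
- by move=> c; rewrite !cmorphismZ ?(cmorphism_one FP) ?(cmorphism_one GP).
- by move=> f g; rewrite (cmorphismD FP) (cmorphismD GP) => -> ->.
- by move=> f g; rewrite (cmorphism_mul FP) (cmorphism_mul GP) => -> ->.
move=> f fQ; apply: filt_eq => k; have [g FGg fg] := fQ k.
have -> : F f - G f = F (f - g) - G (f - g).
  by rewrite (cmorphismB FP) (cmorphismB GP) FGg opprB addrA subrK.
by apply: filtB; [apply: cmorphism_filt FP _ _ fg | apply: cmorphism_filt GP _ _ fg].
Qed.

Variable th : X -> cpalg R'.
Hypothesis thR : forall e f, prel R e f -> neval th e = neval th f.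
Hypothesis th1 : forall a, filt 1 (th a).

Lemma peval_filt k (x : palg R) : homog k x -> filt k (peval th x).
Proof.
move=> [s ->]; rewrite (peval_sum thR); apply: filt_sum => p _.
rewrite (peval_scale thR) (peval_prod thR); apply: filtZ.
rewrite -{1}(size_tuple p.2); elim: (tval p.2) => [|a r IHr] //.
by rewrite big_cons /= -add1n; apply: filtM.
Qed.

Lemma cmor_summable (f : cpalg R) : summable (fun p => peval th (f p)).
Proof. by apply: filt_summable => p; apply/peval_filt/chomog. Qed.

Lemma cmor_gen a : cmor th (cgen a : cpalg R) = th a.
Proof.
rewrite /cmor (@csum_finite _ _ _ _ 2).
  by rewrite !big_ord_recl big_ord0 !cgenE /= peval_zero // peval_gen // add0r addr0.
by case=> [|[|p]] // _; rewrite cgenE peval_zero.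
Qed.

(** Multiplicativity is obtained by density in the left factor. For a generator it holds because
    multiplication by it shifts degrees by one, so both sides are the same series reindexed. *)
Lemma cmorP : cmorphism (cmor th : cpalg R -> cpalg R').
Proof.
have lin c (f g : cpalg R) : cmor th (c *: f + g) = c *: cmor th f + cmor th g.
  have S := cmor_summable.
  rewrite /cmor -(csumZ c (S f)) -(csumD (summableZ c (S f)) (S g)).
  by apply: csum_eq => p; rewrite ccompD ccompZ peval_add ?peval_scale.
have flt k (f : cpalg R) : filt k f -> filt k (cmor th f).
  move=> fk; apply: csum_filt => p; have [pk|kp] := ltnP p k.
    by rewrite fk // peval_zero.
  exact/(filtW kp)/peval_filt/chomog.
have one : cmor th (1 : cpalg R) = 1.
  rewrite /cmor (@csum_finite _ _ _ _ 1).
    by rewrite big_ord1 ccomp1 peval_one.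
  by case=> // p _; rewrite ccomp1 peval_zero.
have D (f g : cpalg R) : cmor th (f + g) = cmor th f + cmor th g.
  by rewrite -[f]scale1r lin !scale1r.
have zero : cmor th (0 : cpalg R) = 0.
  by apply: (@addrI _ (cmor th (0 : cpalg R))); rewrite -D !addr0.
have Z c (f : cpalg R) : cmor th (c *: f) = c *: cmor th f.
  by rewrite -[c *: f]addr0 lin zero addr0.
have B (f g : cpalg R) : cmor th (f - g) = cmor th f - cmor th g.
  by rewrite -scaleN1r D Z scaleN1r.
split=> //; apply: cpalg_dense_ind.
- by move=> c g; rewrite -scalerAl mul1r !Z one -scalerAl mul1r.
- move=> a g; rewrite cmor_gen /cmor csum_recl; last exact: cmor_summable.
  rewrite cgenM peval_zero // add0r.
  have LB (h h' : cpalg R') : th a * (h - h') = th a * h - th a * h'.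
    by rewrite mulrBr.
  have Lf k : exists l, forall h : cpalg R', filt l h -> filt k (th a * h).
    by exists k => h; apply: filtMr.
  have [_ ->] := csum_cont LB Lf (cmor_summable g).
  by apply: csum_eq => p; rewrite [RHS]/= cgenM peval_mul // peval_gen.
- by move=> f f' fQ fQ' g; rewrite mulrDl !D fQ fQ' mulrDl.
- by move=> f f' fQ fQ' g; rewrite -mulrA !fQ fQ' mulrA.
move=> f fQ g; apply: filt_eq => k; have [h hQ fh] := fQ k.
have -> : cmor th (f * g) - cmor th f * cmor th g
    = cmor th ((f - h) * g) - cmor th (f - h) * cmor th g.
  by rewrite mulrBl !B hQ mulrBl opprB addrA subrK.
by apply: filtB; [apply/flt/filtMl | apply/filtMl/flt].
Qed.

End Cmor.
End Morphisms.

(** * Exponentials, logarithms and the Campbell-Hausdorff series *)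

Section Commutators.
Variables (K : fieldType) (B : algType K).
Implicit Types x y z : B.

Lemma commutatorxx x : commutator x x = 0.
Proof. exact: subrr. Qed.
Lemma commutator0r x : commutator x 0 = 0.
Proof. by rewrite /commutator mulr0 mul0r subr0. Qed.
Lemma commutatorZr c x y : commutator x (c *: y) = c *: commutator x y.
Proof. by rewrite /commutator -scalerAr -scalerAl scalerBr. Qed.
Lemma commutator_linl c x y z :
  commutator (c *: x + y) z = c *: commutator x z + commutator y z.
Proof.
by rewrite /commutator mulrDl mulrDr -scalerAl -scalerAr opprD addrACA -scalerBr.
Qed.
Lemma commutator_linr c x y z :
  commutator z (c *: x + y) = c *: commutator z x + commutator z y.
Proof.
by rewrite /commutator mulrDl mulrDr -scalerAl -scalerAr opprD addrACA -scalerBr.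
Qed.
End Commutators.

Lemma sum_triangle (V : nmodType) (F : nat -> nat -> V) m :
  \sum_(n < m) \sum_(i < n.+1) F i (n - i)%N
  = \sum_(i < m) \sum_(j < m - i) F i j.
Proof.
elim: m => [|m IHm]; first by rewrite !big_ord0.
rewrite big_ord_recr /= IHm big_ord_recr [RHS]big_ord_recr /= subSnn big_ord1.
rewrite addrA -big_split subnn; congr (_ + _); apply: eq_bigr => i _ /=.
by rewrite subSn ?(ltnW (ltn_ord i)) // big_ord_recr.
Qed.

Section Series.
Variables (K : fieldType) (X : Type) (R : presentation K X).
Implicit Types (f g h : cpalg R) (u v : nat -> cpalg R).

Lemma csum_approx_filt d u m : (forall p, filt (p + d) (u p)) ->
  filt (m + d) (csum u - \sum_(p < m) u p).
Proof.
move=> up j jm; rewrite ccompB ccomp_sum (@csumE _ _ _ u j m) ?subrr // => p mp.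
by apply: up; apply: leq_trans jm _; rewrite leq_add2r.
Qed.

(* The Cauchy product for a bilinear operation that shifts degrees by -d. *)
Lemma csum_bilinear d (b : cpalg R -> cpalg R -> cpalg R) u v :
  (forall f g h, b (f - g) h = b f h - b g h) ->
  (forall f g h, b f (g - h) = b f g - b f h) ->
  (forall i j f g, filt (i + d) f -> filt (j + d) g -> filt (i + j + d) (b f g)) ->
  (forall p, filt (p + d) (u p)) -> (forall p, filt (p + d) (v p)) ->
  b (csum u) (csum v) = csum (fun n => \sum_(i < n.+1) b (u i) (v (n - i)%N)).
Proof.
move=> bBl bBr bF up vp.
have b0l h : b 0 h = 0 by have := bBl 0 0 h; rewrite !subrr.
have b0r h : b h 0 = 0 by have := bBr h 0 0; rewrite !subrr.
have bDl f g h : b (f + g) h = b f h + b g h.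
  by rewrite -{1}[g]opprK -[- g]sub0r bBl bBl b0l sub0r opprK.
have bDr f g h : b h (f + g) = b h f + b h g.
  by rewrite -{1}[g]opprK -[- g]sub0r bBr bBr b0r sub0r opprK.
apply/esym/csum_unique.
  move=> k; exists k => m km; apply: filtW km _; apply: (filtW (leq_addr d m)).
  rewrite (sum_triangle (fun i j => b (u i) (v j))).
  (* Split [csum u] into a partial sum and a tail. The tail only contributes in high degree; for
     each kept [u i] the missing part is [b (u i)] applied to the tail of [v] from m - i on, which
     has order at least m again. *)
  rewrite -[csum u](subrK (\sum_(p < m) u p)) bDl -addrA.
  apply: filtD.
    rewrite -[m]addn0; apply: bF; rewrite ?addn0; first exact: csum_approx_filt.
    by apply: csum_filt => p; apply: filtW (vp p); rewrite leq_addl.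
  rewrite (big_morph (b^~ _) (fun f g => bDl f g _) (b0l _)) -sumrB.
  apply: filt_sum => i _.
  rewrite -(big_morph (b (u i)) (fun f g => bDr f g _) (b0r _)) -bBr.
  rewrite -{1}(subnKC (ltnW (ltn_ord i))).
  exact/bF/csum_approx_filt.
apply: filt_summable => n; apply: (filtW (leq_addr d n)); apply: filt_sum => i _.
by rewrite -{1}(subnKC (ltn_ord i : (i <= n)%N)); apply: bF.
Qed.

Lemma cauchy_product u v : (forall p, filt p (u p)) -> (forall p, filt p (v p)) ->
  csum u * csum v = csum (fun n => \sum_(i < n.+1) u i * v (n - i)%N).
Proof.
move=> up vp; apply: (@csum_bilinear 0 *%R).
- by move=> *; rewrite mulrBl.
- by move=> *; rewrite mulrBr.
- by move=> i j f g; rewrite !addn0; apply: filtM.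
- by move=> p; rewrite addn0.
- by move=> p; rewrite addn0.
Qed.

Lemma ccomp_comm : (forall a b, cgen a * cgen b = cgen b * cgen a :> cpalg R) ->
  forall f g, f * g = g * f.
Proof.
move=> genC.
have ind f : (forall b, f * cgen b = cgen b * f) -> forall g, f * g = g * f.
  move=> fC; apply: cpalg_dense_ind => //.
  - by move=> c; rewrite -scalerAl -scalerAr mul1r mulr1.
  - by move=> g h gC hC; rewrite mulrDr mulrDl gC hC.
  - by move=> g h gC hC; rewrite mulrA gC -mulrA hC mulrA.
  move=> g gC; apply: filt_eq => k; have [h hC gh] := gC k.
  have -> : f * g - g * f = f * (g - h) - (g - h) * f.
    by rewrite mulrBl mulrBr hC opprB addrA subrK.
  by apply: filtB; [apply: filtMr | apply: filtMl].
by move=> f g; apply: (ind) => b; apply/esym/(ind).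
Qed.

(** The lowest component of the difference [d] would survive in [d * h], because [h] has constant
    term 1. *)
Lemma mulr_unip_cancel f g h : h 0%N = 1 -> f * h = g * h -> f = g.
Proof.
move=> h0 /eqP; rewrite -subr_eq0 -mulrBl => /eqP fgh; apply: filt_eq.
move: (f - g) fgh => {f g} d dh; elim=> [|k IHk]; first exact: filt_ge0.
move=> j; rewrite ltnS leq_eqVlt => /orP[/eqP ->|]; last exact: IHk.
have := congr1 (fun f => ccomp f k) dh; rewrite ccompM big_ord_recr /= subnn h0.
by rewrite mulr1 big1 ?add0r // => i _; rewrite IHk ?mul0r.
Qed.

(** The degree derivation. In characteristic 0 it is injective on series without constant term, so
    it turns identities between exponentials into recursions on components. *)
Definition euler f : cpalg R := mkc (fun k => homogZ k%:R (chomog f k)).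

Lemma eulerE f k : euler f k = k%:R *: f k. Proof. by []. Qed.
Lemma eulerD f g : euler (f + g) = euler f + euler g.
Proof. by apply: cpalgP => k; rewrite ccompD !eulerE ccompD scalerDr. Qed.
Lemma eulerZ c f : euler (c *: f) = c *: euler f.
Proof. by apply: cpalgP => k; rewrite ccompZ !eulerE ccompZ !scalerA mulrC. Qed.
Lemma eulerB f g : euler (f - g) = euler f - euler g.
Proof. by rewrite -scaleN1r eulerD eulerZ scaleN1r. Qed.
Lemma eulerM f g : euler (f * g) = euler f * g + f * euler g.
Proof.
apply: cpalgP => k; rewrite ccompD eulerE !ccompM scaler_sumr -big_split.
apply: eq_bigr => i _; rewrite /= -scalerAl -scalerAr -scalerDl -natrD.
by rewrite subnKC // -ltnS.
Qed.
Lemma euler_gen a : euler (cgen a) = cgen a.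
Proof.
by apply: cpalgP => k; rewrite eulerE cgenE; case: eqP => [->|]; rewrite ?scaler0 ?scale1r.
Qed.
Lemma euler1 : euler 1 = 0.
Proof.
by apply: cpalgP => k; rewrite eulerE ccomp1; case: eqP => [->|]; rewrite ?scale0r ?scaler0.
Qed.
Lemma euler_filt k f : filt k f -> filt k (euler f).
Proof. by move=> fk j jk; rewrite eulerE fk // scaler0. Qed.
Lemma euler_csum u : summable u -> euler (csum u) = csum (euler \o u).
Proof.
by case/(csum_cont eulerB) => // k; exists k => f; apply: euler_filt.
Qed.
Lemma euler_genX a n : euler (cgen a ^+ n) = n%:R *: cgen a ^+ n.
Proof.
elim: n => [|n IHn]; first by rewrite euler1 scale0r.
by rewrite exprS eulerM euler_gen IHn -scalerAr -{1}[_ * _]scale1r -scalerDl -natr1 addrC.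
Qed.

Lemma cexp_terms_filt f : filt 1 f -> forall p, filt p ((p`!%:R)^-1 *: f ^+ p).
Proof. by move=> f1 p; apply/filtZ/filt_exp. Qed.

Lemma cexp_comp0 f : filt 1 f -> cexp f 0%N = 1.
Proof.
move=> f1; rewrite (@csumE _ _ _ _ 0 1).
  by rewrite big_ord1 invr1 scale1r expr0.
by move=> p p1; apply: cexp_terms_filt.
Qed.

Lemma clog_filt f : f 0%N = 1 -> filt 1 (clog f).
Proof.
move=> f0; apply: csum_filt => p; apply: filtZ; apply: (@filtW _ _ _ 1 p.+1) => //.
by apply: filt_exp => -[] // _; rewrite ccompB f0 subrr.
Qed.

Hypothesis charK : [pchar K] =i pred0.

Lemma natrS_neq0 n : n.+1%:R != 0 :> K.
Proof. by move/pcharf0P: charK => ->. Qed.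

Lemma scale_natrK n x : (n.+1%:R : K) *: x = 0 :> palg R -> x = 0.
Proof.
move=> /(congr1 (GRing.scale (n.+1%:R^-1))).
by rewrite scalerA mulVf ?natrS_neq0 // scale1r scaler0.
Qed.

Section ExpAd.
Variable Z : cpalg R.
Hypothesis Z1 : filt 1 Z.
Let e n : cpalg R := (n`!%:R)^-1 *: Z ^+ n.
(** The terms of e^{ad Z}(y); those of ((e^{ad Z} - 1)/ad Z)(w) follow as [be w]. *)
Let al (y : cpalg R) i : cpalg R := (i`!%:R)^-1 *: iter i (commutator Z) y.
Let be (w : cpalg R) i : cpalg R := (i.+1`!%:R)^-1 *: iter i (commutator Z) w.

Let invS n : ((n.+1)`!%:R)^-1 * n.+1%:R = (n`!%:R)^-1 :> K.
Proof. by rewrite factS natrM invfM mulrC mulrA divff ?natrS_neq0 // mul1r. Qed.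

Let eS n : n.+1%:R *: e n.+1 = Z * e n.
Proof. by rewrite /e scalerA mulrC invS exprS scalerAr. Qed.

Let Zal y i : Z * al y i = i.+1%:R *: al y i.+1 + al y i * Z.
Proof.
rewrite /al scalerA [_%:R * _]mulrC invS iterS -commutatorZr /commutator.
by rewrite subrK.
Qed.

Let Zbe w i : Z * be w i = i.+2%:R *: be w i.+1 + be w i * Z.
Proof.
rewrite /be scalerA [_%:R * _]mulrC invS iterS -commutatorZr /commutator.
by rewrite subrK.
Qed.

(** The part of e^Z y = e^{ad Z}(y) e^Z with n factors Z. After multiplication by n + 1, a new
    factor Z lengthens either the nested bracket or the power, with weights i and n + 1 - i that add
    up to n + 1. *)
Let e_mul y n : e n * y = \sum_(i < n.+1) al y i * e (n - i)%N.
Proof.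
elim: n => [|n IHn].
  by rewrite big_ord1 /e /al /= invr1 !scale1r expr0 mulr1 mul1r.
apply: (scalerI (natrS_neq0 n)); rewrite scalerAl eS -mulrA IHn mulr_sumr.
under eq_bigr do rewrite mulrA Zal mulrDl -[_ * Z * _]mulrA -eS.
rewrite big_split /= scaler_sumr.
transitivity (\sum_(i < n.+2) (i%:R *: (al y i * e (n.+1 - i)%N)
                 + (n.+1 - i)%:R *: (al y i * e (n.+1 - i)%N))).
  rewrite big_split /=; congr (_ + _).
    rewrite [RHS]big_ord_recl scale0r add0r; apply: eq_bigr => i _.
    by rewrite scalerAl.
  rewrite [RHS]big_ord_recr /= subnn scale0r addr0; apply: eq_bigr => i _.
  by rewrite scalerAr subSn // -ltnS.
by apply: eq_bigr => i _; rewrite -scalerDl -natrD subnKC // -ltnS.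
Qed.

Lemma cexp_mul y : cexp Z * y = csum (al y) * cexp Z.
Proof.
have alF i : filt i (al y i).
  apply: filtZ; elim: i => [|i IHi] //=; rewrite -add1n.
  by apply: filtB; [apply: filtM | rewrite addnC; apply: filtM].
rewrite (cauchy_product alF (cexp_terms_filt Z1)).
have LB (h h' : cpalg R) : (h - h') * y = h * y - h' * y by rewrite mulrBl.
have Lf k : exists l, forall h : cpalg R, filt l h -> filt k (h * y).
  by exists k => h; apply: filtMl.
have [_ ->] := csum_cont LB Lf (filt_summable (cexp_terms_filt Z1)).
by apply: csum_eq => n; apply: e_mul.
Qed.

Let euler_e n : euler (e n.+1) = \sum_(i < n.+1) be (euler Z) i * e (n - i)%N.
Proof.
elim: n => [|n IHn].
  by rewrite big_ord1 /e /be /= invr1 !scale1r expr0 mulr1.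
apply: (scalerI (natrS_neq0 n.+1)); rewrite -eulerZ eS eulerM IHn mulr_sumr.
under eq_bigr do rewrite mulrA Zbe mulrDl -[_ * Z * _]mulrA -eS.
rewrite big_split /= scaler_sumr.
transitivity (\sum_(i < n.+2) (i.+1%:R *: (be (euler Z) i * e (n.+1 - i)%N)
                 + (n.+1 - i)%:R *: (be (euler Z) i * e (n.+1 - i)%N))).
  rewrite big_split /= addrA; congr (_ + _).
    rewrite [RHS]big_ord_recl /be /= invr1 !scale1r; congr (_ + _).
    by apply: eq_bigr => i _; rewrite scalerAl.
  rewrite [RHS]big_ord_recr /= subnn scale0r addr0; apply: eq_bigr => i _.
  by rewrite scalerAr subSn // -ltnS.
apply: eq_bigr => i _; rewrite -scalerDl -natrD addSn subnKC //.
by rewrite -ltnS.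
Qed.

(** The derivative of the exponential when Z and its derivative need not commute: E(e^Z) = ((e^{ad
    Z} - 1)/ad Z)(E Z) e^Z, with E the Euler derivation. *)
Lemma euler_cexp : euler (cexp Z) = csum (be (euler Z)) * cexp Z.
Proof.
have beF i : filt i (be (euler Z) i).
  apply: filtZ; elim: i => [|i IHi] //=; rewrite -add1n.
  by apply: filtB; [apply: filtM | rewrite addnC; apply: filtM].
have eF := cexp_terms_filt Z1.
rewrite (cauchy_product beF eF) euler_csum; last exact: filt_summable.
rewrite csum_recl; last by apply: filt_summable => p; apply/euler_filt/eF.
rewrite /= invr1 scale1r expr0 euler1 add0r.
by apply: csum_eq => n; apply: euler_e.
Qed.

Lemma euler_cexp_comm : commutator Z (euler Z) = 0 ->
  euler (cexp Z) = euler Z * cexp Z.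
Proof.
move=> ZZ; rewrite euler_cexp; congr (_ * _).
have it0 i : iter i.+1 (commutator Z) (euler Z) = 0.
  by elim: i => [|i IHi]; rewrite iterS ?IHi ?commutator0r.
rewrite (@csum_finite _ _ _ _ 1); last by case=> // i _; rewrite /be it0 scaler0.
by rewrite big_ord1 /be /= invr1 scale1r.
Qed.

Lemma cexp_commute y : commutator Z y = 0 -> cexp Z * y = y * cexp Z.
Proof.
move=> Zy; rewrite cexp_mul; congr (_ * _).
have it0 i : iter i.+1 (commutator Z) y = 0.
  by elim: i => [|i IHi]; rewrite iterS ?IHi ?commutator0r.
rewrite (@csum_finite _ _ _ _ 1); last by case=> // i _; rewrite /al it0 scaler0.
by rewrite big_ord1 /al /= invr1 scale1r.
Qed.

End ExpAd.
End Series.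

Section ExpLog.
Variable K : fieldType.
Hypothesis charK : [pchar K] =i pred0.

Let S := cpalg (free_pres K unit).
Let x : S := cgen tt.

Let sC (f g : S) : f * g = g * f.
Proof. by apply: ccomp_comm => -[] []. Qed.

Let u1 : (1 + x) - 1 = x. Proof. by rewrite addrC addKr. Qed.

Let l : S := clog (1 + x).

Let l1 : filt 1 l.
Proof. by apply: clog_filt; rewrite ccompD ccomp1 cgenE addr0. Qed.

Let euler_l : (1 + x) * euler l = x.
Proof.
have sS : summable (fun p => (-1 : K) ^+ p *: x ^+ p.+1).
  by apply: filt_summable => p; apply/filtZ/(filtW (leqnSn p))/filt_exp/filt_gen.
have -> : euler l = csum (fun p => (-1 : K) ^+ p *: x ^+ p.+1).
  rewrite /l /clog u1 euler_csum; last first.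
    by apply: filt_summable => p; apply/filtZ/(filtW (leqnSn p))/filt_exp/filt_gen.
  apply: csum_eq => p; rewrite /= eulerZ euler_genX scalerA -mulrA mulVf ?mulr1 //.
  exact: natrS_neq0.
(* The geometric series for x/(1 + x), characterised by s = x - x s. *)
set s := csum _; suff sE : s = x - x * s by rewrite mulrDl mul1r {1}sE subrK.
rewrite {1}/s csum_recl // expr0 scale1r expr1; congr (_ + _).
have LB (h h' : S) : x * (h - h') = x * h - x * h' by rewrite mulrBr.
have Lf k : exists l, forall h : S, filt l h -> filt k (x * h).
  by exists k => h; apply: filtMr.
have [xS ->] := csum_cont LB Lf sS; rewrite -scaleN1r -csumZ //.
by apply: csum_eq => p /=; rewrite -scalerAr scalerA -!exprS.
Qed.

Let cexp_l : cexp l = 1 + x.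
Proof.
set F := cexp l.
have Fo : euler F + x * euler F = x * F.
  rewrite euler_cexp_comm //; last by rewrite /commutator sC subrr.
  by rewrite -{1}[euler l * _]mul1r -mulrDl mulrA euler_l.
apply: cpalgP; case=> [|k].
  by rewrite cexp_comp0 // ccompD ccomp1 cgenE addr0.
rewrite ccompD ccomp1 cgenE add0r eqSS.
(* Compare coefficients in E F + x E F = x F. Degree 1 gives F_1 = x, and degree k + 2 gives (k + 2)
   F_{k+2} + (k + 1) x F_{k+1} = x F_{k+1}. For k = 0 the terms in F_1 cancel; for k > 0 they vanish
   by induction. *)
elim: k => [|k IHk].
  have := congr1 (fun f => ccomp f 1) Fo; rewrite ccompD !cgenM !eulerE scale1r.
  by rewrite scale0r mulr0 addr0 cexp_comp0 // mulr1.
have := congr1 (fun f => ccomp f k.+2) Fo; rewrite ccompD !cgenM !eulerE IHk /=.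
case: k {IHk} => [|k]; rewrite /= ?scale1r ?scaler0 ?mulr0 ?addr0.
  by rewrite -[RHS]add0r => /addIr/scale_natrK; apply.
by move/scale_natrK; apply.
Qed.

(** It is enough to treat 1 + x in one variable, where everything commutes, and to substitute u - 1
    for x. There F = exp(log(1 + x)) solves (1 + x) E F = x F with constant term 1, which forces F =
    1 + x. *)
Lemma cexp_clog (X : Type) (R : presentation K X) (u : cpalg R) :
  u 0%N = 1 -> cexp (clog u) = u.
Proof.
move=> u0; have u1' : filt 1 (u - 1).
  by case=> // _; rewrite ccompB u0 subrr.
have FP : cmorphism (cmor (fun _ => u - 1) : S -> cpalg R) by apply: cmorP.
have Fx : cmor (fun _ => u - 1) (1 + x) = u.
  by rewrite (cmorphismD FP) (cmorphism_one FP) cmor_gen // addrC subrK.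
rewrite -{2}Fx -cexp_l (cmorphism_cexp FP l1) (cmorphism_clog FP) ?Fx //.
by rewrite u1; apply: filt_gen.
Qed.

End ExpLog.

(** * Lie elements of a presented algebra *)

Section LieExpressions.
Variables (K : fieldType) (X : Type).

Definition lbr_expr (s s' : seq (K * lmon X)) :=
  [seq (p.1 * q.1, LBr p.2 q.2) | p <- s, q <- s'].

Lemma lbr_expr_deg k l s s' :
  all (fun p : K * lmon X => ldeg p.2 == k) s ->
  all (fun p : K * lmon X => ldeg p.2 == l) s' ->
  all (fun p => ldeg p.2 == (k + l)%N) (lbr_expr s s').
Proof.
move=> sk sl; apply/all_allpairsP => p q ps qs /=.
by rewrite (eqP (allP sk _ ps)) (eqP (allP sl _ qs)).
Qed.

Lemma lpeval_lbr (L : lmodType K) (br : L -> L -> L) (th : X -> L) s s' :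
  (forall c x y z, br (c *: x + y) z = c *: br x z + br y z) ->
  (forall c x y z, br z (c *: x + y) = c *: br z x + br z y) ->
  lpeval br th (lbr_expr s s') = br (lpeval br th s) (lpeval br th s').
Proof.
move=> brl brr.
have br0l z : br 0 z = 0.
  by have := brl (-1) 0 0 z; rewrite scaler0 addr0 scaleN1r addNr.
have br0r z : br z 0 = 0.
  by have := brr (-1) 0 0 z; rewrite scaler0 addr0 scaleN1r addNr.
have brD x y z : br (x + y) z = br x z + br y z.
  by rewrite -[x]scale1r brl !scale1r.
have brDr x y z : br z (x + y) = br z x + br z y.
  by rewrite -[x]scale1r brr !scale1r.
rewrite /lpeval big_allpairs_dep (big_morph (br^~ _) (fun x y => brD x y _) (br0l _)).
apply: eq_bigr => p _; rewrite (big_morph (br _) (fun x y => brDr x y _) (br0r _)).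
apply: eq_bigr => q _ /=; rewrite -[_ *: leval br th p.2]addr0 brl br0l addr0.
by rewrite -[_ *: leval br th q.2]addr0 brr br0r addr0 scalerA.
Qed.

End LieExpressions.

Section LieElements.
Variables (K : fieldType) (X : Type) (R : presentation K X).
Implicit Types (x y : palg R) (f g : cpalg R).

Definition is_lie k x := exists s : seq (K * lmon X),
  all (fun p => ldeg p.2 == k) s /\ x = lpeval (@commutator K (palg R)) pgen s.

Lemma is_lie0 k : is_lie k 0.
Proof. by exists [::]; rewrite /lpeval big_nil. Qed.
Lemma is_lieD k x y : is_lie k x -> is_lie k y -> is_lie k (x + y).
Proof.
move=> [s [sk ->]] [s' [sk' ->]]; exists (s ++ s').
by rewrite all_cat sk sk' /lpeval big_cat.
Qed.
Lemma is_lieZ k c x : is_lie k x -> is_lie k (c *: x).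
Proof.
move=> [s [sk ->]]; exists [seq (c * p.1, p.2) | p <- s]; split.
  by rewrite all_map; apply: sub_all sk.
rewrite /lpeval big_map scaler_sumr; apply: eq_bigr => p _.
by rewrite scalerA.
Qed.
Lemma is_lie_sum k (I : Type) (r : seq I) (P : pred I) (F : I -> palg R) :
  (forall i, P i -> is_lie k (F i)) -> is_lie k (\sum_(i <- r | P i) F i).
Proof.
by move=> FP; apply: (big_ind (is_lie k) (is_lie0 k) (@is_lieD k)).
Qed.
Lemma is_lie_gen a : is_lie 1 (pgen a).
Proof. by exists [:: (1, LGen a)]; rewrite /lpeval big_seq1 /= scale1r. Qed.
Lemma is_lie_cgen a k : is_lie k ((cgen a : cpalg R) k).
Proof. by rewrite cgenE; case: eqP => [->|_]; [apply: is_lie_gen | apply: is_lie0]. Qed.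

Lemma is_lie_comm k l x y :
  is_lie k x -> is_lie l y -> is_lie (k + l) (commutator x y).
Proof.
move=> [s [sk ->]] [s' [sl ->]]; exists (lbr_expr s s').
split; first exact: lbr_expr_deg.
by rewrite lpeval_lbr //; [apply: commutator_linl | apply: commutator_linr].
Qed.

Lemma commutator_comp f g k :
  commutator f g k = \sum_(i < k.+1) commutator (f i) (g (k - i)%N).
Proof.
rewrite ccompB !ccompM [in X in _ - X](reindex_inj rev_ord_inj) -sumrB.
apply: eq_bigr => i _; rewrite /= subSS /commutator.
by rewrite subKn // -ltnS.
Qed.

Definition lie_upto n f := filt 1 f /\ forall k, (k < n)%N -> is_lie k (f k).

(** Neither factor has a constant term, so a component of the commutator in degree at most n only
    involves components of degree below n. *)
Lemma lie_upto_comm n f g :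
  lie_upto n f -> lie_upto n g -> lie_upto n.+1 (commutator f g).
Proof.
move=> [f1 fn] [g1 gn]; split.
  by apply: (@filtW _ _ _ 1 2) => //; apply: filtB; apply: (@filtM _ _ _ 1 1).
move=> k; rewrite ltnS => kn; rewrite commutator_comp; apply: is_lie_sum => i _.
have [i0|i_gt0] := posnP i.
  rewrite i0 f1 // /commutator mul0r mulr0 subr0; exact: is_lie0.
have [ik|ki] := ltnP i k; last first.
  have -> : (k - i = 0)%N by apply/eqP; rewrite subn_eq0.
  rewrite g1 // commutator0r; exact: is_lie0.
rewrite -{1}(subnKC (ltnW ik)); apply: is_lie_comm; [apply: fn | apply: gn].
  exact: leq_trans ik kn.
by apply: leq_trans kn; rewrite ltn_subrL i_gt0 (leq_ltn_trans _ ik).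
Qed.

End LieElements.

Section CBH.
Variable K : fieldType.
Hypothesis charK : [pchar K] =i pred0.

Let A : ncseries K := cgen false.
Let B : ncseries K := cgen true.

Lemma cexp_gen_mul_comp0 (X : Type) (R : presentation K X) (x y : cpalg R) :
  filt 1 x -> filt 1 y -> (cexp x * cexp y) 0%N = 1.
Proof. by move=> x1 y1; rewrite ccompM big_ord1 !cexp_comp0 // mulr1. Qed.

Let Z := cbh K.
Let EAB0 : (cexp A * cexp B) 0%N = 1.
Proof. by apply: cexp_gen_mul_comp0; apply: filt_gen. Qed.
Lemma cbh_filt : filt 1 Z. Proof. exact: clog_filt. Qed.

Let EZ : cexp Z = cexp A * cexp B. Proof. exact: cexp_clog. Qed.

(* Euler's derivation applied to [e^Z = e^A e^B] expresses [deg Z_k * Z_k] as  *)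
(* a sum of iterated brackets of generators and of components of degree < k.   *)
Lemma cbh_lie : lie_series Z.
Proof.
have Zf := cbh_filt.
pose ad i y : ncseries K := iter i (commutator Z) y.
have adF i y : filt i (ad i y).
  elim: i => [|i IHi] //; rewrite /ad iterS -add1n.
  by apply: filtB; [apply: filtM | rewrite addnC; apply: filtM].
(* The two expressions for E(e^Z) e^{-Z}: the derivative of the exponential on the left; on the
   right E(e^A e^B) = A e^Z + e^Z B, followed by e^Z B = e^{ad Z}(B) e^Z. *)
have key : csum (fun i => (i.+1`!%:R)^-1 *: ad i (euler Z))
    = A + csum (fun i => (i`!%:R)^-1 *: ad i B).
  apply: (@mulr_unip_cancel _ _ _ _ _ (cexp Z)); first by rewrite EZ.
  rewrite -euler_cexp // mulrDl -cexp_mul // EZ eulerM.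
  have eg a : euler (cexp (cgen a)) = (cgen a : ncseries K) * cexp (cgen a).
    rewrite euler_cexp_comm ?euler_gen //; first exact: filt_gen.
    exact: commutatorxx.
  rewrite !eg -[in RHS]mulrA (@cexp_commute _ _ _ charK B) ?commutatorxx //.
    by rewrite -!mulrA.
  exact: filt_gen.
have sS0 y : summable (fun i => (i`!%:R : K)^-1 *: ad i y).
  by apply: filt_summable => i; apply/filtZ/adF.
have sS1 y : summable (fun i => (i.+1`!%:R : K)^-1 *: ad i y).
  by apply: filt_summable => i; apply/filtZ/adF.
(* With the terms for i = 0 split off, E Z is A + B plus terms with at least one bracket with [Z].
   By [lie_upto_comm] these are Lie in degree k + 1 once [Z] is Lie in degrees at most k; division
   by k + 1 then closes the induction. *)
move: key; rewrite csum_recl // [in RHS]csum_recl // {1 3}/ad /= !invr1 !scale1r => key.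
elim/ltn_ind => -[_|k IHk].
  by rewrite Zf //; apply: is_lie0.
have ZU : lie_upto k.+1 Z by split.
have adU i y : lie_upto k.+1 y -> lie_upto k.+2 (ad i.+1 y).
  move=> yU; elim: i => [|i IHi]; first exact: lie_upto_comm.
  rewrite /ad iterS; have [u1 u2] := lie_upto_comm ZU yU.
  have [v1 v2] := IHi; apply: lie_upto_comm => //.
  by split=> // j jk; apply: v2; apply: ltnW.
have csumU (u : nat -> ncseries K) : (forall i, lie_upto k.+2 (u i)) ->
    is_lie k.+1 (csum u k.+1).
  move=> uU /=; apply: is_lie_sum => i _. 
  by have [_ uk] := uU i; apply: (uk k.+1 (ltnSn _)).
have genU a : lie_upto k.+1 (cgen a : ncseries K).
  by split=> [|j _]; [apply: filt_gen | apply: is_lie_cgen].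
have eZU : lie_upto k.+1 (euler Z).
  by split=> [|j jk]; [apply: euler_filt | rewrite eulerE; apply/is_lieZ/(proj2 ZU)].
have scU (c : K) (f : ncseries K) : lie_upto k.+2 f -> lie_upto k.+2 (c *: f).
  by move=> [f1 f2]; split=> [|j jk]; [apply: filtZ | rewrite ccompZ; apply/is_lieZ/f2].
change (is_lie k.+1 (Z k.+1)).
have -> : Z k.+1 = k.+1%:R^-1 *: (k.+1%:R *: Z k.+1).
  by rewrite scalerA mulVf ?natrS_neq0 // scale1r.
apply: is_lieZ; rewrite -eulerE.
set b := csum _ in key; set a := csum _ in key.
have -> : euler Z = A + (B + a) - b by rewrite -key addrK.
rewrite ccompB !ccompD -scaleN1r; apply: is_lieD.
  apply: is_lieD; first exact: is_lie_cgen.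
  by apply: is_lieD; [apply: is_lie_cgen | apply: csumU => i; apply/scU/adU/genU].
by apply/is_lieZ/csumU => i; apply/scU/adU/eZU.
Qed.
End CBH.

(** * Lie series over a presented algebra *)

Section Actions.
Variables (K : fieldType) (X : Type) (R : presentation K X) (N : lmodType K).
Variable act : X -> N -> N.

(** The counterpart of [neval] for modules: operators on generators that satisfy the relations
    extend to an action of the presented algebra. *)
Fixpoint nact (e : nexp K X) : N -> N :=
  match e with
  | NCst c => *:%R c
  | NGen x => act x
  | NAdd e1 e2 => fun n => nact e1 n + nact e2 n
  | NMul e1 e2 => fun n => nact e1 (nact e2 n)
  end.

Hypothesis act_lin : forall x c m n, act x (c *: m + n) = c *: act x m + act x n.
Hypothesis act_rel : forall e f, prel R e f -> nact e =1 nact f.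

Lemma nact_lin e c m n : nact e (c *: m + n) = c *: nact e m + nact e n.
Proof.
elim: e m n => [a|x|e1 IH1 e2 IH2|e1 IH1 e2 IH2] m n //=.
- by rewrite scalerDr !scalerA mulrC.
- by rewrite IH1 IH2 scalerDr addrACA.
- by rewrite IH2 IH1.
Qed.

Lemma nact_pcong e f : pcong R e f -> nact e =1 nact f.
Proof.
have nactD e' m n : nact e' (m + n) = nact e' m + nact e' n.
  by rewrite -[m]scale1r nact_lin !scale1r.
have nact0 e' : nact e' 0 = 0 by apply: (@addrI _ (nact e' 0)); rewrite -nactD !addr0.
have nactZ e' c m : nact e' (c *: m) = c *: nact e' m.
  by rewrite -[c *: m]addr0 nact_lin nact0 addr0.
elim=> {e f} /=.
- exact: act_rel.
- by [].
- by move=> e f _ ef n; rewrite ef.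
- by move=> e f g _ ef _ fg n; rewrite ef fg.
- by move=> e e' f f' _ ee _ ff n; rewrite ee ff.
- by move=> e e' f f' _ ee _ ff n; rewrite ff ee.
- by move=> e f g n; rewrite addrA.
- by move=> e f n; rewrite addrC.
- by move=> e n; rewrite scale0r add0r.
- by move=> e n; rewrite scaleN1r scale0r addNr.
- by [].
- by move=> e n; rewrite scale1r.
- by [].
- by move=> e f g n; rewrite nactD.
- by move=> a b n; rewrite scalerDl.
- by move=> a b n; rewrite scalerA.
- by move=> a e n; rewrite nactZ.
Qed.

Definition pact (x : palg R) : N -> N := nact (repr x).

Lemma pact_pi e : pact (\pi_(palg R) e) =1 nact e.
Proof. exact/nact_pcong/repr_pcong. Qed.
Lemma pactD x y n : pact (x + y) n = pact x n + pact y n.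
Proof.
rewrite -[x + y]/(padd x y); elim/quotW: x => x; elim/quotW: y => y.
by rewrite !piE !pact_pi.
Qed.
Lemma pactM x y n : pact (x * y) n = pact x (pact y n).
Proof.
rewrite -[x * y]/(pmul x y); elim/quotW: x => x; elim/quotW: y => y.
by rewrite !piE !pact_pi.
Qed.
Lemma pact_cst c n : pact (pcst R c) n = c *: n.
Proof. by rewrite !piE pact_pi. Qed.
Lemma pactZ c x n : pact (c *: x) n = c *: pact x n.
Proof. by rewrite -[c *: x]/(pcst R c * x) pactM pact_cst. Qed.
Lemma pact0 n : pact 0 n = 0.
Proof. by rewrite -[0 : palg R]/(pcst R 0) pact_cst scale0r. Qed.
Lemma pact1 n : pact 1 n = n.
Proof. by rewrite -[1 : palg R]/(pcst R 1) pact_cst scale1r. Qed.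
Lemma pact_gen a : pact (pgen a) =1 act a.
Proof. exact: pact_pi. Qed.
Lemma pact_commutator x y n :
  pact (commutator x y) n = pact x (pact y n) - pact y (pact x n).
Proof. by rewrite /commutator pactD -[- (y * x)]scaleN1r pactZ !pactM scaleN1r. Qed.

End Actions.

Section PevalLie.
Variables (K : fieldType) (X Y : Type) (B : algType K).

Lemma peval_leval (th : Y -> B) (m : lmon Y) :
  peval th (leval (@commutator K (palg (free_pres K Y))) pgen m)
  = leval (@commutator K B) th m.
Proof.
elim: m => [a|m IHm n IHn] /=; first by rewrite peval_gen.
rewrite /commutator -scaleN1r peval_add // peval_scale // !peval_mul //.
by rewrite scaleN1r IHm IHn.
Qed.

Lemma peval_lpeval (th : Y -> B) (s : seq (K * lmon Y)) :
  peval th (lpeval (@commutator K (palg (free_pres K Y))) pgen s)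
  = lpeval (@commutator K B) th s.
Proof.
rewrite /lpeval peval_sum //; apply: eq_bigr => p _.
by rewrite peval_scale // peval_leval.
Qed.

Lemma lie_series_exprP (f : cpalg (free_pres K Y)) k :
  lie_series f -> lie_expr k (f k) (xget [::] (lie_expr k (f k))).
Proof. by move=> /(_ k); apply: xgetPex. Qed.

End PevalLie.

(* A Lie bracket lowering degrees by one, as the bracket of a linear Poisson   *)
(* structure.                                                                  *)
Record poisson_like (K : fieldType) (Y : Type) (S : presentation K Y)
    (br : cpalg S -> cpalg S -> cpalg S) : Prop := PoissonLike {
  plike_lin : forall c f g h, br (c *: f + g) h = c *: br f h + br g h;
  plike_anti : forall f g, br f g = - br g f;
  plike_jacobi : forall f g h, br f (br g h) + br g (br h f) + br h (br f g) = 0;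
  plike_filt : forall i j f g,
    filt i.+1 f -> filt j.+1 g -> filt (i + j).+1 (br f g) }.

(* The Dynkin-Specht-Wever argument.  Let L act on L + K.1 by                  *)
(* x.(l, c) = ([x, l] + c x, 0).  A Lie monomial m of degree k in the          *)
(* generators sends (0, 1) to (k m, 0), whence a well-defined linear map from  *)
(* the presented associative algebra to L that is, up to the factor k, a Lie   *)
(* morphism on Lie elements: no embedding of the presented Lie algebra in its  *)
(* enveloping algebra is needed.                                               *)
Section Dynkin.
Variables (K : fieldType) (X Y : Type).
Variables (S : presentation K Y) (br : cpalg S -> cpalg S -> cpalg S).
Hypothesis brP : poisson_like br.
Hypothesis charK : [pchar K] =i pred0.

Local Notation L := (cpalg S).

Lemma plikeDl f g h : br (f + g) h = br f h + br g h.
Proof. by rewrite -[f]scale1r (plike_lin brP) !scale1r. Qed.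
Lemma plike0l h : br 0 h = 0.
Proof. by apply: (@addrI _ (br 0 h)); rewrite -plikeDl !addr0. Qed.
Lemma plike0r h : br h 0 = 0.
Proof. by rewrite (plike_anti brP) plike0l oppr0. Qed.
Lemma plikeZl c f h : br (c *: f) h = c *: br f h.
Proof. by rewrite -[c *: f]addr0 (plike_lin brP) plike0l addr0. Qed.
Lemma plikeNl f h : br (- f) h = - br f h.
Proof. by rewrite -scaleN1r plikeZl scaleN1r. Qed.
Lemma plikeNr f h : br h (- f) = - br h f.
Proof. by rewrite (plike_anti brP) plikeNl -(plike_anti brP). Qed.
Lemma plikeBl f g h : br (f - g) h = br f h - br g h.
Proof. by rewrite plikeDl plikeNl. Qed.
Lemma plike_linr c f g h : br h (c *: f + g) = c *: br h f + br h g.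
Proof.
rewrite (plike_anti brP) (plike_lin brP) opprD -scalerN.
by rewrite -!(plike_anti brP h).
Qed.
Lemma plikeDr f g h : br h (f + g) = br h f + br h g.
Proof. by rewrite -[f]scale1r plike_linr !scale1r. Qed.
Lemma plikeZr c f h : br h (c *: f) = c *: br h f.
Proof. by rewrite -[c *: f]addr0 plike_linr plike0r addr0. Qed.
Lemma plikeBr f g h : br h (f - g) = br h f - br h g.
Proof. by rewrite plikeDr plikeNr. Qed.
Lemma plike_derivation x y l : br (br x y) l = br x (br y l) - br y (br x l).
Proof.
rewrite (plike_anti brP); apply/eqP; rewrite eq_sym -subr_eq0 opprK.
rewrite [br x l](plike_anti brP) plikeNr opprK.
by rewrite (plike_jacobi brP).
Qed.

Variables (R : presentation K X) (th : X -> L).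
Hypothesis th2 : forall x, filt 2 (th x).

Definition dynkin_act (x : X) (n : L * K^o) : L * K^o :=
  (br (th x) n.1 + (n.2 : K) *: th x, 0).

Hypothesis thR : forall e f, prel R e f -> nact dynkin_act e =1 nact dynkin_act f.

Let act_lin x c m n :
  dynkin_act x (c *: m + n) = c *: dynkin_act x m + dynkin_act x n.
Proof.
rewrite /dynkin_act -[RHS]/(_, _) /=; congr (_, _); last by rewrite scaler0 addr0.
by rewrite plike_linr scalerDl scalerDr addrACA scalerA.
Qed.

Definition dynkin (x : palg R) : L := (pact dynkin_act x (0, 1)).1.

Let M := leval br th.
Let brk := @commutator K (palg R).

(** On the first component a Lie monomial acts by its adjoint, by the Jacobi identity. On the
    scalar, a bracket of m and n gives [M m, deg n M n] - [M n, deg m M m], and the two degrees add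
    up. *)
Lemma pact_leval m l c :
  pact dynkin_act (leval brk pgen m) (l, c)
  = (br (M m) l + c *: ((ldeg m)%:R *: M m), 0).
Proof.
elim: m l c => [x|m IHm n IHn] l c /=; first by rewrite pact_gen // /dynkin_act scale1r.
rewrite pact_commutator // !(IHm, IHn); congr (_, _) => /=; last by rewrite subrr.
rewrite !scale0r !addr0 !plikeDr !plikeZr [in br (M n) (M m)](plike_anti brP).
rewrite opprD !scalerN opprK addrACA -plike_derivation -!scalerDr -scalerDl.
by rewrite -natrD addnC.
Qed.

Lemma dynkin_leval m : dynkin (leval brk pgen m) = (ldeg m)%:R *: M m.
Proof. by rewrite /dynkin pact_leval plike0r add0r scale1r. Qed.

Lemma dynkinD x y : dynkin (x + y) = dynkin x + dynkin y.
Proof. by rewrite /dynkin pactD. Qed.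
Lemma dynkinZ c x : dynkin (c *: x) = c *: dynkin x.
Proof. by rewrite /dynkin pactZ. Qed.
Lemma dynkin0 : dynkin 0 = 0.
Proof. by rewrite /dynkin pact0. Qed.

Lemma dynkin_sum (I : Type) (r : seq I) (P : pred I) (F : I -> palg R) :
  dynkin (\sum_(i <- r | P i) F i) = \sum_(i <- r | P i) dynkin (F i).
Proof. exact: (big_morph _ dynkinD dynkin0). Qed.

Lemma dynkin_gen a : dynkin (pgen a) = th a.
Proof. by rewrite (dynkin_leval (LGen a)) /= scale1r. Qed.

Lemma dynkin1 : dynkin 1 = 0.
Proof. by rewrite /dynkin pact1. Qed.

Lemma dynkin_prod a b r : dynkin (\prod_(c <- [:: a, b & r]) pgen c)
  = br (th a) (dynkin (\prod_(c <- b :: r) pgen c)).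
Proof.
rewrite /dynkin big_cons pactM // pact_gen // big_cons pactM // pact_gen //.
by rewrite /dynkin_act /= scale0r addr0.
Qed.

(** Generators go to elements of order 2, and each bracket with one of them raises the order by 2 -
    1 = 1. *)
Lemma dynkin_filt k x : homog k x -> filt k.+1 (dynkin x).
Proof.
move=> [s ->]; rewrite dynkin_sum; apply: filt_sum => p _.
rewrite dynkinZ; apply: filtZ; rewrite -{1}(size_tuple p.2).
case: (tval p.2) => [|a r]; first by rewrite big_nil dynkin1.
elim: r a => [|b r IHr] a; first by rewrite big_seq1 dynkin_gen.
rewrite dynkin_prod; exact: (plike_filt brP (th2 a) (IHr b)).
Qed.

(** In degree 0 the inverse is 0 by convention, which is harmless since [dynkin 1] vanishes. *)
Definition lie_value k (x : palg R) : L := k%:R^-1 *: dynkin x.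

(** The left side depends only on the element of the associative algebra, so the value of a Lie
    expression does not depend on the expression. The degree is invertible in characteristic 0. *)
Lemma lie_value_lpeval k s : all (fun p => ldeg p.2 == k) s ->
  lie_value k (lpeval brk pgen s) = lpeval br th s.
Proof.
move=> sk; rewrite /lie_value /lpeval dynkin_sum scaler_sumr.
elim: s sk => [|p s IHs] /=; first by rewrite !big_nil.
case/andP=> /eqP pk /IHs sE; rewrite !big_cons sE dynkinZ dynkin_leval pk.
congr (_ + _); rewrite !scalerA.
have : (0 < k)%N by rewrite -pk; elim: (p.2) => //= m m0 n _; rewrite ltn_addr.
by case: k {sE IHs} pk => // k _ _; rewrite mulrCA mulVf ?mulr1 ?natrS_neq0.
Qed.

Lemma lie_value_commutator k l x y : is_lie k x -> is_lie l y ->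
  lie_value (k + l) (commutator x y) = br (lie_value k x) (lie_value l y).
Proof.
move=> [s [sk ->]] [s' [sl ->]].
rewrite -lpeval_lbr; [|exact: commutator_linl|exact: commutator_linr].
rewrite !lie_value_lpeval ?lbr_expr_deg // lpeval_lbr //.
  by move=> c x' y' z; rewrite (plike_lin brP).
by move=> c x' y' z; rewrite plike_linr.
Qed.

Definition lie_map (f : cpalg R) : L := csum (fun k => lie_value k (f k)).

Lemma lie_value_filt (f : cpalg R) k : filt k.+1 (lie_value k (f k)).
Proof. exact/filtZ/dynkin_filt/chomog. Qed.

Lemma lie_map_summable (f : cpalg R) : summable (fun k => lie_value k (f k)).
Proof. by apply: filt_summable => p; apply: (filtW (leqnSn p) (@lie_value_filt f p)). Qed.

Lemma lie_map_lin c f g : lie_map (c *: f + g) = c *: lie_map f + lie_map g.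
Proof.
have sS := lie_map_summable.
rewrite /lie_map -(csumZ c (sS f)) -(csumD (summableZ c (sS f)) (sS g)).
apply: csum_eq => k; rewrite ccompD ccompZ /lie_value dynkinD dynkinZ scalerDr.
by rewrite !scalerA mulrC.
Qed.
Lemma lie_mapD f g : lie_map (f + g) = lie_map f + lie_map g.
Proof. by rewrite -[f]scale1r lie_map_lin !scale1r. Qed.
Lemma lie_map0 : lie_map 0 = 0.
Proof. by apply: (@addrI _ (lie_map 0)); rewrite -lie_mapD !addr0. Qed.
Lemma lie_mapZ c f : lie_map (c *: f) = c *: lie_map f.
Proof. by rewrite -[c *: f]addr0 lie_map_lin lie_map0 addr0. Qed.
Lemma lie_mapB f g : lie_map (f - g) = lie_map f - lie_map g.
Proof. by rewrite -scaleN1r lie_mapD lie_mapZ scaleN1r. Qed.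
Lemma lie_map_sum (I : Type) (r : seq I) (P : pred I) (F : I -> cpalg R) :
  lie_map (\sum_(i <- r | P i) F i) = \sum_(i <- r | P i) lie_map (F i).
Proof. exact: (big_morph _ lie_mapD lie_map0). Qed.
Lemma lie_map_gen a : lie_map (cgen a) = th a.
Proof.
rewrite /lie_map (@csum_finite _ _ _ _ 2).
  rewrite !big_ord_recl big_ord0 !cgenE /lie_value /= dynkin0 scaler0 add0r addr0.
  by rewrite (dynkin_leval (LGen a)) /= scale1r invr1 scale1r.
by case=> [|[|p]] // _; rewrite cgenE /lie_value dynkin0 scaler0.
Qed.
Lemma lie_map_filt k f : filt k f -> filt k.+1 (lie_map f).
Proof.
move=> fk; apply: csum_filt => p; have [pk|kp] := ltnP p k.
  by rewrite fk // /lie_value dynkin0 scaler0.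
by apply: (@filtW _ _ _ k.+1 p.+1) => //; apply: lie_value_filt.
Qed.
Lemma lie_map_csum u : summable u -> lie_map (csum u) = csum (lie_map \o u).
Proof.
by case/(csum_cont lie_mapB) => // k; exists k => f /lie_map_filt; apply: filtW.
Qed.

Definition lie_series_of (f : cpalg R) := forall k, is_lie k (f k).

Lemma lie_series_of_commutator f g :
  lie_series_of f -> lie_series_of g -> lie_series_of (commutator f g).
Proof.
move=> fL gL k; rewrite commutator_comp; apply: is_lie_sum => i _.
by rewrite -{1}(subnKC (ltn_ord i : (i <= k)%N)); apply: is_lie_comm.
Qed.

(** Both sides are sums over pairs of degrees, matched term by term by [lie_value_commutator]; the
    shift 1 in [csum_bilinear] is the degree lost by the bracket. *)
Lemma lie_map_commutator f g : lie_series_of f -> lie_series_of g ->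
  lie_map (commutator f g) = br (lie_map f) (lie_map g).
Proof.
move=> fL gL; rewrite {2 3}/lie_map.
rewrite (@csum_bilinear _ _ _ 1 br); last first.
- by move=> p; rewrite addn1; apply: lie_value_filt.
- by move=> p; rewrite addn1; apply: lie_value_filt.
- by move=> i j f' g'; rewrite !addn1; apply: (plike_filt brP).
- by move=> f' g' h; rewrite plikeBr.
- by move=> f' g' h; rewrite plikeBl.
apply: csum_eq => n; rewrite commutator_comp.
rewrite {1}/lie_value dynkin_sum scaler_sumr; apply: eq_bigr => i _.
rewrite -lie_value_commutator //.
by rewrite subnKC // -ltnS.
Qed.

Section Substitution.
Variables (Z : Type) (sg : Z -> cpalg R).
Hypothesis sg1 : forall z, filt 1 (sg z).
Hypothesis sgL : forall z, lie_series_of (sg z).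

Lemma lie_map_leval m :
  lie_series_of (leval (@commutator K (cpalg R)) sg m) /\
  lie_map (leval (@commutator K (cpalg R)) sg m) = leval br (lie_map \o sg) m.
Proof.
elim: m => [z|m [mL mE] n [nL nE]] //=; split.
  exact: lie_series_of_commutator.
by rewrite lie_map_commutator // mE nE.
Qed.

Lemma lie_map_lpeval s :
  lie_series_of (lpeval (@commutator K (cpalg R)) sg s) /\
  lie_map (lpeval (@commutator K (cpalg R)) sg s) = lpeval br (lie_map \o sg) s.
Proof.
split=> [k|]; rewrite /lpeval.
  rewrite ccomp_sum; apply: is_lie_sum => p _.
  by rewrite ccompZ; apply/is_lieZ/(proj1 (lie_map_leval _)).
rewrite lie_map_sum; apply: eq_bigr => p _.
by rewrite lie_mapZ (proj2 (lie_map_leval _)).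
Qed.

(** The bridge between the two sides: substituting Lie series in a Lie series becomes evaluation
    under [br]. It is applied to the Campbell-Hausdorff series and to log Phi. *)
Lemma lie_map_cmor (f : cpalg (free_pres K Z)) : lie_series f ->
  lie_series_of (cmor sg f) /\ lie_map (cmor sg f) = lie_eval br (lie_map \o sg) f.
Proof.
move=> fL.
have fE k : peval sg (f k)
    = lpeval (@commutator K (cpalg R)) sg (xget [::] (lie_expr k (f k))).
  by have [_ {1}->] := lie_series_exprP k fL; rewrite peval_lpeval.
split=> [k|].
  rewrite /cmor; apply: is_lie_sum => p _.
  by rewrite fE; apply: (proj1 (lie_map_lpeval _)).
rewrite /cmor lie_map_csum; last exact: cmor_summable.
by apply: csum_eq => k /=; rewrite fE (proj2 (lie_map_lpeval _)).
Qed.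

End Substitution.

(** log(e^x e^y) is the Campbell-Hausdorff series with x and y substituted, and that series is Lie,
    so [lie_map_cmor] applies. *)
Lemma lie_map_star x y : filt 1 x -> filt 1 y ->
  lie_series_of x -> lie_series_of y ->
  let z := clog (cexp x * cexp y) in
  [/\ filt 1 z, lie_series_of z & star br (lie_map x) (lie_map y) = lie_map z].
Proof.
move=> x1 y1 xL yL z.
have xy0 : (cexp x * cexp y) 0%N = 1 by exact: cexp_gen_mul_comp0.
have s1 b : filt 1 (subst2 x y b) by case: b.
have sL b : lie_series_of (subst2 x y b) by case: b.
have FP : cmorphism (cmor (subst2 x y) : ncseries K -> cpalg R) by apply: cmorP.
have zE : cmor (subst2 x y) (cbh K) = z.
  rewrite /cbh (cmorphism_clog FP); last first.
    case=> // _; rewrite ccompB cexp_gen_mul_comp0 ?subrr //; exact: filt_gen.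
  rewrite (cmorphism_mul FP) !(cmorphism_cexp FP); try exact: filt_gen.
  by rewrite !cmor_gen.
have [zL zV] := lie_map_cmor s1 sL (cbh_lie charK).
split; first exact: clog_filt.
  by rewrite -zE.
rewrite -zE zV /star; congr (lie_eval br _ _).
by apply: funext; case.
Qed.

End Dynkin.

(** * Linear Poisson structures *)

Section SymmetricAlgebra.
Variables (K : fieldType) (W : lmodType K).
Local Notation S := (symhat W).
Implicit Types (f g h : S) (u v : W).

Lemma cgen_lin c u v : cgen (c *: u + v) = c *: cgen u + cgen v :> S.
Proof.
apply: cpalgP => k; rewrite ccompD ccompZ !cgenE; case: ifP => _; last first.
  by rewrite scaler0 addr0.
rewrite -[c *: pgen u]/(pmul (pcst _ c) (pgen u)) -[RHS]/(padd _ _) /pgen !piE.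
by apply/palgP/pc_rel/sym_lin.
Qed.
Lemma cgenD u v : cgen (u + v) = cgen u + cgen v :> S.
Proof. by rewrite -[u]scale1r cgen_lin !scale1r. Qed.
Lemma cgen0 : cgen 0 = 0 :> S.
Proof. by apply: (@addrI _ (cgen 0)); rewrite -cgenD !addr0. Qed.
Lemma cgenN u : cgen (- u) = - cgen u :> S.
Proof. by rewrite -[- u]addr0 -scaleN1r cgen_lin cgen0 addr0 scaleN1r. Qed.
Lemma cgen_sum (I : Type) (r : seq I) (P : pred I) (F : I -> W) :
  cgen (\sum_(i <- r | P i) F i) = \sum_(i <- r | P i) cgen (F i) :> S.
Proof. exact: (big_morph _ cgenD cgen0). Qed.

Lemma symhatC f g : f * g = g * f.
Proof.
apply: ccomp_comm => a b; apply: cpalgP => k; rewrite !cgenM; case: k => // k.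
rewrite !cgenE; case: ifP => _; last by rewrite !mulr0.
rewrite -[pgen a * _]/(pmul (pgen a) (pgen b)) -[RHS]/(pmul _ _) /pgen !piE.
by apply/palgP/pc_rel/sym_comm.
Qed.
Lemma sym_respects (B : algType K) (th : W -> B) :
  (forall u v, th u * th v = th v * th u) ->
  (forall c u v, th (c *: u + v) = c *: th u + th v) ->
  forall e e', prel (sym_pres W) e e' -> neval th e = neval th e'.
Proof.
move=> thC thL e e'; case=> [u v|c u v] /=; first exact: thC.
by rewrite thL -scalerAl mul1r.
Qed.

Lemma cgen_respects e e' : prel (sym_pres W) e e' ->
  neval (cgen : W -> S) e = neval cgen e'.
Proof. by apply: sym_respects => *; [apply: symhatC | apply: cgen_lin]. Qed.

Lemma cmor_cgen f : cmor (cgen : W -> S) f = f.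
Proof.
apply: (cmorphism_ext (F := cmor cgen) (G := id)); last 1 first.
- by move=> a; rewrite cmor_gen //; exact: cgen_respects.
- by apply: cmorP; [exact: cgen_respects | exact: filt_gen].
- exact: cmorphism_id.
Qed.

Record derivation (F : S -> S) : Prop := Derivation {
  derivation_lin : forall c f g, F (c *: f + g) = c *: F f + F g;
  derivation_mul : forall f g, F (f * g) = F f * g + f * F g;
  derivation_filt : forall k f, filt k f -> filt k.-1 (F f) }.

Section DerivationTheory.
Variable F : S -> S.
Hypothesis FP : derivation F.
Lemma derivationD f g : F (f + g) = F f + F g.
Proof. by rewrite -[f]scale1r (derivation_lin FP) !scale1r. Qed.
Lemma derivation0 : F 0 = 0.
Proof. by apply: (@addrI _ (F 0)); rewrite -derivationD !addr0. Qed.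
Lemma derivationZ c f : F (c *: f) = c *: F f.
Proof. by rewrite -[c *: f]addr0 (derivation_lin FP) derivation0 addr0. Qed.
Lemma derivationNE f : F (- f) = - F f.
Proof. by rewrite -scaleN1r derivationZ scaleN1r. Qed.
Lemma derivationB f g : F (f - g) = F f - F g.
Proof. by rewrite -scaleN1r derivationD derivationZ scaleN1r. Qed.
Lemma derivation_sum (I : Type) (r : seq I) (P : pred I) (G : I -> S) :
  F (\sum_(i <- r | P i) G i) = \sum_(i <- r | P i) F (G i).
Proof. exact: (big_morph F derivationD derivation0). Qed.
Lemma derivation_cst c : F c%:A = 0.
Proof.
rewrite derivationZ; have := derivation_mul FP 1 1.
by rewrite !mulr1 mul1r -{1}[F 1]addr0 => /addrI <-; rewrite scaler0.
Qed.
End DerivationTheory.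

Lemma derivation_ext (F G : S -> S) : derivation F -> derivation G ->
  (forall u, F (cgen u) = G (cgen u)) -> F =1 G.
Proof.
move=> FP GP FG; apply: cpalg_dense_ind => //.
- by move=> c; rewrite !derivation_cst.
- by move=> f g; rewrite (derivationD FP) (derivationD GP) => -> ->.
- by move=> f g; rewrite (derivation_mul FP) (derivation_mul GP) => -> ->.
move=> f fQ; apply: filt_eq => k; have [g FGg fg] := fQ k.+1.
have -> : F f - G f = F (f - g) - G (f - g).
  by rewrite (derivationB FP) (derivationB GP) FGg opprB addrA subrK.
by apply: filtB;
  [apply: derivation_filt FP k.+1 _ fg | apply: derivation_filt GP k.+1 _ fg].
Qed.

Lemma derivation_scaleD c F G : derivation F -> derivation G ->
  derivation (fun f => c *: F f + G f).
Proof.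
move=> FP GP; split=> [a f g|f g|k f fk].
- rewrite (derivation_lin FP) (derivation_lin GP) !scalerDr addrACA !scalerA.
  by rewrite mulrC.
- rewrite (derivation_mul FP) (derivation_mul GP) scalerDr mulrDl mulrDr addrACA.
  by rewrite -scalerAl -scalerAr.
by apply: filtD; [apply/filtZ/(derivation_filt FP) | apply: derivation_filt GP _ _ fk].
Qed.

Section Extension.
Variable D : W -> S.
Hypothesis D_lin : forall c u v, D (c *: u + v) = c *: D u + D v.

(** The Leibniz rule involves the values of the factors, so equality of values and equality of
    derivatives are carried together through the congruence. *)
Lemma nder_pcong e e' : pcong (sym_pres W) e e' -> nder cgen D e = nder cgen D e'.
Proof.
move=> ef; suff [] : neval (cgen : W -> S) e = neval cgen e'
  /\ nder cgen D e = nder cgen D e' by [].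
elim: ef => {e e'} /=.
- move=> e f ef; split; first exact: cgen_respects.
  case: ef => [u v|c u v] /=; first by rewrite addrC symhatC [cgen v * _]symhatC.
  by rewrite D_lin mul0r add0r -scalerAl mul1r.
- by [].
- by move=> e f _ [-> ->].
- by move=> e f g _ [-> ->] _ [-> ->].
- by move=> e e' f f' _ [-> ->] _ [-> ->].
- by move=> e e' f f' _ [-> ->] _ [-> ->].
- by move=> e f g; rewrite !addrA.
- by move=> e f; split; rewrite addrC.
- by move=> e; rewrite scale0r !add0r.
- by move=> e; rewrite !scaleN1r mul0r add0r !mulN1r scale0r !addNr.
- by move=> e f g; rewrite !(mulrA, mulrDl, mulrDr, addrA).
- by move=> e; rewrite scale1r !mul1r mul0r add0r.
- by move=> e f g; rewrite !mulrDl addrACA.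
- by move=> e f g; rewrite !mulrDr addrACA.
- by move=> a b; rewrite scalerDl addr0.
- by move=> a b; rewrite -scalerAl mul1r scalerA mul0r mulr0 addr0.
- move=> a e; rewrite -!scalerAl mul1r -scalerAr mulr1; split=> //.
  by rewrite mul0r mulr0 addr0 add0r mul1r -scalerAr mulr1.
Qed.

Definition pder (x : palg (sym_pres W)) : S := nder cgen D (repr x).

Lemma pder_pi e : pder (\pi_(palg (sym_pres W)) e) = nder cgen D e.
Proof. exact/nder_pcong/repr_pcong. Qed.
Lemma pderD x y : pder (x + y) = pder x + pder y.
Proof.
rewrite -[x + y]/(padd x y); elim/quotW: x => x; elim/quotW: y => y.
by rewrite !piE !pder_pi.
Qed.
Lemma pderM x y :
  pder (x * y) = pder x * peval cgen y + peval cgen x * pder y.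
Proof.
rewrite -[x * y]/(pmul x y); elim/quotW: x => x; elim/quotW: y => y.
rewrite !piE !pder_pi !pevalE //; exact: cgen_respects.
Qed.
Lemma pder_cst c : pder (pcst _ c) = 0.
Proof. by rewrite !piE pder_pi. Qed.
Lemma pderZ c x : pder (c *: x) = c *: pder x.
Proof.
rewrite -[c *: x]/(pcst _ c * x) pderM pder_cst mul0r add0r.
by rewrite peval_cst -?scalerAl ?mul1r //; exact: cgen_respects.
Qed.
Lemma pder0 : pder 0 = 0. Proof. exact: pder_cst. Qed.
Lemma pder_gen a : pder (pgen a) = D a. Proof. exact: pder_pi. Qed.
Lemma pder_sum (I : Type) (r : seq I) (P : pred I) (F : I -> palg (sym_pres W)) :
  pder (\sum_(i <- r | P i) F i) = \sum_(i <- r | P i) pder (F i).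
Proof. exact: (big_morph _ pderD pder0). Qed.

Lemma pder_filt d k x : (forall a, filt d (D a)) -> homog k x ->
  filt (k.-1 + d) (pder x).
Proof.
move=> Dd [s ->]; rewrite pder_sum; apply: filt_sum => p _.
rewrite pderZ; apply: filtZ; rewrite -{1}(size_tuple p.2).
elim: (tval p.2) => [|a r IHr] /=; first by rewrite big_nil -[1]/(pcst _ 1) pder_cst.
rewrite big_cons pderM pder_gen peval_gen; last exact: cgen_respects.
apply: filtD.
  rewrite addnC; apply: filtM => //; rewrite peval_prod; last exact: cgen_respects.
  by move=> j jr; rewrite prod_cgenE (ltn_eqF jr).
(* For an empty tail the predecessor of the length is truncated at 0 and the degree count fails, but
   then the derivative of the tail is 0. *)
case: r IHr => [|b r] IHr; first by rewrite big_nil -[1]/(pcst _ 1) pder_cst mulr0.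
by rewrite /= -add1n -addnA; apply: filtM; [apply: filt_gen | apply: IHr].
Qed.

Definition cder (f : S) : S := csum (fun p => nder cgen D (repr (f p))).

Lemma cder_summable f : summable (fun p => pder (f p)).
Proof.
move=> k; exists k.+1 => -[//|p] kp; apply: (@filtW _ _ _ k p) => //.
by have := pder_filt (fun a => @filt_ge0 _ _ _ (D a)) (chomog f p.+1); rewrite addn0.
Qed.

Lemma cder_gen a : cder (cgen a) = D a.
Proof.
rewrite /cder (@csum_finite _ _ _ _ 2).
  by rewrite !big_ord_recl big_ord0 !cgenE -!/(pder _) pder0 pder_gen add0r addr0.
by case=> [|[|p]] // _; rewrite cgenE -/(pder _) pder0.
Qed.

Lemma cder_filt d k f : (forall a, filt d (D a)) -> filt k f ->
  filt (k.-1 + d) (cder f).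
Proof.
move=> Dd fk; apply: csum_filt => p; have [pk|kp] := ltnP p k.
  by rewrite fk // -/(pder _) pder0.
apply: (@filtW _ _ _ _ (p.-1 + d)); last exact/pder_filt/chomog.
by rewrite leq_add2r; case: k p kp {fk} => // k [].
Qed.

Lemma cderP : derivation cder.
Proof.
have S1 := cder_summable.
have lin c f g : cder (c *: f + g) = c *: cder f + cder g.
  rewrite /cder -(csumZ c (S1 f)) -(csumD (summableZ c (S1 f)) (S1 g)).
  by apply: csum_eq => p; rewrite -/(pder _) ccompD ccompZ pderD pderZ.
have flt k f : filt k f -> filt k.-1 (cder f).
  by move=> fk; rewrite -[k.-1]addn0; apply: cder_filt.
have D' f g : cder (f + g) = cder f + cder g.
  by rewrite -[f]scale1r lin !scale1r.
have zero : cder 0 = 0 by apply: (@addrI _ (cder 0)); rewrite -D' !addr0.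
have Z c f : cder (c *: f) = c *: cder f.
  by rewrite -[c *: f]addr0 lin zero addr0.
have B f g : cder (f - g) = cder f - cder g.
  by rewrite -scaleN1r D' Z scaleN1r.
have one : cder 1 = 0.
  rewrite /cder (@csum_finite _ _ _ _ 1).
    by rewrite big_ord1 ccomp1 -/(pder (pcst _ 1)) pder_cst.
  by case=> // p _; rewrite ccomp1 -/(pder _) pder0.
split=> //; apply: cpalg_dense_ind.
- by move=> c g; rewrite -scalerAl mul1r !Z one scaler0 mul0r add0r -scalerAl mul1r.
- move=> a g; rewrite cder_gen /cder csum_recl; last exact: S1.
  rewrite cgenM -/(pder _) pder0 add0r.
  have LB (h h' : S) : cgen a * (h - h') = cgen a * h - cgen a * h'.
    by rewrite mulrBr.
  have Lf k : exists l, forall h : S, filt l h -> filt k (cgen a * h).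
    by exists k => h; apply: filtMr.
  have LB' (h h' : S) : D a * (h - h') = D a * h - D a * h'.
    by rewrite mulrBr.
  have Lf' k : exists l, forall h : S, filt l h -> filt k (D a * h).
    by exists k => h; apply: filtMr.
  have [S2 ->] := csum_cont LB Lf (S1 g).
  have [S3] := csum_cont LB' Lf' (cmor_summable cgen_respects (@filt_gen _ _ _) g).
  (* The terms in which the leading generator is differentiated sum to [D a * g], since evaluating
     [g] at the generators returns [g]. *)
  rewrite -[csum _]/(cmor cgen g) cmor_cgen => ->; rewrite -csumD //.
  apply: csum_eq => p; rewrite -/(pder _) cgenM pderM pder_gen peval_gen //.
  exact: cgen_respects.
- move=> f f' fQ fQ' g; rewrite mulrDl !D' fQ fQ' !mulrDl.
  by rewrite addrACA.
- by move=> f f' fQ fQ' g; rewrite -mulrA !fQ fQ' mulrDl mulrDr !mulrA addrA.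
move=> f fQ g; apply: filt_eq => k; have [h hQ fh] := fQ k.+1.
have -> : cder (f * g) - (cder f * g + f * cder g)
    = cder ((f - h) * g) - (cder (f - h) * g + (f - h) * cder g).
  by rewrite mulrBl !B hQ !mulrBl [in RHS]addrACA -opprD opprB addrA subrK.
apply: filtB; first exact/(flt k.+1)/filtMl.
apply: filtD; first exact/filtMl/(flt k.+1).
by apply/filtMl; apply: filtW fh.
Qed.

End Extension.

Lemma nder_csum (D : nat -> W -> S) e :
  (forall u, summable (D^~ u)) ->
  summable (fun q => nder cgen (D q) e) /\
  nder cgen (fun u => csum (D^~ u)) e = csum (fun q => nder cgen (D q) e).
Proof.
move=> DS; elim: e => [c|u|e [S1 E1] f [S2 E2]|e [S1 E1] f [S2 E2]] /=.
- by split; [move=> k; exists 0%N | rewrite csum0].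
- by split.
- by split; [apply: summableD | rewrite E1 E2 csumD].
set a := neval _ f; set b := neval _ e.
have LB (h h' : S) : b * (h - h') = b * h - b * h' by rewrite mulrBr.
have Lf k : exists l, forall h : S, filt l h -> filt k (b * h).
  by exists k => h; apply: filtMr.
have LB' (h h' : S) : (h - h') * a = h * a - h' * a by rewrite mulrBl.
have Lf' k : exists l, forall h : S, filt l h -> filt k (h * a).
  by exists k => h; apply: filtMl.
have [S3 E3] := csum_cont LB Lf S2; have [S4 E4] := csum_cont LB' Lf' S1.
by split; [apply: summableD | rewrite E1 E2 E3 E4 csumD].
Qed.

(** By [nder_csum] the sum over the degrees of [g] can be performed inside the derivation, so the
    double series is an iterated extension of derivations. *)
Lemma biderE (beta : W -> W -> S) f g :
  (forall u c v w, beta u (c *: v + w) = c *: beta u v + beta u w) ->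
  bider beta f g = cder (fun u => cder (beta u) g) f.
Proof.
move=> bL; apply: csum_eq => p; symmetry.
have [] // := @nder_csum (fun q u => nder cgen (beta u) (repr (g q))) (repr (f p)).
by move=> u; apply: cder_summable; apply: bL.
Qed.

End SymmetricAlgebra.

(** * The Kostant-Kirillov bracket *)

Section LinearPoisson.
Variables (K : fieldType) (W : lmodType K) (mu : W -> W -> W).
Hypothesis muP : lie_bracket mu.
Local Notation S := (symhat W).
Local Notation P := (kk_poisson mu).
Implicit Types (f g h : S) (u v w : W).

Lemma lie_bracketC u v : mu u v = - mu v u.
Proof.
have muD x y z : mu (x + y) z = mu x z + mu y z.
  by rewrite -[x]scale1r (lie_linl muP) !scale1r.
have muDr x y z : mu z (x + y) = mu z x + mu z y.
  by rewrite -[x]scale1r (lie_linr muP) !scale1r.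
have := lie_alt muP (u + v); rewrite muD !muDr !(lie_alt muP) add0r addr0.
by move/eqP; rewrite addr_eq0 => /eqP.
Qed.
Lemma lie_bracket0l v : mu 0 v = 0.
Proof.
have := lie_linl muP (-1) 0 0 v.
by rewrite scaler0 addr0 scaleN1r addNr.
Qed.
Lemma lie_bracket0r v : mu v 0 = 0.
Proof. by rewrite lie_bracketC lie_bracket0l oppr0. Qed.

Let ad u : S -> S := cder (fun v => cgen (mu u v)).
Let ad_gen_lin u c v w :
  cgen (mu u (c *: v + w)) = c *: cgen (mu u v) + cgen (mu u w) :> S.
Proof. by rewrite (lie_linr muP) cgen_lin. Qed.
Let adP u : derivation (ad u).
Proof. exact/cderP/ad_gen_lin. Qed.
Let ad_gen u v : ad u (cgen v) = cgen (mu u v).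
Proof. exact/cder_gen/ad_gen_lin. Qed.
Let ad_filt u k f : filt k f -> filt k (ad u f).
Proof.
move=> fk; apply: (@filtW _ _ _ _ (k.-1 + 1)); first by rewrite addn1 leqSpred.
by apply: cder_filt => // *; apply: filt_gen.
Qed.
Let ad_lin c u v f : ad (c *: u + v) f = c *: ad u f + ad v f.
Proof.
apply: (derivation_ext (adP _) (derivation_scaleD c (adP u) (adP v))) => w.
by rewrite !ad_gen (lie_linl muP) cgen_lin.
Qed.

Lemma kk_poissonE f g : P f g = cder (fun u => ad u g) f.
Proof. exact/biderE/ad_gen_lin. Qed.

Lemma kk_derivation_l g : derivation (P^~ g).
Proof.
have dP := cderP (fun c u v => ad_lin c u v g).
split=> [c f h|f h|k f fk]; rewrite !kk_poissonE.
- exact: derivation_lin dP _ _ _.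
- exact: derivation_mul dP _ _.
- exact: derivation_filt dP _ _ fk.
Qed.

Lemma kk_genl u g : P (cgen u) g = cder (fun v => cgen (mu u v)) g.
Proof. by rewrite kk_poissonE cder_gen. Qed.

Lemma kk_gen u v : P (cgen u) (cgen v) = cgen (mu u v).
Proof. by rewrite kk_genl -/(ad u _) ad_gen. Qed.

Lemma kk_poisson_filtl k l f g :
  filt k f -> filt l g -> filt (k.-1 + l) (P f g).
Proof.
by move=> fk gl; rewrite kk_poissonE; apply: cder_filt => // *; apply: ad_filt.
Qed.

Lemma kk_poisson_filt1 f g : filt 1 (P f g).
Proof.
rewrite kk_poissonE; apply: (@cder_filt _ _ _ _ 1 0 f) => // u.
by apply: (@cder_filt _ _ _ _ 1 0 g) => // v; apply: filt_gen.
Qed.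

(** By construction the bracket is a derivation in [f] only. In [g] the property is clear for a
    generator [f], where the bracket is the extended adjoint action, and it spreads to all [f] by
    density. *)
Lemma kk_derivation_r f : derivation (P f).
Proof.
have PlB g := derivationB (kk_derivation_l g).
split=> [c g h|g h|k g gk]; last 1 first.
- apply: (@filtW _ _ _ _ (0.-1 + k)); first by rewrite leq_pred.
  exact: kk_poisson_filtl.
- elim/cpalg_dense_ind: f c g h.
  + by move=> a c g h; rewrite !(derivation_cst (kk_derivation_l _)) scaler0 addr0.
  + by move=> a c g h; rewrite !kk_genl; apply: derivation_lin (adP a) _ _ _.
  + move=> f f' fQ fQ' c g h; rewrite !(derivationD (kk_derivation_l _)) fQ fQ'.
    by rewrite scalerDr addrACA.
  + move=> f f' fQ fQ' c g h; rewrite !(derivation_mul (kk_derivation_l _)) fQ fQ'.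
    by rewrite mulrDl mulrDr addrACA scalerDr scalerAl scalerAr.
  move=> f fQ c g h; apply: filt_eq => k; have [f' f'Q ff'] := fQ k.+1.
  have -> : P f (c *: g + h) - (c *: P f g + P f h)
      = P (f - f') (c *: g + h) - (c *: P (f - f') g + P (f - f') h).
    rewrite !PlB f'Q scalerBr [in RHS]addrACA -opprD opprB.
    by rewrite addrA subrK.
  have flt x : filt k (P (f - f') x) by apply: (derivation_filt (kk_derivation_l x) ff').
  by apply: filtB => //; apply: filtD => //; apply: filtZ.
- elim/cpalg_dense_ind: f g h.
  + by move=> a g h; rewrite !(derivation_cst (kk_derivation_l _)) mul0r mulr0 addr0.
  + by move=> a g h; rewrite !kk_genl; apply: derivation_mul (adP a) _ _.
  + move=> f f' fQ fQ' g h; rewrite !(derivationD (kk_derivation_l _)) fQ fQ'.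
    by rewrite mulrDl mulrDr addrACA.
  + move=> f f' fQ fQ' g h; rewrite !(derivation_mul (kk_derivation_l _)) fQ fQ'.
    rewrite !mulrDl !mulrDr !mulrA addrACA; congr (_ + _ + (_ + _)).
    * by rewrite -!mulrA (symhatC h).
    * by rewrite (symhatC f g).
  move=> f fQ g h; apply: filt_eq => k; have [f' f'Q ff'] := fQ k.+1.
  have -> : P f (g * h) - (P f g * h + g * P f h)
      = P (f - f') (g * h) - (P (f - f') g * h + g * P (f - f') h).
    rewrite !PlB f'Q mulrBl mulrBr [in RHS]addrACA -opprD opprB.
    by rewrite addrA subrK.
  have flt x : filt k (P (f - f') x) by apply: (derivation_filt (kk_derivation_l x) ff').
  by apply: filtB => //; apply: filtD; [apply: filtMl | apply: filtMr].
Qed.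

Lemma derivationN F : derivation F -> derivation (fun f : S => - F f).
Proof.
move=> FP; have z : derivation (fun _ : S => 0).
  by split=> [c f g|f g|k f _] //; rewrite ?scaler0 ?mul0r ?mulr0 addr0.
have := derivation_scaleD (-1) FP z; congr derivation.
by apply: funext => f; rewrite scaleN1r addr0.
Qed.

Lemma kk_anti f g : P f g = - P g f.
Proof.
apply: (derivation_ext (kk_derivation_r f) (derivationN (kk_derivation_l f))) => v.
apply: (derivation_ext (kk_derivation_l _) (derivationN (kk_derivation_r _))) => u.
by rewrite !kk_gen lie_bracketC cgenN.
Qed.

Let hamiltonian f g := forall h, P (P f g) h = P f (P g h) - P g (P f h).

(** For fixed [f] the property passes to sums, products and limits in [g] by the Leibniz rule.
    Together with [hamiltonian_sym] this extends it in one variable after the other. *)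
Let hamiltonian_ext f :
  (forall u, hamiltonian f (cgen u)) -> forall g, hamiltonian f g.
Proof.
move=> fu; apply: cpalg_dense_ind => //.
- move=> c h; rewrite (derivation_cst (kk_derivation_r f)).
  rewrite !(derivation_cst (kk_derivation_l _)) (derivation0 (kk_derivation_l _)).
  by rewrite (derivation0 (kk_derivation_r _)) subrr.
- move=> g g' gQ gQ' h; rewrite (derivationD (kk_derivation_r f)).
  rewrite !(derivationD (kk_derivation_l _)) (derivationD (kk_derivation_r _)).
  by rewrite gQ gQ' addrACA opprD.
- move=> g g' gQ gQ' h; rewrite (derivation_mul (kk_derivation_r f)).
  rewrite (derivationD (kk_derivation_l _)) !(derivation_mul (kk_derivation_l _)).
  rewrite (derivationD (kk_derivation_r f)) !(derivation_mul (kk_derivation_r f)).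
  rewrite gQ gQ' !mulrBl !mulrBr opprD.
  by rewrite [LHS](AC ((2*1)*(1*2)) (((1*4)*(3*5))*(2*6))).
(* Two nested brackets lose one degree each, hence an approximation to order k + 2. *)
move=> g gQ h; apply: filt_eq => k; have [g' g'Q gg'] := gQ k.+2.
have PlB x := derivationB (kk_derivation_l x).
have PrB x := derivationB (kk_derivation_r x).
have -> : P (P f g) h - (P f (P g h) - P g (P f h))
    = P (P f (g - g')) h - (P f (P (g - g') h) - P (g - g') (P f h)).
  rewrite PrB !PlB PrB g'Q !opprB.
  by rewrite [RHS](AC ((1*2)*(2*2)) ((1*(4*7))*((2*5)*(6*3)))) /= !subrr !addr0.
have fl x m (z : S) : filt m.+1 z -> filt m (P z x).
  exact: (derivation_filt (kk_derivation_l x)).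
have fr x m (z : S) : filt m.+1 z -> filt m (P x z).
  exact: (derivation_filt (kk_derivation_r x)).
apply: filtB; first exact/fl/fr.
apply: filtB; first exact/fr/fl.
by apply: fl; apply: filtW gg'.
Qed.

Let hamiltonian_sym f g : hamiltonian f g -> hamiltonian g f.
Proof.
move=> fg h; rewrite [P g f]kk_anti (derivationNE (kk_derivation_l h)) fg.
by rewrite opprB.
Qed.

Lemma kk_hamiltonian f g h : P (P f g) h = P f (P g h) - P g (P f h).
Proof.
suff gen u v : hamiltonian (cgen u) (cgen v).
  apply: hamiltonian_ext => u; apply: hamiltonian_sym.
  by apply: hamiltonian_ext => v; apply: hamiltonian_sym.
(* A commutator of derivations is a derivation, so for linear [f] and [g] it suffices to test on
   generators, where the claim is the Jacobi identity of [mu]. *)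
have adC : derivation (fun x => ad u (ad v x) - ad v (ad u x)).
  have FP := adP u; have GP := adP v; set F := ad u in FP *; set G := ad v in GP *.
  split=> [c x y|x y|k x xk].
  - rewrite (derivation_lin FP) (derivation_lin GP) (derivation_lin FP).
    rewrite (derivation_lin GP) scalerBr opprD -!addrA; congr (_ + _).
    by rewrite addrCA.
  - rewrite (derivation_mul FP) (derivation_mul GP) (derivationD FP) (derivationD GP).
    rewrite !(derivation_mul FP) !(derivation_mul GP) mulrBl mulrBr !opprD.
    set a := F (G x) * y; set b := G x * _; set c := F x * _; set d := x * F _.
    set e := G (F x) * y; set l := x * G _.
    rewrite [LHS](AC ((2*2)*(2*2)) (((1*5)*(4*8))*((2*7)*(3*6)))) /=.
    by rewrite (subrr b) (addrC c) addNr !addr0.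
  - by apply: filtB; apply: filtW (leq_pred k) _; do 2 apply: ad_filt.
move=> h'; rewrite kk_gen !kk_genl.
apply: (derivation_ext (adP _) adC) => w; rewrite !ad_gen -cgenN -cgenD; congr cgen.
have /eqP := lie_jacobi muP u v w; rewrite addrC addr_eq0 => /eqP muE.
rewrite lie_bracketC muE opprK; congr (_ + _).
rewrite (lie_bracketC w) -scaleN1r -[X in mu v X]addr0 (lie_linr muP).
by rewrite lie_bracket0r addr0 scaleN1r.
Qed.

Lemma kk_jacobi f g h : P f (P g h) + P g (P h f) + P h (P f g) = 0.
Proof.
rewrite [P h (P f g)]kk_anti kk_hamiltonian [P h f]kk_anti.
by rewrite (derivationNE (kk_derivation_r g)) subrr.
Qed.

Lemma kk_plike : poisson_like P.
Proof.
split; [|exact: kk_anti|exact: kk_jacobi|].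
  by move=> c f g h; apply: derivation_lin (kk_derivation_l h) _ _ _.
by move=> i j f g fi gj; rewrite -addnS; apply: (@kk_poisson_filtl i.+1).
Qed.

Lemma kk_poisson_structure : poisson_structure P.
Proof.
split; [|exact: kk_anti|exact: kk_jacobi| |].
- by move=> c f g h; apply: derivation_lin (kk_derivation_l h) _ _ _.
- by move=> f g h; apply: derivation_mul (kk_derivation_r f) _ _.
by move=> k; exists k.+1 => f g; apply: (derivation_filt (kk_derivation_l g)).
Qed.

Lemma kk_mull f g h : P (f * g) h = P f h * g + f * P g h.
Proof. exact: derivation_mul (kk_derivation_l h) _ _. Qed.
Lemma kk_mulr f g h : P f (g * h) = P f g * h + g * P f h.
Proof. exact: derivation_mul (kk_derivation_r f) _ _. Qed.
End LinearPoisson.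

(** * Functoriality of the symmetric algebra *)

Section LinearMaps.
Variables (K : fieldType) (V W : lmodType K) (h : V -> W).
Hypothesis h_lin : forall c u v, h (c *: u + v) = c *: h u + h v.

Definition sym_map : symhat V -> symhat W := cmor (fun v => cgen (h v)).

Let cgen_h_lin c u v : cgen (h (c *: u + v)) = c *: cgen (h u) + cgen (h v) :> symhat W.
Proof. by rewrite h_lin cgen_lin. Qed.

Lemma sym_mapP : cmorphism sym_map.
Proof.
apply: cmorP => [|v]; last exact: filt_gen.
by apply: sym_respects => *; [apply: symhatC | apply: cgen_h_lin].
Qed.

Lemma sym_map_gen v : sym_map (cgen v) = cgen (h v).
Proof.
rewrite /sym_map cmor_gen //.
by apply: sym_respects => *; [apply: symhatC | apply: cgen_h_lin].
Qed.

Variables (mu : V -> V -> V) (nu : W -> W -> W).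
Hypotheses (muP : lie_bracket mu) (nuP : lie_bracket nu).
Hypothesis h_mu : forall u v, h (mu u v) = nu (h u) (h v).

Let sym_map_poisson_l g :
  (forall u, sym_map (kk_poisson mu (cgen u) g)
    = kk_poisson nu (sym_map (cgen u)) (sym_map g)) ->
  forall f, sym_map (kk_poisson mu f g) = kk_poisson nu (sym_map f) (sym_map g).
Proof.
have mP := sym_mapP.
move=> gQ; apply: cpalg_dense_ind => //.
- move=> c; rewrite (cmorphismZ mP) (cmorphism_one mP).
  rewrite (derivation_cst (kk_derivation_l muP g)) (cmorphism0 mP).
  by rewrite (derivation_cst (kk_derivation_l nuP _)).
- move=> f f' fQ fQ'; rewrite (derivationD (kk_derivation_l muP g)) !(cmorphismD mP).
  by rewrite (derivationD (kk_derivation_l nuP _)) fQ fQ'.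
- move=> f f' fQ fQ'; rewrite (kk_mull muP) (cmorphismD mP) !(cmorphism_mul mP).
  by rewrite (kk_mull nuP) fQ fQ'.
move=> f fQ; apply: filt_eq => k; have [f' f'Q ff'] := fQ k.+1.
have -> : sym_map (kk_poisson mu f g) - kk_poisson nu (sym_map f) (sym_map g)
    = sym_map (kk_poisson mu (f - f') g) - kk_poisson nu (sym_map (f - f')) (sym_map g).
  rewrite (derivationB (kk_derivation_l muP g)) !(cmorphismB mP).
  by rewrite (derivationB (kk_derivation_l nuP _)) f'Q opprB addrA subrK.
apply: filtB.
  exact/(cmorphism_filt mP)/(derivation_filt (kk_derivation_l muP g) ff').
apply: (derivation_filt (kk_derivation_l nuP _) (k := k.+1)).
exact: (cmorphism_filt mP).
Qed.

(** Extend from generators in the first variable, exchange the variables by antisymmetry, and extend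
    once more. *)
Lemma sym_map_poisson f g :
  sym_map (kk_poisson mu f g) = kk_poisson nu (sym_map f) (sym_map g).
Proof.
apply: sym_map_poisson_l => u; rewrite (kk_anti muP) (kk_anti nuP).
rewrite -scaleN1r (cmorphismZ sym_mapP) scaleN1r; congr (- _).
apply: sym_map_poisson_l => v.
by rewrite (kk_gen muP) !sym_map_gen (kk_gen nuP) h_mu.
Qed.

End LinearMaps.

Lemma sym_map_comp (K : fieldType) (U V W : lmodType K) (h : U -> V) (k : V -> W) :
  (forall c u v, h (c *: u + v) = c *: h u + h v) ->
  (forall c u v, k (c *: u + v) = c *: k u + k v) ->
  forall f, sym_map k (sym_map h f) = sym_map (k \o h) f.
Proof.
move=> hL kL; have khL c u v : (k \o h) (c *: u + v) = c *: (k \o h) u + (k \o h) v.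
  by rewrite /= hL kL.
apply: (cmorphism_ext (cmorphism_comp (sym_mapP hL) (sym_mapP kL)) (sym_mapP khL)) => u.
by rewrite /= !sym_map_gen.
Qed.

Lemma sym_map_id (K : fieldType) (V : lmodType K) (h : V -> V) :
  h =1 id -> forall f, sym_map h f = f.
Proof.
by move=> hE f; rewrite -[RHS]cmor_cgen /sym_map; congr cmor; apply: funext => v; rewrite hE.
Qed.

Lemma sl_eq m i j : (i.-1 <= m)%N -> (j.-1 <= m)%N ->
  (sl m i == sl m j) = (i.-1 == j.-1).
Proof. by move=> im jm; rewrite -val_eqE /= !inordK. Qed.

(** * Tensor powers *)

Section Slots.
Variables (K : fieldType) (V : lmodType K).
Implicit Types (x y : V).

Lemma embE n (i j : 'I_n) x : emb i x j = if j == i then x else 0.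
Proof. by rewrite ffunE. Qed.

Lemma emb_lin n (i : 'I_n) c x y : emb i (c *: x + y) = c *: emb i x + emb i y.
Proof.
apply/ffunP => j; rewrite !ffunE; case: eqP => // _.
by rewrite scaler0 addr0.
Qed.
Lemma emb0 n (i : 'I_n) : emb i (0 : V) = 0.
Proof. by apply/ffunP => j; rewrite !ffunE if_same. Qed.

Definition embs n (I : seq 'I_n) x : {ffun 'I_n -> V} := \sum_(a <- I) emb a x.

Lemma embs_lin n (I : seq 'I_n) c x y : embs I (c *: x + y) = c *: embs I x + embs I y.
Proof.
rewrite /embs scaler_sumr -big_split; apply: eq_bigr => a _; exact: emb_lin.
Qed.

Lemma embs0 n (I : seq 'I_n) : embs I (0 : V) = 0.
Proof. by rewrite /embs big1 // => a _; rewrite emb0. Qed.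

Lemma embsE n (I : seq 'I_n) x a : uniq I -> embs I x a = if a \in I then x else 0.
Proof.
elim: I => [|b I IHI]; first by rewrite /embs big_nil ffunE.
rewrite /embs big_cons => /andP[bI uI]; rewrite ffunE -/(embs I x) IHI // embE inE.
by case: eqP => [->|_] /=; rewrite ?(negbTE bI) ?addr0 ?add0r.
Qed.

(** The linear map behind x^{I_1,...,I_n}: the i-th summand is copied into all slots of [I i], as an
    iterated coproduct does with primitive elements. *)
Definition insert n m (I : 'I_n -> seq 'I_m) (u : {ffun 'I_n -> V}) :
  {ffun 'I_m -> V} := \sum_i embs (I i) (u i).

Lemma insert_lin n m (I : 'I_n -> seq 'I_m) c u v :
  insert I (c *: u + v) = c *: insert I u + insert I v.
Proof.
rewrite /insert scaler_sumr -big_split; apply: eq_bigr => i _.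
by rewrite !ffunE embs_lin.
Qed.

Lemma insert_emb n m (I : 'I_n -> seq 'I_m) i x : insert I (emb i x) = embs (I i) x.
Proof.
rewrite /insert (bigD1 i) //= embE eqxx big1 ?addr0 // => j ji.
by rewrite embE (negbTE ji) embs0.
Qed.

Lemma insert_embs n m (I : 'I_n -> seq 'I_m) (J : seq 'I_n) x :
  insert I (embs J x) = embs (flatten [seq I j | j <- J]) x.
Proof.
have insD u v : insert I (u + v) = insert I u + insert I v.
  by rewrite -[u]scale1r insert_lin !scale1r.
elim: J => [|j J IHJ] /=.
  rewrite /embs !big_nil; apply: (@addrI _ (insert I 0)).
  by rewrite -insD !addr0.
by rewrite {1}/embs big_cons insD insert_emb -/(embs J x) IHJ /embs big_cat.
Qed.

(** Each slot then receives at most one summand, at most once, which makes [insert I] a Lie algebra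
    map ([insert_bracket]). *)
Definition separated n m (I : 'I_n -> seq 'I_m) :=
  (forall i, uniq (I i)) /\ forall i j a, a \in I i -> a \in I j -> i = j.

Lemma insertE n m (I : 'I_n -> seq 'I_m) u i a :
  separated I -> a \in I i -> insert I u a = u i.
Proof.
move=> [uI sI] aI; rewrite /insert sum_ffunE (bigD1 i) //= embsE // aI.
rewrite big1 ?addr0 // => j ji; rewrite embsE //; case: ifP => // aj.
by rewrite (sI _ _ _ aj aI) eqxx in ji.
Qed.

Lemma insertE0 n m (I : 'I_n -> seq 'I_m) u a :
  separated I -> (forall i, a \notin I i) -> insert I u a = 0.
Proof.
move=> [uI sI] aI; rewrite /insert sum_ffunE big1 // => i _.
by rewrite embsE // (negbTE (aI i)).
Qed.

Lemma slotE n (i : 'I_n) f : slot i f = sym_map (@emb K V n i) f.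
Proof. by []. Qed.

Lemma slot_gen n (i : 'I_n) x : slot i (cgen x) = cgen (emb i x).
Proof. by rewrite slotE sym_map_gen //; apply: emb_lin. Qed.

Lemma cgen_embs n (I : seq 'I_n) x :
  cgen (embs I x) = \sum_(a <- I) cgen (emb a x) :> tpow V n.
Proof. exact: cgen_sum. Qed.

Lemma tmapE n m (F : n.-tuple (symhat V -> tpow V m)) (I : 'I_n -> seq 'I_m) :
  (forall i x, tnth F i (cgen x) = cgen (embs (I i) x)) ->
  forall f, tmap F f = sym_map (insert I) f.
Proof.
move=> FI f; congr (cmor _ _); apply: funext => u; rewrite cgen_sum.
by apply: eq_bigr => i _; rewrite FI.
Qed.

Lemma place_inE n m (s : 'I_n -> 'I_m) f :
  @place_in K V n m s f = sym_map (insert (fun i => [:: s i])) f.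
Proof.
congr (cmor _ _); apply: funext => u; rewrite cgen_sum.
by apply: eq_bigr => i _; rewrite /embs big_seq1.
Qed.

Lemma Delta0E f : Delta0 f = sym_map (@embs 2 [:: sl 1 1; sl 1 2]) f.
Proof.
congr (cmor _ _); apply: funext => x.
by rewrite /embs big_cons big_seq1 cgenD.
Qed.

Lemma place2_Delta0_gen m i j x :
  place2 m i j (Delta0 (cgen x)) = cgen (embs [:: sl m i; sl m j] x).
Proof.
rewrite Delta0E sym_map_gen; last exact: embs_lin.
rewrite /place2 place_inE sym_map_gen; last exact: insert_lin.
by rewrite insert_embs /= eqxx sl_eq.
Qed.

End Slots.

Section TensorPoisson.
Variables (K : fieldType) (V : lmodType K) (mu : V -> V -> V).
Hypothesis muP : lie_bracket mu.

Definition ffun_bracket n (u v : {ffun 'I_n -> V}) : {ffun 'I_n -> V} :=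
  [ffun i => mu (u i) (v i)].

Lemma ffun_bracketP n : lie_bracket (@ffun_bracket n).
Proof.
split=> [c x y z|c x y z|x|x y z]; apply/ffunP => i; rewrite !ffunE.
- exact: lie_linl.
- exact: lie_linr.
- exact: lie_alt.
- exact: lie_jacobi.
Qed.

Lemma ffun_bracket_emb n (i : 'I_n) x u :
  ffun_bracket (emb i x) u = emb i (mu x (u i)).
Proof.
apply/ffunP => j; rewrite !ffunE; case: eqP => [->//|_].
exact: lie_bracket0l.
Qed.

Lemma insert_bracket n m (I : 'I_n -> seq 'I_m) u v : separated I ->
  insert I (ffun_bracket u v) = ffun_bracket (insert I u) (insert I v).
Proof.
move=> sI; apply/ffunP => a; rewrite [RHS]ffunE.
have [/existsP[i ai]|/existsPn aI] := boolP [exists i, a \in I i].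
  by rewrite !(insertE _ sI ai) ffunE.
by rewrite !(insertE0 _ sI aI) lie_bracket0l.
Qed.

Lemma embs_bracket n (I : seq 'I_n) x y : uniq I ->
  embs I (mu x y) = ffun_bracket (embs I x) (embs I y).
Proof.
move=> uI; apply/ffunP => a; rewrite [RHS]ffunE !embsE //.
by case: ifP => // _; rewrite lie_bracket0l.
Qed.

(** As distinct factors commute, the bracket of generators is that of the product Lie algebra g^n,
    and the results on [kk_poisson] apply to tensor powers. *)
Lemma tpoissonE n : @tpoisson K V (kk_poisson mu) n = kk_poisson (@ffun_bracket n).
Proof.
congr bider; apply: funext => u; apply: funext => v.
have -> : ffun_bracket u v = \sum_i emb i (mu (u i) (v i)).
  apply/ffunP => i; rewrite sum_ffunE ffunE (bigD1 i) //= embE eqxx.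
  by rewrite big1 ?addr0 // => j ji; rewrite embE eq_sym (negbTE ji).
rewrite cgen_sum; apply: eq_bigr => i _.
by rewrite (kk_gen muP) slot_gen.
Qed.

End TensorPoisson.

(** * Evaluation of Lie series under a Poisson bracket *)

Section LieEvaluation.
Variables (K : fieldType) (X Y : Type) (S : presentation K Y).
Variable br : cpalg S -> cpalg S -> cpalg S.
Hypothesis brP : poisson_like br.
Hypothesis charK : [pchar K] =i pred0.
Variable th : X -> cpalg S.
Hypothesis th2 : forall x, filt 2 (th x).
Variable f : cpalg (free_pres K X).
Hypothesis fL : lie_series f.

Let thR e e' : prel (free_pres K X) e e' ->
  nact (dynkin_act br th) e =1 nact (dynkin_act br th) e'.
Proof. by []. Qed.

Local Notation val k := (@lie_value K X Y S br (free_pres K X) th k (f k)).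

Lemma lie_value_expr k :
  lpeval br th (xget [::] (lie_expr k (f k))) = val k.
Proof.
have [sk {2}->] := lie_series_exprP k fL.
by rewrite lie_value_lpeval.
Qed.

(** This trades the expressions chosen in [lie_eval] for canonical values, for which degree
    estimates and linearity are available. *)
Lemma lie_evalE : lie_eval br th f = csum (fun k => val k).
Proof. by apply: csum_eq => k; apply: lie_value_expr. Qed.

Lemma lie_eval_summable : summable (fun k => val k).
Proof. exact: lie_map_summable. Qed.

Lemma lie_eval_derivation (F : cpalg S -> cpalg S) :
  (forall c g h, F (c *: g + h) = c *: F g + F h) ->
  (forall k, exists l, forall g, filt l g -> filt k (F g)) ->
  (forall g h, F (br g h) = br (F g) h + br g (F h)) ->
  (forall x, F (th x) = 0) -> F (lie_eval br th f) = 0.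
Proof.
move=> Flin Fcont Fbr Fth.
have FD g h : F (g + h) = F g + F h by rewrite -[g]scale1r Flin !scale1r.
have F0 : F 0 = 0 by apply: (@addrI _ (F 0)); rewrite -FD !addr0.
have FZ c g : F (c *: g) = c *: F g by rewrite -[c *: g]addr0 Flin F0 addr0.
have FB g h : F (g - h) = F g - F h by rewrite -scaleN1r FD FZ scaleN1r.
rewrite lie_evalE; have [_ ->] := csum_cont FB Fcont lie_eval_summable.
rewrite -[RHS](csum0 S); apply: csum_eq => k /=; rewrite -lie_value_expr.
rewrite /lpeval (big_morph F FD F0) big1 // => p _; rewrite FZ.
suff -> : F (leval br th p.2) = 0 by rewrite scaler0.
elim: (p.2) => [x|m IHm n IHn] //=.
by rewrite Fbr IHm IHn (plike0l brP) (plike0r brP) addr0.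
Qed.

Lemma lie_eval_morphism (Z : Type) (S' : presentation K Z)
    (br' : cpalg S' -> cpalg S' -> cpalg S') (F : cpalg S -> cpalg S') :
  cmorphism F -> (forall g h, F (br g h) = br' (F g) (F h)) ->
  F (lie_eval br th f) = lie_eval br' (F \o th) f.
Proof.
move=> FP Fbr; rewrite lie_evalE (cmorphism_csum FP lie_eval_summable).
apply: csum_eq => k; rewrite [LHS]/= -lie_value_expr /lpeval (cmorphism_sum FP).
apply: eq_bigr => p _; rewrite (cmorphismZ FP); congr (_ *: _).
by elim: (p.2) => [x|m IHm n IHn] //=; rewrite Fbr IHm IHn.
Qed.

(** The Dynkin map sends a word to its right-nested bracket, and in length at least 2 the innermost
    bracket is one of two generators. *)
Lemma lie_value_ideal (J : cpalg S -> Prop) k :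
  J 0 -> (forall c g h, J g -> J h -> J (c *: g + h)) ->
  (forall x g, J g -> J (br (th x) g)) -> (forall x y, J (br (th x) (th y))) ->
  (1 < k)%N -> J (val k).
Proof.
move=> J0 Jlin Jbr Jth k1.
have [s ->] := chomog f k.
rewrite /lie_value (dynkin_sum brP thR) scaler_sumr.
have JD g h : J g -> J h -> J (g + h).
  by move=> Jg Jh; rewrite -[g]scale1r; apply: Jlin.
have JZ c g : J g -> J (c *: g) by move=> Jg; rewrite -[_ *: _]addr0; apply: Jlin.
apply: (big_ind J J0 JD) => p _; rewrite (dynkinZ brP thR); do 2 apply: (JZ).
have : (1 < size p.2)%N by rewrite size_tuple.
case: (tval p.2) => [|a [|b r]] // _ {p}.
elim: r a b => [|c r IHr] a b; rewrite dynkin_prod //; last exact: Jbr (IHr b c).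
by rewrite big_seq1 (dynkin_gen brP thR).
Qed.

End LieEvaluation.

(** * The canonical tensors *)

Section Casimir.
Variables (K : fieldType) (g : lmodType K) (mu : g -> g -> g) (t : seq (g * g)).
Hypothesis gP : metrized mu t.
Let muP := metr_lie gP.
Local Notation P n := (kk_poisson (@ffun_bracket K g mu n)).

Let brP n : lie_bracket (@ffun_bracket K g mu n).
Proof. exact: ffun_bracketP. Qed.

(** The tensor [t] placed in slots a and b; for n = 3 it is [tbar]. *)
Definition casimir n (a b : 'I_n) : tpow g n :=
  \sum_(p <- t) cgen (emb a p.1) * cgen (emb b p.2).

Lemma casimir_filt n (a b : 'I_n) : filt 2 (casimir a b).
Proof. by apply: filt_sum => p _; apply: (@filtM _ _ _ 1 1); apply: filt_gen. Qed.

Lemma sym_map_casimir n m (I : 'I_n -> seq 'I_m) a b :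
  sym_map (insert I) (casimir a b)
  = \sum_(c <- I a) \sum_(d <- I b) casimir c d.
Proof.
have mP := sym_mapP (@insert_lin K g n m I).
rewrite (cmorphism_sum mP).
under [RHS]eq_bigr do rewrite exchange_big /=.
rewrite [RHS]exchange_big; apply: eq_bigr => p _ /=.
rewrite (cmorphism_mul mP) !sym_map_gen; try exact: insert_lin.
rewrite !insert_emb !cgen_embs mulr_suml; apply: eq_bigr => c _.
by rewrite mulr_sumr.
Qed.

Lemma tensor2E : tensor2 t = casimir (sl 1 1) (sl 1 2).
Proof.
apply: eq_bigr => p _; rewrite /ptens !big_ord_recl big_ord0 mulr1.
have -> : sl 1 1 = ord0 by apply: val_inj; rewrite /= inordK.
by have -> : sl 1 2 = lift ord0 ord0 by apply: val_inj; rewrite /= inordK.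
Qed.

Definition slots2 n (a b : 'I_n) (i : 'I_2) : seq 'I_n :=
  if i == sl 1 1 then [:: a] else [:: b].

Let sl12 : (sl 1 2 == sl 1 1) = false. Proof. by rewrite sl_eq. Qed.

Lemma separated_slots2 n (a b : 'I_n) : a != b -> separated (slots2 a b).
Proof.
move=> ab; split=> [i|i j c]; first by rewrite /slots2; case: ifP.
have two (k : 'I_2) : k = sl 1 1 \/ k = sl 1 2.
  by case: k => [[|[|//]]] ?; [left|right]; apply: val_inj; rewrite /= inordK.
case: (two i) => ->; case: (two j) => ->; rewrite /slots2 ?eqxx ?sl12 ?inE //.
  by move=> /eqP -> /eqP ba; rewrite ba eqxx in ab.
by move=> /eqP -> /eqP ba; rewrite ba eqxx in ab.
Qed.

Lemma sym_map_casimir2 n (a b : 'I_n) :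
  sym_map (insert (slots2 a b)) (casimir (sl 1 1) (sl 1 2)) = casimir a b.
Proof. by rewrite sym_map_casimir /slots2 eqxx sl12 !big_seq1. Qed.

Lemma casimir_sym n (a b : 'I_n) : casimir a b = casimir b a.
Proof.
have := metr_sym gP; rewrite tensor2E /place2 place_inE sym_map_casimir.
rewrite !big_seq1 eqxx sl12 => /(congr1 (sym_map (insert (slots2 b a)))).
by rewrite sym_map_casimir2 sym_map_casimir /slots2 eqxx sl12 !big_seq1.
Qed.

Lemma ad_actE n x (f : tpow g n) : ad_act mu x f = P n (cgen [ffun=> x]) f.
Proof.
rewrite kk_genl //; congr (cder _ _); apply: funext => u; congr cgen.
by apply/ffunP => i; rewrite !ffunE.
Qed.

Lemma poisson_emb n (i j : 'I_n) x y : P n (cgen (emb i x)) (cgen (emb j y))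
  = if i == j then cgen (emb i (mu x y)) else 0.
Proof.
rewrite kk_gen // ffun_bracket_emb // embE; case: eqP => // _.
by rewrite (lie_bracket0r muP) emb0 cgen0.
Qed.

Lemma poisson_emb_casimir n (a b c : 'I_n) x : c != a -> c != b ->
  P n (cgen (emb c x)) (casimir a b) = 0.
Proof.
move=> ca cb; rewrite (derivation_sum (kk_derivation_r (brP n) _)) big1 // => p _.
by rewrite kk_mulr // !poisson_emb (negbTE ca) (negbTE cb) mul0r mulr0 addr0.
Qed.

(** In two slots this is invariance of [t]. The insertion into slots a and b carries it over, being
    a Poisson map because a and b differ. *)
Lemma poisson_embs_casimir n (a b : 'I_n) x : a != b ->
  P n (cgen (emb a x) + cgen (emb b x)) (casimir a b) = 0.
Proof.
move=> ab; have sI := separated_slots2 ab.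
have := metr_inv gP x; rewrite tensor2E ad_actE.
move/(congr1 (sym_map (insert (slots2 a b)))).
have mP := sym_mapP (@insert_lin K g 2 n (slots2 a b)).
rewrite (sym_map_poisson (@insert_lin _ _ _ _ _) (brP 2) (brP n)); last first.
  by move=> u v; apply: insert_bracket.
rewrite sym_map_casimir2 (cmorphism0 mP) sym_map_gen; last exact: insert_lin.
rewrite -cgenD; congr (P n (cgen _) _ = 0).
rewrite /insert !big_ord_recl big_ord0 addr0 /slots2 !ffunE.
have <- : sl 1 2 = lift ord0 ord0 by apply: val_inj; rewrite /= inordK.
have <- : sl 1 1 = ord0 by apply: val_inj; rewrite /= inordK.
by rewrite eqxx sl12 /embs !big_seq1.
Qed.

Lemma poisson_diag_casimir n (a b : 'I_n) x : a != b ->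
  P n (cgen [ffun=> x]) (casimir a b) = 0.
Proof.
move=> ab; have dP := kk_derivation_l (brP n) (casimir a b).
have -> : [ffun=> x] = \sum_(c < n) emb c x.
  apply/ffunP => c; rewrite sum_ffunE ffunE (bigD1 c) //= embE eqxx.
  by rewrite big1 ?addr0 // => d dc; rewrite embE eq_sym (negbTE dc).
rewrite cgen_sum (bigD1 a) // (bigD1 b) //=; last by rewrite eq_sym.
rewrite addrA (derivationD dP) poisson_embs_casimir // add0r.
rewrite (derivation_sum dP) big1 // => c /andP[ca cb].
exact: poisson_emb_casimir.
Qed.

(** Each term of t^{i,j} + t^{i,k} is a factor in slot i times the sum of one element placed in
    slots j and k. The former misses t^{j,k}, the latter Poisson-commutes with it by invariance. *)
Lemma casimir_4T n (i j k : 'I_n) : uniq [:: i; j; k] ->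
  P n (casimir i j + casimir i k) (casimir j k) = 0.
Proof.
rewrite /= !inE negb_or => /and3P[/andP[ij ik] jk _].
rewrite /casimir -big_split /= -/(casimir j k).
rewrite (derivation_sum (kk_derivation_l (brP n) _)) big1 // => p _.
rewrite -mulrDr kk_mull // poisson_emb_casimir // mul0r add0r.
by rewrite poisson_embs_casimir // mulr0.
Qed.

Lemma casimir_comm n (i j k l : 'I_n) : uniq [:: i; j; k; l] ->
  P n (casimir i j) (casimir k l) = 0.
Proof.
rewrite /= !inE !negb_or => /and4P[/and3P[ij ik il] /andP[jk jl] kl _].
rewrite (derivation_sum (kk_derivation_l (brP n) _)) big1 // => p _.
by rewrite kk_mull // !poisson_emb_casimir // mul0r mulr0 addr0.
Qed.

(* [br_diag] sets the generators [t^{i,i}] to 0. *)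
Definition braid_image n (p : 'I_n * 'I_n) : tpow g n :=
  if p.1 == p.2 then 0 else casimir p.1 p.2.

Lemma braid_image_filt n p : filt 2 (@braid_image n p).
Proof. by rewrite /braid_image; case: ifP => _; [apply: filt0 | apply: casimir_filt]. Qed.

(** The relations are needed for the operators of the Dynkin action. Such an operator is linear in
    its element, and the operators of x and y commute when [x, y] = 0 by the Jacobi identity. *)
Lemma braid_image_respects n e f : prel (braid_pres K n) e f ->
  nact (dynkin_act (P n) (@braid_image n)) e
  =1 nact (dynkin_act (P n) (@braid_image n)) f.
Proof.
have pP := kk_plike (brP n).
pose A (x : tpow g n) (v : tpow g n * K^o) : tpow g n * K^o :=
  (P n x v.1 + (v.2 : K) *: x, 0).
have AD x y v : A x v + A y v = A (x + y) v.
  rewrite /A -[LHS]/(_, _) /= addr0; congr (_, _).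
  by rewrite (plikeDl pP) scalerDr addrACA.
have AC x y v : P n x y = 0 -> A x (A y v) = A y (A x v).
  move=> xy; rewrite /A /= !scale0r !addr0; congr (_, _).
  rewrite !(plikeDr pP) !(plikeZr pP) xy (plike_anti pP y x) xy oppr0.
  rewrite scaler0 !addr0; apply/eqP; rewrite -subr_eq0 -(plike_derivation pP) xy.
  by rewrite (plike0l pP).
case=> [i|i j|i j k u3|i j k l u4] v /=; rewrite /dynkin_act -?/(A _ _).
- by rewrite /A /braid_image eqxx (plike0l pP) scaler0 addr0 scale0r.
- by congr (A _ v); rewrite /braid_image /= eq_sym casimir_sym.
- move: (u3); rewrite /= !inE negb_or => /and3P[/andP[ij ik] jk _].
  rewrite /braid_image /= (negbTE ij) (negbTE ik) (negbTE jk).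
  by rewrite !AD; apply: AC; apply: casimir_4T.
move: (u4); rewrite /= !inE !negb_or => /and4P[/and3P[ij ik il] /andP[jk jl] kl _].
rewrite /braid_image /= (negbTE ij) (negbTE kl).
by apply: AC; apply: casimir_comm.
Qed.

End Casimir.

(** * The pentagon *)

Section BraidAlgebra.
Variable K : fieldType.

Lemma braid_gen_sym n (i j : 'I_n) : cgen (i, j) = cgen (j, i) :> That K n.
Proof.
apply: cpalgP => k; rewrite !cgenE; case: ifP => // _.
by rewrite /pgen; apply/palgP/pc_rel/br_sym.
Qed.

Lemma braid_gen_4T n (i j k : 'I_n) : uniq [:: i; j; k] ->
  GRing.comm (cgen (j, k)) (cgen (i, j) + cgen (i, k) : That K n).
Proof.
move=> u3; apply/esym/cpalgP => -[|l].
  by rewrite mulrDl mulrDr !ccompD !cgenM.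
rewrite mulrDl mulrDr !ccompD !cgenM !cgenE; case: ifP => _; last by rewrite !mulr0.
rewrite -mulrDl -mulrDr -[LHS]/(pmul (padd (pgen _) (pgen _)) (pgen _)).
rewrite -[RHS]/(pmul (pgen _) (padd (pgen _) (pgen _))) /pgen !piE.
exact/palgP/pc_rel/br_4T.
Qed.

Lemma braid_gen_comm n (i j k l : 'I_n) : uniq [:: i; j; k; l] ->
  GRing.comm (cgen (i, j)) (cgen (k, l) : That K n).
Proof.
move=> u4; apply: cpalgP => -[|p]; rewrite !cgenM // !cgenE.
case: ifP => _; last by rewrite !mulr0.
rewrite -[LHS]/(pmul (pgen _) (pgen _)) -[RHS]/(pmul (pgen _) (pgen _)) /pgen !piE.
exact/palgP/pc_rel/br_comm.
Qed.

Definition braid_insert n m (J : 'I_n -> seq 'I_m) (p : 'I_n * 'I_n) : That K m :=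
  if p.1 == p.2 then 0 else \sum_(a <- J p.1) \sum_(b <- J p.2) cgen (a, b).

Lemma braid_insert_filt n m (J : 'I_n -> seq 'I_m) p : filt 1 (braid_insert J p).
Proof.
rewrite /braid_insert; case: ifP => _; first exact: filt0.
by apply: filt_sum => a _; apply: filt_sum => b _; apply: filt_gen.
Qed.

Lemma braid_insert_lie n m (J : 'I_n -> seq 'I_m) p :
  lie_series_of (braid_insert J p).
Proof.
move=> k; rewrite /braid_insert; case: ifP => _; first exact: is_lie0.
rewrite ccomp_sum; apply: is_lie_sum => a _; rewrite ccomp_sum.
by apply: is_lie_sum => b _; apply: is_lie_cgen.
Qed.

Lemma comm_sum_seq (B : pzRingType) (I : eqType) (r : seq I) (F : I -> B) x :
  (forall i, i \in r -> GRing.comm x (F i)) -> GRing.comm x (\sum_(i <- r) F i).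
Proof.
by move=> xF; rewrite big_seq; apply: commr_sum => i /xF.
Qed.

Lemma braid_insert_respects n m (J : 'I_n -> seq 'I_m) : separated J ->
  forall e f, prel (braid_pres K n) e f ->
  neval (braid_insert J) e = neval (braid_insert J) f.
Proof.
move=> [uJ sJ].
have dJ i j a b : i != j -> a \in J i -> b \in J j -> a != b.
  by move=> ij ai bj; apply: contraNneq ij => ab; apply/eqP/(sJ _ _ _ ai); rewrite ab.
move=> e f; case=> [i|i j|i j k u3|i j k l u4] /=.
- by rewrite /braid_insert eqxx scale0r.
- rewrite /braid_insert /= [j == i]eq_sym; case: ifP => // _.
  rewrite exchange_big; apply: eq_bigr => b _; apply: eq_bigr => a _.
  exact: braid_gen_sym.
- move: u3; rewrite /= !inE negb_or => /and3P[/andP[ij ik] jk _].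
  rewrite /braid_insert /= (negbTE ij) (negbTE ik) (negbTE jk) -big_split.
  apply: comm_sum_seq => b bj; apply/commr_sym/comm_sum_seq => a ai.
  apply/commr_sym/comm_sum_seq => c ck; apply/commr_sym.
  have ab := dJ _ _ _ _ ij ai bj; have ac := dJ _ _ _ _ ik ai ck.
  have bc := dJ _ _ _ _ jk bj ck.
  (* For fixed a, b, c the part t^{a,b} + t^{a,c} commutes with t^{b,c} by the four-term relation;
     every other t^{a,d} shares no index with t^{b,c}. *)
  rewrite (bigD1_seq b) ?uJ //= [in X in _ + X](bigD1_seq c) ?uJ //= addrACA.
  apply: commrD; first by apply: braid_gen_4T; rewrite /= !inE negb_or ab ac bc.
  apply: commrD; rewrite big_seq_cond; apply: commr_sum => d /andP[dj db];
    apply: braid_gen_comm; rewrite /= !inE !negb_or bc [b == a]eq_sym ab.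
    rewrite [b == d]eq_sym db [c == a]eq_sym ac (dJ _ _ _ _ ij ai dj).
    by rewrite eq_sym (dJ _ _ _ _ jk dj ck).
  rewrite [c == a]eq_sym ac (dJ _ _ _ _ ik ai dj) [c == d]eq_sym db.
  by rewrite (dJ _ _ _ _ jk bj dj).
move: u4; rewrite /= !inE !negb_or => /and4P[/and3P[ij ik il] /andP[jk jl] kl _].
rewrite /braid_insert /= (negbTE ij) (negbTE kl).
apply: comm_sum_seq => c ck; apply: comm_sum_seq => d dl.
apply/commr_sym/comm_sum_seq => a ai; apply: comm_sum_seq => b bj.
apply/commr_sym/braid_gen_comm; rewrite /= !inE !negb_or.
rewrite (dJ _ _ _ _ ij ai bj) (dJ _ _ _ _ ik ai ck) (dJ _ _ _ _ il ai dl).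
by rewrite (dJ _ _ _ _ jk bj ck) (dJ _ _ _ _ jl bj dl) (dJ _ _ _ _ kl ck dl).
Qed.

Lemma uniq_flatten_nth (T : eqType) (s : seq (seq T)) : uniq (flatten s) ->
  (forall i, uniq (nth [::] s i)) /\
  forall i j x, x \in nth [::] s i -> x \in nth [::] s j -> i = j.
Proof.
elim: s => [|r s IHs] /=; first by split=> [i|i j x]; rewrite !nth_nil.
rewrite cat_uniq => /and3P[ur /hasPn rs /IHs[us sI]].
have rsN i x : x \in r -> x \notin nth [::] s i.
  move=> xr; apply/negP => xs; have /rs/negP[] // : x \in flatten s.
  apply/flattenP; exists (nth [::] s i) => //; rewrite mem_nth // ltnNge.
  by apply: contraTN xs => si; rewrite nth_default.
split=> [[|i]|[|i] [|j] x] //=.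
- by move=> xr xs; have := rsN j _ xr; rewrite xs.
- by move=> xs xr; have := rsN i _ xr; rewrite xs.
by move=> /sI H /H ->.
Qed.

Lemma separated_slots n m (I : n.-tuple (seq nat)) :
  all (fun k => 0 < k <= m.+1)%N (flatten I) -> uniq (flatten I) ->
  separated (fun i => map (sl m) (tnth I i)).
Proof.
move=> /allP Im /uniq_flatten_nth[uI sI].
have tE i : tnth I i = nth [::] I i by apply: tnth_nth.
have Ik i k : k \in tnth I i -> (0 < k <= m.+1)%N.
  by move=> ki; apply: Im; apply/flattenP; exists (tnth I i) => //; apply: mem_tnth.
have slI k l : (0 < k <= m.+1)%N -> (0 < l <= m.+1)%N -> sl m k = sl m l -> k = l.
  by move=> k0 l0 /eqP; rewrite sl_eq; lia.
split=> [i|i j a /mapP[k ki ->] /mapP[l lj kl]].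
  have inj : {in tnth I i &, injective (sl m)}.
    by move=> k l ki li; apply: slI; [apply: Ik ki | apply: Ik li].
  by rewrite (map_inj_in_uniq inj) tE.
apply/val_inj/(sI _ _ k); rewrite -tE //.
by rewrite (slI _ _ (Ik _ _ ki) (Ik _ _ lj) kl).
Qed.

End BraidAlgebra.

Section Pentagon.
Variables (K : fieldType) (g : lmodType K) (mu : g -> g -> g) (t : seq (g * g)).
Hypothesis charK : [pchar K] =i pred0.
Hypothesis gP : metrized mu t.
Variable Phi : ncseries K.
Hypothesis PhiP : lie_associator Phi.

Let muP := metr_lie gP.
Let brP n : lie_bracket (@ffun_bracket K g mu n) := ffun_bracketP muP n.
Let pP n := kk_plike (brP n).
Local Notation P n := (kk_poisson (@ffun_bracket K g mu n)).
Let Psi := clog Phi.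
Let PsiL : lie_series Psi := assoc_lie PhiP.
Let Psi1 : filt 1 Psi. Proof. exact/clog_filt/(assoc_const PhiP). Qed.
Let PhiE : cexp Psi = Phi. Proof. exact/cexp_clog/(assoc_const PhiP). Qed.

Section Insertion.
Variables (m : nat) (I : 3.-tuple (seq nat)).
Let J i := map (sl m) (tnth I i).
Hypothesis sJ : separated J.

Definition log_insertion_arg (b : bool) : That K m.+1 :=
  subst2 (braid_insert K J (sl 2 1, sl 2 2)) (braid_insert K J (sl 2 2, sl 2 3)) b.

Definition log_insertion : That K m.+1 := cmor log_insertion_arg Psi.

Let arg1 b : filt 1 (log_insertion_arg b).
Proof. by case: b; apply: braid_insert_filt. Qed.
Let argL b : lie_series_of (log_insertion_arg b).
Proof. by case: b; apply: braid_insert_lie. Qed.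

Lemma log_insertion_filt : filt 1 log_insertion.
Proof. by apply: (cmorphism_filt (cmorP _ arg1)) Psi1. Qed.

Lemma insertion_assoc : insertion m I (assoc3 Phi) = cexp log_insertion.
Proof.
have aP : cmorphism (cmor log_insertion_arg : ncseries K -> _) by exact: cmorP.
have thE : (fun p : 'I_3 * 'I_3 => if p.1 == p.2 then 0 else
    \sum_(a <- tnth I p.1) \sum_(b <- tnth I p.2) tgen K m a b) = braid_insert K J.
  apply: funext => p; rewrite /braid_insert; case: ifP => // _.
  by rewrite big_map; apply: eq_bigr => a _; rewrite big_map.
rewrite /insertion thE /assoc3 -(cmorphism_cexp aP Psi1) PhiE.
have tP : cmorphism (cmor (subst2 (tgen K 2 1 2) (tgen K 2 2 3)) : ncseries K -> _).
  by apply: cmorP => // -[]; apply: filt_gen.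
have iP : cmorphism (cmor (braid_insert K J) : That K 3 -> _).
  by apply: cmorP; [exact: braid_insert_respects sJ | exact: braid_insert_filt].
apply: (cmorphism_ext (cmorphism_comp tP iP) aP) => b /=.
rewrite !cmor_gen //.
by case: b; rewrite cmor_gen //; apply: braid_insert_respects.
Qed.

Local Notation lm := (@lie_map K _ _ _ (P m.+1) (braid_pres K m.+1)
  (@braid_image K g t m.+1)).

(** Both sides evaluate the Lie series log Phi at the inserted tensors: the left by [lie_map_cmor],
    the right because the insertion is a Poisson map. *)
Lemma lie_map_log_insertion :
  lie_series_of log_insertion /\
  lm log_insertion = sym_map (insert J) (phi_tilde mu Phi t).
Proof.
have [L ->] := lie_map_cmor (pP m.+1) charK (@braid_image_filt K g t m.+1)
  (braid_image_respects gP (n := m.+1)) arg1 argL PsiL.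
split=> //; rewrite /phi_tilde tpoissonE //.
have t2 b : filt 2 (subst2 (tbar t 1 2) (tbar t 2 3) b).
  by case: b; apply: casimir_filt.
rewrite (lie_eval_morphism (pP 3) charK t2 PsiL (sym_mapP (@insert_lin K g _ _ J))
  (br' := P m.+1)); last first.
  apply: (sym_map_poisson (@insert_lin _ _ _ _ _) (brP 3) (brP m.+1)) => u v.
  exact: insert_bracket.
congr (lie_eval _ _ _); apply: funext => b /=.
have imE i j : i != j -> lm (braid_insert K J (i, j)) = sym_map (insert J) (casimir t i j).
  move=> ij; rewrite sym_map_casimir /braid_insert /= (negbTE ij).
  have gE := lie_map_gen (pP m.+1)
    (braid_image_respects gP (n := m.+1)).
  have sE := lie_map_sum (pP m.+1) (@braid_image_filt K g t m.+1)
    (braid_image_respects gP (n := m.+1)).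
  rewrite sE; apply: eq_big_seq => a ai; rewrite sE; apply: eq_big_seq => c cj.
  (* The value 0 on equal indices never occurs here, since a and c lie in disjoint blocks. *)
  rewrite gE /braid_image /=; case: eqP => // ac.
  by move: ij; rewrite (proj2 sJ i j a) ?eqxx // ac.
by case: b; rewrite /log_insertion_arg /= imE // sl_eq.
Qed.

End Insertion.

Lemma phi_tilde_pentagon :
  let st := star (P 4) in
  let ph (I : 3.-tuple (seq nat)) :=
    sym_map (insert (fun i => map (sl 3) (tnth I i))) (phi_tilde mu Phi t) in
  st (ph [tuple [:: 1]; [:: 2]; [:: 3; 4]]%N) (ph [tuple [:: 1; 2]; [:: 3]; [:: 4]]%N)
  = st (st (ph [tuple [:: 2]; [:: 3]; [:: 4]]%N) (ph [tuple [:: 1]; [:: 2; 3]; [:: 4]]%N))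
       (ph [tuple [:: 1]; [:: 2]; [:: 3]]%N).
Proof.
move=> st ph.
have phE (I : 3.-tuple (seq nat)) : all (fun k => 0 < k <= 4)%N (flatten I) -> uniq (flatten I) ->
    ph I = @lie_map K _ _ _ (P 4) (braid_pres K 4) (@braid_image K g t 4)
             (log_insertion 3 I) /\ lie_series_of (log_insertion 3 I).
  by move=> I1 I2; have [] := lie_map_log_insertion (separated_slots I1 I2).
have stE := lie_map_star (pP 4) charK (@braid_image_filt K g t 4)
  (braid_image_respects gP (n := 4)).
have F I : filt 1 (log_insertion 3 I) by exact: log_insertion_filt.
have insE (I : 3.-tuple (seq nat)) : all (fun k => 0 < k <= 4)%N (flatten I) -> uniq (flatten I) ->
    insertion 3 I (assoc3 Phi) = cexp (log_insertion 3 I).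
  by move=> I1 I2; apply/insertion_assoc/separated_slots.
have := assoc_pentagon PhiP; rewrite /pentagon !insE // => pent.
have [-> L1] := phE [tuple [:: 1]; [:: 2]; [:: 3; 4]]%N isT isT.
have [-> L2] := phE [tuple [:: 1; 2]; [:: 3]; [:: 4]]%N isT isT.
have [-> L3] := phE [tuple [:: 2]; [:: 3]; [:: 4]]%N isT isT.
have [-> L4] := phE [tuple [:: 1]; [:: 2; 3]; [:: 4]]%N isT isT.
have [-> L5] := phE [tuple [:: 1]; [:: 2]; [:: 3]]%N isT isT.
rewrite /st; have [_ _ ->] := stE _ _ (F _) (F _) L1 L2.
have [z1 zL ->] := stE _ _ (F _) (F _) L3 L4.
have [_ _ ->] := stE _ _ z1 (F _) zL L5.
(* Both sides are images of logarithms, and [cexp_clog] undoes the inner one, so the arguments are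
   the two sides of the pentagon for Phi. *)
by rewrite pent cexp_clog // cexp_gen_mul_comp0.
Qed.

End Pentagon.

(** * The reduction *)

Section MaximalTensors.
Variables (K : fieldType) (V : lmodType K) (n : nat).
Implicit Types (f h : tpow V n) (x : n.-tuple V).

(** The ideal before completion. [maxtens] asks for membership degree by degree, and is thus stable
    under [csum] ([maxtens_csum]). *)
Definition tensor_ideal f := exists s : seq (n.-tuple V * tpow V n),
  f = \sum_(p <- s) ptens p.1 * p.2.

Lemma tensor_ideal0 : tensor_ideal 0.
Proof. by exists [::]; rewrite big_nil. Qed.
Lemma tensor_idealD f h : tensor_ideal f -> tensor_ideal h -> tensor_ideal (f + h).
Proof. by move=> [s ->] [s' ->]; exists (s ++ s'); rewrite big_cat. Qed.
Lemma tensor_idealM f h : tensor_ideal f -> tensor_ideal (f * h).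
Proof.
move=> [s ->]; exists [seq (p.1, p.2 * h) | p <- s].
by rewrite big_map mulr_suml; apply: eq_bigr => p _; rewrite mulrA.
Qed.
Lemma tensor_idealMl f h : tensor_ideal f -> tensor_ideal (h * f).
Proof. by rewrite symhatC; apply: tensor_idealM. Qed.
Lemma tensor_idealZ c f : tensor_ideal f -> tensor_ideal (c *: f).
Proof. by move=> fJ; rewrite -[f]mulr1 scalerAr; apply: tensor_idealM. Qed.
Lemma tensor_ideal_sum (I : Type) (r : seq I) (P : pred I) (F : I -> tpow V n) :
  (forall i, P i -> tensor_ideal (F i)) -> tensor_ideal (\sum_(i <- r | P i) F i).
Proof. exact: (big_ind tensor_ideal tensor_ideal0 tensor_idealD). Qed.
Lemma tensor_ideal_ptens x : tensor_ideal (ptens x).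
Proof. by exists [:: (x, 1)]; rewrite big_seq1 mulr1. Qed.

Lemma ccomp_prodM (X : Type) (R : presentation K X) (s : seq X) (f : cpalg R) k :
  ((\prod_(a <- s) cgen a) * f) k
  = \prod_(a <- s) pgen a * (if (size s <= k)%N then f (k - size s)%N else 0).
Proof.
elim: s k => [|a s IHs] k; first by rewrite !big_nil !mul1r subn0.
rewrite !big_cons -!mulrA cgenM; case: k => [|k]; first by rewrite !mulr0.
by rewrite IHs.
Qed.

Lemma maxtensD f h : maxtens f -> maxtens h -> maxtens (f + h).
Proof.
by move=> fm hm k; have [s E] := fm k; have [s' E'] := hm k;
  exists (s ++ s'); rewrite ccompD E E' big_cat.
Qed.

Lemma maxtens0 : maxtens (0 : tpow V n).
Proof. by move=> k; exists [::]; rewrite big_nil. Qed.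

Lemma maxtensZ c f : maxtens f -> maxtens (c *: f).
Proof.
move=> fm k; have [s E] := fm k; exists [seq (p.1, c *: p.2) | p <- s].
rewrite ccompZ E big_map scaler_sumr; apply: eq_bigr => p _.
by rewrite scalerAr.
Qed.

Lemma maxtens_sum (I : Type) (r : seq I) (P : pred I) (F : I -> tpow V n) :
  (forall i, P i -> maxtens (F i)) -> maxtens (\sum_(i <- r | P i) F i).
Proof. exact: (big_ind _ maxtens0 maxtensD). Qed.

Lemma maxtens_ideal f : tensor_ideal f -> maxtens f.
Proof.
move=> [s ->]; apply: maxtens_sum => p _ k; move: p.1 p.2 => x h.
exists [:: (x, if (n <= k)%N then h (k - n)%N else 0)].
have -> : ptens x = \prod_(a <- [seq emb i (tnth x i) | i <- index_enum 'I_n]) cgen a.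
  by rewrite big_map.
have szE : size (index_enum 'I_n) = n.
  by rewrite [index_enum _]unlock -enumT size_enum_ord.
by rewrite ccomp_prodM size_map szE big_map big_seq1.
Qed.

Lemma maxtens_csum (u : nat -> tpow V n) :
  (forall k, maxtens (u k)) -> maxtens (csum u).
Proof.
move=> um k; have := @maxtens_sum _ (index_enum 'I_(csum_bound u k)) xpredT
  (fun p => u p) (fun p _ => um p) k.
by rewrite ccomp_sum.
Qed.

Let symhat_mul : Monoid.com_law (1 : tpow V n) := HB.pack (@GRing.mul (tpow V n))
  (Monoid.isComLaw.Build (tpow V n) 1 *%R (@mulrA _) (@symhatC _ _) (@mul1r _)).

Lemma tensor_ideal_place (s : 'S_n) f : tensor_ideal f -> tensor_ideal (place_in s f).
Proof.
have pP := sym_mapP (@insert_lin K V n n (fun i => [:: s i])).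
move=> [r ->]; rewrite place_inE (cmorphism_sum pP); apply: tensor_ideal_sum => p _.
rewrite (cmorphism_mul pP); apply: tensor_idealM.
suff -> : sym_map (insert (fun i => [:: s i])) (ptens p.1)
    = ptens [tuple tnth p.1 (s^-1%g i) | i < n] by apply: tensor_ideal_ptens.
rewrite (cmorphism_prod pP) /ptens [RHS](reindex_inj (op := symhat_mul) (@perm_inj _ s)).
apply: eq_bigr => i _; rewrite sym_map_gen; last exact: insert_lin.
by rewrite insert_emb /embs big_seq1 tnth_mktuple permK.
Qed.

End MaximalTensors.

Lemma ptens3E (K : fieldType) (V : lmodType K) (x : 3.-tuple V) :
  ptens x = cgen (emb (sl 2 1) (tnth x (sl 2 1))) *
    (cgen (emb (sl 2 2) (tnth x (sl 2 2))) * cgen (emb (sl 2 3) (tnth x (sl 2 3)))).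
Proof.
rewrite /ptens !big_ord_recl big_ord0 mulr1.
have -> : sl 2 1 = ord0 by apply: val_inj; rewrite /= inordK.
have -> : sl 2 2 = lift ord0 ord0 by apply: val_inj; rewrite /= inordK.
by have -> : sl 2 3 = lift ord0 (lift ord0 ord0) by apply: val_inj; rewrite /= inordK.
Qed.

Lemma tnth3_sl (V : Type) (x y z : V) :
  [/\ tnth [tuple x; y; z] (sl 2 1) = x, tnth [tuple x; y; z] (sl 2 2) = y
    & tnth [tuple x; y; z] (sl 2 3) = z].
Proof. by split; rewrite (tnth_nth x) /= inordK. Qed.

Lemma ord3_sl (i : 'I_3) : [\/ i = sl 2 1, i = sl 2 2 | i = sl 2 3].
Proof.
by case: i => [[|[|[|//]]]] ?; [apply: Or31|apply: Or32|apply: Or33];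
  apply: val_inj; rewrite /= inordK.
Qed.

Section PhiTilde.
Variables (K : fieldType) (g : lmodType K) (mu : g -> g -> g) (t : seq (g * g)).
Hypothesis charK : [pchar K] =i pred0.
Hypothesis gP : metrized mu t.

Let muP := metr_lie gP.
Let brP n : lie_bracket (@ffun_bracket K g mu n) := ffun_bracketP muP n.
Let pP n := kk_plike (brP n).
Local Notation P n := (kk_poisson (@ffun_bracket K g mu n)).
Local Notation phi := (phi_metr mu t).
Local Notation c i j := (casimir t (sl 2 i) (sl 2 j)).

(** Only the two factors in slot 2 have a nonzero bracket. *)
Lemma phi_metrE : P 3 (tbar t 1 2) (tbar t 2 3) = phi.
Proof.
rewrite (derivation_sum (kk_derivation_l (brP 3) _)); apply: eq_bigr => p _.
rewrite (derivation_sum (kk_derivation_r (brP 3) _)); apply: eq_bigr => q _.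
rewrite kk_mull // !kk_mulr // !(poisson_emb gP) !sl_eq //= !mul0r !mulr0 !addr0.
have [e1 e2 e3] := tnth3_sl p.1 (mu p.2 q.1) q.2.
by rewrite mul0r add0r ptens3E e1 e2 e3.
Qed.

(** A linear element acts on one tensor slot at a time, so every term is again a pure tensor. *)
Lemma poisson_ptens (u : {ffun 'I_3 -> g}) (x : 3.-tuple g) :
  tensor_ideal (P 3 (cgen u) (ptens x)).
Proof.
have uE i y : P 3 (cgen u) (cgen (emb i y)) = cgen (emb i (mu (u i) y)).
  rewrite kk_gen //; congr cgen; apply/ffunP => j; rewrite !ffunE.
  by case: eqP => [->//|_]; rewrite (lie_bracket0r muP).
have tJ y z w : tensor_ideal (cgen (emb (sl 2 1) y) *
    (cgen (emb (sl 2 2) z) * cgen (emb (sl 2 3) w)) : tpow g 3).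
  have [e1 e2 e3] := tnth3_sl y z w.
  by have := tensor_ideal_ptens [tuple y; z; w]; rewrite ptens3E e1 e2 e3.
rewrite ptens3E !kk_mulr // !uE mulrDr.
by apply: tensor_idealD => //; apply: tensor_idealD.
Qed.

Lemma poisson_tensor_ideal (i j : 'I_3) f :
  tensor_ideal f -> tensor_ideal (P 3 (casimir t i j) f).
Proof.
have genJ u h : tensor_ideal h -> tensor_ideal (P 3 (cgen u) h).
  move=> [s ->]; rewrite (derivation_sum (kk_derivation_r (brP 3) _)).
  apply: tensor_ideal_sum => p _; rewrite kk_mulr //; apply: tensor_idealD.
    exact/tensor_idealM/poisson_ptens.
  exact/tensor_idealM/tensor_ideal_ptens.
move=> fJ; rewrite (derivation_sum (kk_derivation_l (brP 3) _)).
apply: tensor_ideal_sum => p _; rewrite kk_mull //; apply: tensor_idealD.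
  exact/tensor_idealM/genJ.
exact/tensor_idealMl/genJ.
Qed.

Lemma phi_metr_ideal : tensor_ideal phi.
Proof.
by apply: tensor_ideal_sum => p _; apply: tensor_ideal_sum => q _;
  apply: tensor_ideal_ptens.
Qed.

Let cas i j k := P 3 (casimir t i j) (casimir t j k).

Let cas_rev i j k : cas k j i = - cas i j k.
Proof. by rewrite /cas (kk_anti (brP 3)) !(casimir_sym gP j) (casimir_sym gP k). Qed.

(** This is the relation [t^{k,i} + t^{k,j}, t^{i,j}] = 0 combined with the symmetry of [t]. *)
Let cas_swap i j k : uniq [:: i; j; k] -> cas j i k = - cas i j k.
Proof.
move=> u3; have kij : uniq [:: k; i; j] by rewrite -(rot_uniq 1).
have := casimir_4T gP kij; rewrite (plikeDl (pP 3)) => /eqP.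
rewrite addr_eq0 => /eqP E.
rewrite /cas (casimir_sym gP j i) (kk_anti (brP 3)) (casimir_sym gP i k) E opprK.
by rewrite (kk_anti (brP 3)) (casimir_sym gP k j).
Qed.

Let phi_cas : phi = cas (sl 2 1) (sl 2 2) (sl 2 3).
Proof. by rewrite -phi_metrE. Qed.

Let place_cas (s : 'S_3) i j k : place_in s (cas i j k) = cas (s i) (s j) (s k).
Proof.
rewrite place_inE (sym_map_poisson (@insert_lin _ _ _ _ _) (brP 3) (brP 3)).
  by rewrite !sym_map_casimir !big_seq1.
move=> u v; apply: (insert_bracket muP); split=> // a b d.
by rewrite !inE => /eqP -> /eqP /perm_inj.
Qed.

(** Transpositions generate the group: (1 2) is [cas_swap], (1 3) is [cas_rev], and (2 3) is a
    combination of both. *)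
Lemma phi_metr_alternating : alternating3 phi.
Proof.
have placeZ (s : 'S_3) b (f : tpow g 3) : place_in s (b *: f) = b *: place_in s f.
  by rewrite !place_inE (cmorphismZ (sym_mapP (@insert_lin _ _ _ _ _))).
have placeM (s s' : 'S_3) (f : tpow g 3) :
    place_in (s * s')%g f = place_in s' (place_in s f).
  rewrite !place_inE sym_map_comp; try exact: insert_lin.
  congr (sym_map _ f); apply: funext => u /=.
  have insD v w : insert (fun i => [:: s' i]) (v + w)
      = insert (fun i => [:: s' i]) v + insert (fun i => [:: s' i]) w :> {ffun 'I_3 -> g}.
    by rewrite -[v]scale1r insert_lin !scale1r.
  have ins0 : insert (fun i => [:: s' i]) 0 = 0 :> {ffun 'I_3 -> g}.
    by apply: (@addrI _ (insert (fun i => [:: s' i]) 0)); rewrite -insD !addr0.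
  rewrite {1 3}/insert (big_morph _ insD ins0); apply: eq_bigr => i _.
  by rewrite insert_embs /= permM.
have place1 (f : tpow g 3) : place_in (1%g : 'S_3) f = f.
  rewrite place_inE sym_map_id // => u; rewrite /insert.
  apply/ffunP => i; rewrite sum_ffunE (bigD1 i) //= embsE // perm1 inE eqxx.
  rewrite big1 ?addr0 // => j ji; rewrite embsE // inE perm1 eq_sym.
  by rewrite (negbTE ji).
move=> s; have [ts -> /= tsP] := prod_tpermP s.
elim: ts tsP => [|[i j] ts IHts] /=.
  by rewrite big_nil place1 odd_perm1 scale1r.
case/andP=> ij /IHts IH; rewrite big_cons placeM odd_mul_tperm ij signr_addb.
suff -> : place_in (tperm i j) phi = - phi.
  by rewrite -scaleN1r placeZ IH scalerA expr1.
rewrite phi_cas place_cas.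
have e12 : (sl 2 1 == sl 2 2) = false by rewrite sl_eq.
have e13 : (sl 2 1 == sl 2 3) = false by rewrite sl_eq.
have e23 : (sl 2 2 == sl 2 3) = false by rewrite sl_eq.
have e21 : (sl 2 2 == sl 2 1) = false by rewrite sl_eq.
have e31 : (sl 2 3 == sl 2 1) = false by rewrite sl_eq.
have e32 : (sl 2 3 == sl 2 2) = false by rewrite sl_eq.
have u123 : uniq [:: sl 2 1; sl 2 2; sl 2 3] by rewrite /= !inE e12 e13 e23.
have c12 : cas (tperm (sl 2 1) (sl 2 2) (sl 2 1)) (tperm (sl 2 1) (sl 2 2) (sl 2 2))
    (tperm (sl 2 1) (sl 2 2) (sl 2 3)) = - cas (sl 2 1) (sl 2 2) (sl 2 3).
  by rewrite tpermL tpermR tpermD ?e13 ?e23 // cas_swap.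
have c13 : cas (tperm (sl 2 1) (sl 2 3) (sl 2 1)) (tperm (sl 2 1) (sl 2 3) (sl 2 2))
    (tperm (sl 2 1) (sl 2 3) (sl 2 3)) = - cas (sl 2 1) (sl 2 2) (sl 2 3).
  by rewrite tpermL tpermR tpermD ?e12 ?e32 // cas_rev.
have c23 : cas (tperm (sl 2 2) (sl 2 3) (sl 2 1)) (tperm (sl 2 2) (sl 2 3) (sl 2 2))
    (tperm (sl 2 2) (sl 2 3) (sl 2 3)) = - cas (sl 2 1) (sl 2 2) (sl 2 3).
  rewrite tpermL tpermR tpermD ?e21 ?e31 //.
  have u231 : uniq [:: sl 2 2; sl 2 3; sl 2 1] by rewrite /= !inE e23 e21 e31.
  by rewrite (cas_rev (sl 2 2)) -(cas_swap u231) (cas_rev (sl 2 1)).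
by case: (ord3_sl i) ij => ->; case: (ord3_sl j) => ->; rewrite /dpair /= ?eqxx // => _;
  rewrite // tpermC.
Qed.

End PhiTilde.

(** * Properties of phi~ and assembly of the lift *)

Section Lift.
Variables (K : fieldType) (g : lmodType K) (mu : g -> g -> g) (t : seq (g * g)).
Hypothesis charK : [pchar K] =i pred0.
Hypothesis gP : metrized mu t.
Variable Phi : ncseries K.
Hypothesis PhiP : lie_associator Phi.

Let muP := metr_lie gP.
Let brP n : lie_bracket (@ffun_bracket K g mu n) := ffun_bracketP muP n.
Let pP n := kk_plike (brP n).
Local Notation P n := (kk_poisson (@ffun_bracket K g mu n)).
Local Notation phi := (phi_metr mu t).
Local Notation phit := (phi_tilde mu Phi t).
Let Psi := clog Phi.
Let PsiL : lie_series Psi := assoc_lie PhiP.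
Let th := subst2 (tbar t 1 2) (tbar t 2 3).

Let th2 b : filt 2 (th b). Proof. by case: b; apply: casimir_filt. Qed.

Let thR e e' : prel (free_pres K bool) e e' ->
  nact (dynkin_act (P 3) th) e =1 nact (dynkin_act (P 3) th) e'.
Proof. by []. Qed.

Local Notation val k := (@lie_value K _ _ _ (P 3) (free_pres K bool) th k (Psi k)).

Let phitE : phit = csum (fun k => val k).
Proof. by rewrite /phi_tilde tpoissonE // (lie_evalE (pP 3) charK th PsiL). Qed.

Let valF k : filt k.+1 (val k).
Proof. exact: (lie_value_filt (pP 3) th2 thR). Qed.

Let PsiE k : (k < 3)%N ->
  Psi k = commutator (cgen false : ncseries K) (cgen true) k.
Proof.
by move=> k3; apply/eqP; rewrite -subr_eq0 -ccompB (assoc_lead PhiP).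
Qed.

Let commE k : commutator (cgen false : ncseries K) (cgen true) k
  = if k == 2 then commutator (pgen false) (pgen true) else 0.
Proof.
rewrite ccompB !cgenM; case: k => [|k]; first by rewrite subrr.
by rewrite !cgenE eqSS; case: ifP => // _; rewrite !mulr0 subrr.
Qed.

Let val0 k : (k < 2)%N -> val k = 0.
Proof.
move=> k2; rewrite (PsiE (leqW k2)) commE (ltn_eqF k2).
by rewrite /lie_value (dynkin0 (pP 3) thR) scaler0.
Qed.

Let val2 : val 2 = phi.
Proof.
rewrite PsiE // commE eqxx (@lie_value_commutator _ _ _ _ _ (pP 3) charK _ _ thR 1 1);
  try exact: is_lie_gen.
by rewrite /lie_value !(dynkin_gen (pP 3) thR) !invr1 !scale1r phi_metrE.
Qed.

(** log Phi starts with [A, B], whose value is phi; its components of Lie degree k at least 3 take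
    values of order k + 1, hence at least 4. *)
Lemma phi_tilde_lead : filt 4 (phit - phi).
Proof.
have vS : summable (fun k => val k).
  by apply: filt_summable => k; apply: (filtW (leqnSn k) (@valF k)).
rewrite phitE csum_recl // csum_recl; last first.
  by apply: filt_summable => k; apply: (@filtW _ _ _ k k.+2); [lia | exact: valF].
rewrite csum_recl; last first.
  by apply: filt_summable => k; apply: (@filtW _ _ _ k k.+3); [lia | exact: (@valF k.+2)].
rewrite (@val0 0 isT) (@val0 1 isT) !add0r val2 addrC addKr.
by apply: csum_filt => k; apply: (@filtW _ _ _ 4 k.+4) => //; apply: valF.
Qed.

Let poisson_th b b' : tensor_ideal (P 3 (th b) (th b')).
Proof.
have self f : P 3 f f = 0.
  have : (2%:R : K) *: P 3 f f = 0.
    by rewrite scaler_nat mulr2n {2}(kk_anti (brP 3)) subrr.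
  move/(congr1 (GRing.scale (2%:R^-1))); rewrite scaler0 scalerA mulVf ?scale1r //.
  exact: natrS_neq0.
case: b b' => -[]; rewrite /th /= ?self; try exact: tensor_ideal0.
  rewrite (kk_anti (brP 3)) phi_metrE // -scaleN1r.
  exact/tensor_idealZ/phi_metr_ideal.
by rewrite phi_metrE //; apply: phi_metr_ideal.
Qed.

(** Lie degrees 0 and 1 contribute nothing. Beyond, a value is a combination of nested brackets
    whose core is 0, phi or -phi. *)
Let val_ideal k : tensor_ideal (val k).
Proof.
have [k2|k2] := ltnP k 2; first by rewrite val0 //; apply: tensor_ideal0.
apply: (lie_value_ideal (pP 3)) => //.
- exact: tensor_ideal0.
- by move=> c f h fJ hJ; apply: tensor_idealD => //; apply: tensor_idealZ.
- by move=> b f; case: b; apply: poisson_tensor_ideal.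
Qed.

Lemma phi_tilde_maxtens : maxtens phit.
Proof. by rewrite phitE; apply: maxtens_csum => k; apply/maxtens_ideal/val_ideal. Qed.

(** The bracket with the diagonal copy of x is a derivation of the Poisson bracket that kills both
    arguments of log Phi. *)
Lemma phi_tilde_invariant x : P 3 (cgen [ffun=> x]) phit = 0.
Proof.
have dP := kk_derivation_r (brP 3) (cgen [ffun=> x]).
rewrite /phi_tilde tpoissonE //.
apply: (lie_eval_derivation (pP 3) charK th2 PsiL (F := P 3 (cgen [ffun=> x]))).
- exact: derivation_lin dP.
- by move=> k; exists k.+1 => h; apply: (derivation_filt dP).
- by move=> f h; rewrite (kk_hamiltonian (brP 3) _ f h) subrK.
by case; apply: poisson_diag_casimir; rewrite ?sl_eq.
Qed.

Lemma phi_metr_invariant : ad_invariant mu phi.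
Proof.
move=> x; rewrite (ad_actE gP) -(phi_metrE gP).
have := kk_hamiltonian (brP 3) (cgen [ffun=> x]) (tbar t 1 2) (tbar t 2 3).
rewrite !poisson_diag_casimir ?sl_eq // (plike0l (pP 3)) (plike0r (pP 3)) subr0.
by move<-.
Qed.

(** Alternation preserves the filtration and fixes phi, whose six signed permutations coincide. *)
Lemma alt3_phi_tilde : filt 4 (alt3 phit - phi).
Proof.
have pP' s := sym_mapP (@insert_lin K g 3 3 (fun i => [:: (s : 'S_3) i])).
have altE : alt3 phi = phi.
  rewrite /alt3; under eq_bigr do
    rewrite (phi_metr_alternating gP) scalerA -expr2 sqrr_sign scale1r.
  rewrite sumr_const card_Sn -scaler_nat scalerA mulVf ?scale1r //.
  exact: natrS_neq0.
rewrite -altE /alt3 -scalerBr -sumrB; apply/filtZ/filt_sum => s _.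
rewrite -scalerBr; apply: filtZ; rewrite !place_inE -(cmorphismB (pP' s)).
exact/(cmorphism_filt (pP' s))/phi_tilde_lead.
Qed.

Lemma alt3_phi_tilde_maxtens : maxtens (alt3 phit).
Proof.
apply/maxtensZ/maxtens_sum => s _; apply: maxtensZ.
have vS : summable (fun k => val k).
  by apply: filt_summable => k; apply: (filtW (leqnSn k) (@valF k)).
rewrite phitE place_inE (cmorphism_csum (sym_mapP (@insert_lin _ _ _ _ _)) vS).
apply: maxtens_csum => k; rewrite -[X in maxtens X]place_inE.
exact/maxtens_ideal/tensor_ideal_place.
Qed.

Lemma phi_tilde_reduction :
  reduction (kk_poisson mu) (@Delta0 K g) phit mu (fun _ => 0) phi.
Proof.
split.
- move=> a b x y [a1 a2] [b1 b2]; split; first exact: kk_poisson_filt1.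
  (* Replace [a] and then [b] by its linear part: each error pairs order 2 with order 1, and the
     bracket loses one. *)
  have -> : kk_poisson mu a b - cgen (mu x y)
      = kk_poisson mu (a - cgen x) b + kk_poisson mu (cgen x) (b - cgen y).
    rewrite (derivationB (kk_derivation_l muP b)) (derivationB (kk_derivation_r muP _)).
    by rewrite kk_gen // addrA subrK.
  apply: filtD; first exact: (plike_filt (kk_plike muP) (i := 1) (j := 0)).
  exact: (plike_filt (kk_plike muP) (i := 0) (j := 1) (@filt_gen _ _ _ _)).
- move=> a x _; suff -> : Delta0 a - place2 1 2 1 (Delta0 a) = 0.
    by split; [apply: maxtens0 | rewrite subrr; apply: filt0].
  (* [Delta0] is cocommutative, being induced by the diagonal map into two slots. *)
  apply/eqP; rewrite subr_eq0 /place2 place_inE !Delta0E sym_map_comp;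
    [|exact: embs_lin|exact: insert_lin].
  apply/eqP; congr (sym_map _ a); apply: funext => y /=.
  rewrite insert_embs /= eqxx sl_eq //= /embs !big_cons !big_nil !addr0.
  by rewrite addrC.
by split; [apply: alt3_phi_tilde_maxtens | apply: alt3_phi_tilde].
Qed.

Lemma phi_tilde_drinfeld : drinfeld_algebra (kk_poisson mu) (@Delta0 K g) phit.
Proof.
have sw n (i : 'I_n) (x : g) : slot i (cgen x) = cgen (embs [:: i] x) :> tpow g n.
  by rewrite slot_gen /embs big_seq1.
have u2 : uniq [:: sl 1 1; sl 1 2] by rewrite /= inE sl_eq.
split.
- exact: kk_poisson_structure.
- by move=> f h; apply: kk_poisson_filt1.
- have dP := sym_mapP (@embs_lin K g 2 [:: sl 1 1; sl 1 2]).
  split=> [c f h|f h|]; rewrite !Delta0E.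
  + exact: cmorphism_lin dP _ _ _.
  + exact: cmorphism_mul dP _ _.
  + exact: cmorphism_one dP.
- move=> k; exists k => f fk; rewrite Delta0E.
  exact: cmorphism_filt (sym_mapP (@embs_lin K g 2 [:: sl 1 1; sl 1 2])) _ _ fk.
- move=> f h; rewrite tpoissonE // !Delta0E.
  apply: (sym_map_poisson (@embs_lin K g 2 [:: sl 1 1; sl 1 2]) muP (brP 2)) => u v.
  exact: (embs_bracket muP _ _ u2).
- move=> a; have cL (i : 'I_2) c (u v : {ffun 'I_2 -> g}) :
    (c *: u + v) i = c *: u i + v i by rewrite !ffunE.
  rewrite /counitl -[cmor _ _]/(sym_map (fun u : {ffun 'I_2 -> g} => u (sl 1 2)) _).
  rewrite Delta0E sym_map_comp; [|exact: embs_lin|exact: cL].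
  apply: sym_map_id => x /=.
  by rewrite (embsE _ _ u2) !inE eqxx orbT.
- move=> a; have cL (i : 'I_2) c (u v : {ffun 'I_2 -> g}) :
    (c *: u + v) i = c *: u i + v i by rewrite !ffunE.
  rewrite /counitr -[cmor _ _]/(sym_map (fun u : {ffun 'I_2 -> g} => u (sl 1 1)) _).
  rewrite Delta0E sym_map_comp; [|exact: embs_lin|exact: cL].
  apply: sym_map_id => x /=.
  by rewrite (embsE _ _ u2) !inE eqxx.
- exact: phi_tilde_maxtens.
- move=> a.
  (* Both iterated coproducts are induced by the diagonal map into three slots. *)
  pose D := @embs K g 3 [:: sl 2 1; sl 2 2; sl 2 3].
  have n1 : nat_of_ord (sl 1 1) = 0%N by rewrite /= inordK.
  have n2 : nat_of_ord (sl 1 2) = 1%N by rewrite /= inordK.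
  have ord2 (i : 'I_2) : i = sl 1 1 \/ i = sl 1 2.
    by case: i => [[|[|//]]] ?; [left|right]; apply: val_inj; rewrite /= inordK.
  have E (F : 2.-tuple (symhat g -> tpow g 3)) (I : seq (seq 'I_3)) :
      (forall x, tnth F (sl 1 1) (cgen x) = cgen (embs (nth [::] I 0) x)) ->
      (forall x, tnth F (sl 1 2) (cgen x) = cgen (embs (nth [::] I 1) x)) ->
      nth [::] I 0 ++ nth [::] I 1 = [:: sl 2 1; sl 2 2; sl 2 3] ->
      tmap F (Delta0 a) = sym_map D a.
    move=> F1 F2 I12; rewrite (@tmapE _ _ _ _ _ (fun i : 'I_2 => nth [::] I i)).
      rewrite Delta0E sym_map_comp; [|exact: embs_lin|exact: insert_lin].
      congr (sym_map _ a); apply: funext => x.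
      by rewrite /= insert_embs /= n1 n2 cats0 I12.
    by move=> i x; case: (ord2 i) => ->; rewrite ?n1 ?n2.
  rewrite (E _ [:: [:: sl 2 1]; [:: sl 2 2; sl 2 3]]) //; last 2 first.
  + by move=> x; rewrite (tnth_nth (slot (sl 2 1))) n1 /= sw.
  + by move=> x; rewrite (tnth_nth (slot (sl 2 1))) n2 /= place2_Delta0_gen.
  rewrite (E _ [:: [:: sl 2 1; sl 2 2]; [:: sl 2 3]]) //; last 2 first.
  + by move=> x; rewrite (tnth_nth (slot (sl 2 1))) n1 /= place2_Delta0_gen.
  + by move=> x; rewrite (tnth_nth (slot (sl 2 1))) n2 /= sw.
  have DE x : D x = [ffun=> x].
    apply/ffunP => i; rewrite /D embsE ?ffunE; last by rewrite /= !inE !sl_eq.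
    by rewrite !inE; case: (ord3_sl i) => ->; rewrite eqxx ?orbT.
  have DP := sym_mapP (@embs_lin K g 3 [:: sl 2 1; sl 2 2; sl 2 3]).
  (* phi~ Poisson-commutes with the generators of the image of the iterated coproduct, hence with
     the whole image by density; exp(P(phi~, -)) then reduces to its term of index 0. *)
  have inv b : P 3 phit (sym_map D b) = 0.
    elim/cpalg_dense_ind: b.
    * move=> c; rewrite (cmorphismZ DP) (cmorphism_one DP).
      exact: (derivation_cst (kk_derivation_r (brP 3) _)).
    * move=> x; rewrite sym_map_gen; last exact: embs_lin.
      by rewrite DE (kk_anti (brP 3)) phi_tilde_invariant oppr0.
    * move=> f h fQ hQ; rewrite (cmorphismD DP).
      by rewrite (derivationD (kk_derivation_r (brP 3) _)) fQ hQ addr0.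
    * move=> f h fQ hQ; rewrite (cmorphism_mul DP) (kk_mulr (brP 3)) fQ hQ.
      by rewrite mul0r mulr0 addr0.
    move=> f fQ; apply: filt_eq => k; rewrite subr0.
    have [h hQ fh] := fQ k.+1.
    rewrite -[sym_map D f](subrK (sym_map D h)) -(cmorphismB DP).
    rewrite (derivationD (kk_derivation_r (brP 3) _)) hQ addr0.
    exact/(derivation_filt (kk_derivation_r (brP 3) _) (k := k.+1))/(cmorphism_filt DP).
  rewrite tpoissonE // /expad (@csum_finite _ _ _ _ 1).
    by rewrite big_ord1 invr1 scale1r.
  have it0 k : iter k.+1 (P 3 phit) (sym_map D a) = 0.
    elim: k => [|k IHk]; first exact: inv.
    by rewrite iterS IHk (plike0r (pP 3)).
  by case=> // k _; rewrite it0 scaler0.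
move=> st s d.
have E (F : 3.-tuple (symhat g -> tpow g 4)) (I : 3.-tuple (seq nat)) :
    (forall x, tnth F (sl 2 1) (cgen x) = cgen (embs (map (sl 3) (nth [::] I 0)) x)) ->
    (forall x, tnth F (sl 2 2) (cgen x) = cgen (embs (map (sl 3) (nth [::] I 1)) x)) ->
    (forall x, tnth F (sl 2 3) (cgen x) = cgen (embs (map (sl 3) (nth [::] I 2)) x)) ->
    tmap F phit = sym_map (insert (fun i => map (sl 3) (tnth I i))) phit.
  move=> F1 F2 F3; apply: tmapE => i x; rewrite (tnth_nth [::] I).
  by case: (ord3_sl i) => -> /=; rewrite inordK.
have sE k x : s k (cgen x) = cgen (embs [:: sl 3 k] x) by apply: sw.
have dE k l x : d k l (cgen x) = cgen (embs [:: sl 3 k; sl 3 l] x).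
  exact: place2_Delta0_gen.
have [t1 t2 t3] : [/\ nat_of_ord (sl 2 1) = 0, nat_of_ord (sl 2 2) = 1
    & nat_of_ord (sl 2 3) = 2]%N by split; rewrite /= inordK.
have T (F : 3.-tuple (symhat g -> tpow g 4)) i : tnth F i = nth (s 1%N) F i.
  exact: tnth_nth.
rewrite /st tpoissonE //.
rewrite (E _ [tuple [:: 1]; [:: 2]; [:: 3; 4]]%N); try by
  move=> x; rewrite T ?t1 ?t2 ?t3 /= ?sE ?dE.
rewrite (E _ [tuple [:: 1; 2]; [:: 3]; [:: 4]]%N); try by
  move=> x; rewrite T ?t1 ?t2 ?t3 /= ?sE ?dE.
rewrite (E _ [tuple [:: 2]; [:: 3]; [:: 4]]%N); try by
  move=> x; rewrite T ?t1 ?t2 ?t3 /= ?sE ?dE.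
rewrite (E _ [tuple [:: 1]; [:: 2; 3]; [:: 4]]%N); try by
  move=> x; rewrite T ?t1 ?t2 ?t3 /= ?sE ?dE.
rewrite (E _ [tuple [:: 1]; [:: 2]; [:: 3]]%N); try by
  move=> x; rewrite T ?t1 ?t2 ?t3 /= ?sE ?dE.
exact: phi_tilde_pentagon.
Qed.

End Lift.

Theorem proposition1p9 (K : fieldType) (charK : [pchar K] =i pred0)
    (g : lmodType K) (mu : g -> g -> g) (t : seq (g * g))
    (gP : metrized mu t)
    (Phi : ncseries K) (PhiP : lie_associator Phi) :
  let phi := phi_metr mu t in
  (alternating3 phi /\ ad_invariant mu phi) /\
  is_lift (kk_poisson mu) (@Delta0 K g) (phi_tilde mu Phi t)
    mu (fun _ => 0) phi.
Proof.
split; first by split; [apply: phi_metr_alternating | apply: phi_metr_invariant].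
by split; [apply: phi_tilde_drinfeld | apply: phi_tilde_reduction].
Qed.
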